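(* Let $\mu(d\theta,dx_1,\dots,dx_K)=\mu_0(d\theta)\prod_{k=1}^K\mathcal{M}_k(\theta,dx_k)$ be a partially-factorized probability distribution on $(\Theta\times S,\mathcal{T}\times\mathcal{S})$ and let $$\mu^{M,N}_\times(\varphi):=\frac{1}{MN^K}\sum_{m=1}^M\sum_{\mathbf{n}\in[N]^K}\varphi(\theta^m,X^{m,\mathbf{n}}).$$ If $\varphi$ is $\mu$-integrable, then $\mu^{M,N}_\times(\varphi)$ is unbiased and strongly consistent: for all $N>0$, $$\mathbb{E}[\mu^{M,N}_\times(\varphi)]=\mu(\varphi)\quad\forall M>0,\qquad\lim_{M\to\infty}\mu^{M,N}_\times(\varphi)=\mu(\varphi)\ \text{ almost surely}.$$ If, furthermore, $\varphi\in L^2_\mu$, then $\mathcal{M}_{[K]\setminus A}(\varphi)\in L^2_{\mu_0\otimes\mathcal{M}_A}$ for all subsets $A$ of $[K]$, and the estimator is asymptotically normal: $$M^{1/2}[\mu^{M,N}_\times(\varphi)-\mu(\varphi)]\Rightarrow\mathcal{N}(0,\sigma^2_{\times,N}(\varphi))\ \text{ as }M\to\infty,\quad\forall N>0,$$ where $\Rightarrow$ denotes convergence in distribution and $$\sigma^2_{\times,N}(\varphi):=\mu_0([\mathcal{M}\varphi-\mu(\varphi)]^2)+\sum_{\emptyset\neq A\subseteq[K]}\frac{1}{N^{|A|}}\sum_{B\subseteq A}(-1)^{|A|-|B|}\mu_0(\mathcal{M}_B[\mathcal{M}_{[K]\setminus B}\varphi-\mathcal{M}\varphi]^2).$$ For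 any $N,M>0$, the estimator's variance is given by $\mathrm{Var}(\mu^{M,N}_\times(\varphi))=\sigma^2_{\times,N}(\varphi)/M$.
   Context: $K>1$ is an integer, $[K]:=\{1,\dots,K\}$; $(\Theta,\mathcal{T})$ and $(S_k,\mathcal{S}_k)$, $k\in[K]$, are measurable spaces; $S:=S_1\times\dots\times S_K$ with product sigma-algebra $\mathcal{S}$. $\mu_0$ is a probability distribution on $(\Theta,\mathcal{T})$ and each $\mathcal{M}_k$ is a Markov kernel from $(\Theta,\mathcal{T})$ to $(S_k,\mathcal{S}_k)$. For $A\subseteq[K]$, $\mathcal{M}_A(\theta,dx_A):=\prod_{k\in A}\mathcal{M}_k(\theta,dx_k)$, $\mathcal{M}:=\mathcal{M}_{[K]}$, and $(\mu_0\otimes\mathcal{M}_A)(d\theta,dx_A):=\mu_0(d\theta)\mathcal{M}_A(\theta,dx_A)$. $\mathcal{M}_A(\varphi)=\mathcal{M}_A\varphi$ denotes the function of $\theta$ and $(x_k)_{k\notin A}$ obtained by integrating out $(x_k)_{k\in A}$ from $\varphi(\theta,x)$ with respect to $\mathcal{M}_A(\theta,dx_A)$ ($\mathcal{M}_\emptyset\varphi:=\varphi$); these partial integrals are assumed well-defined at every point. $\mu(\varphi):=\int\varphi\,d\mu$; $L^2_\nu$ is the space of square $\nu$-integrable real-valued functions; $|A|$ is the cardinality of $A$. Sampling: for fixed $N$, the tuples $(\theta^m,X^{m,1},\dots,X^{m,N})$, $m=1,2,\dots$, are i.i.d., with $\theta^m\sim\mu_0$ and, conditionally on $\theta^m$,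 $X^{m,1},\dots,X^{m,N}$ i.i.d. with law $\mathcal{M}(\theta^m,\cdot)$ (i.e. the tuple has law $\mu_0\otimes\mathcal{M}^N$). Writing $X^{m,n}=(X^{m,n}_1,\dots,X^{m,n}_K)$, for $\mathbf{n}=(n_1,\dots,n_K)\in[N]^K$ set $X^{m,\mathbf{n}}:=(X^{m,n_1}_1,\dots,X^{m,n_K}_K)$. *)

(* Defs.v *)
From HB Require Import structures.
From mathcomp Require Import all_boot all_order all_algebra finmap.
From mathcomp Require Import all_classical all_reals all_analysis.
From mathcomp Require Import measurable_realfun.

Set Implicit Arguments.
Unset Strict Implicit.
Unset Printing Implicit Defensive.
Import Order.TTheory GRing.Theory Num.Theory.
Import numFieldNormedType.Exports.

Local Open Scope classical_set_scope.
Local Open Scope ring_scope.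

Definition iprod_display (I : Type) (d : I -> measure_display) :
  measure_display.
Proof. exact: default_measure_display. Qed.

Definition iprod (I : finType) (d : I -> measure_display)
  (T : forall i, measurableType (d i)) : Type := forall i, T i.

Section iprod_measurable.
Context (I : finType) (d : I -> measure_display).
Variable T : forall i, measurableType (d i).

Definition iprod_cylinder : set (set (iprod T)) :=
  [set C | exists i (A : set (T i)),
    measurable A /\ C = [set x : iprod T | A (x i)]].

HB.instance Definition _ := gen_eqMixin (iprod T).
HB.instance Definition _ := gen_choiceMixin (iprod T).
HB.instance Definition _ := isPointed.Build (iprod T) (fun=> point).

HB.instance Definition _ := @isMeasurable.Build (iprod_display d)
  (iprod T) <<s iprod_cylinder >> (@sigma_algebra0 _ setT iprod_cylinder)
  (@sigma_algebraC _ iprod_cylinder)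
  (@sigma_algebra_bigcup _ setT iprod_cylinder).

Lemma measurable_iprod_proj i :
  measurable_fun [set: iprod T] (fun x : iprod T => x i).
Proof.
move=> _ A mA; rewrite setTI; apply: sub_sigma_algebra.
by exists i, A.
Qed.

Lemma measurable_fun_iprod d0 (X : measurableType d0) (f : X -> iprod T) :
  (forall i, measurable_fun [set: X] (fun x => f x i)) ->
  measurable_fun [set: X] f.
Proof.
move=> mf; apply: (@measurability _ _ _ _ setT f iprod_cylinder) => //.
move=> _ [_ [i [A [mA ->]]] <-]; exact: mf.
Qed.

Lemma measurable_iprod_rect (A : forall i, set (T i)) :
  (forall i, measurable (A i)) ->
  measurable [set x : iprod T | forall i, A i (x i)].
Proof.
move=> mA.
have -> : [set x : iprod T | forall i, A i (x i)] =
    \bigcap_(i in [set: I]) [set x : iprod T | A i (x i)].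
  by apply/seteqP; split => x /= h i; [move=> _|]; exact: h.
apply: fin_bigcap_measurable => [|i _]; first exact: finite_finset.
by rewrite -[X in measurable X]setTI; exact: measurable_iprod_proj.
Qed.

End iprod_measurable.

Section kpull.
Context d1 d2 d3 (X : measurableType d1) (Y : measurableType d2)
  (Z : measurableType d3) (R : realType).
Variables (k : R.-pker Y ~> Z) (f : X -> Y).

Definition kpull (mf : measurable_fun [set: X] f) (x : X) :
  {measure set Z -> \bar R} := k (f x).

Hypothesis mf : measurable_fun [set: X] f.

Let measurable_kpull U : measurable U ->
  measurable_fun [set: X] (kpull mf ^~ U).
Proof.
move=> mU; rewrite (_ : (fun _ => _) = (k ^~ U) \o f)//.
exact: measurableT_comp (measurable_kernel k _ mU) mf.
Qed.

HB.instance Definition _ := isKernel.Build _ _ _ _ _ (kpull mf) measurable_kpull.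

Let kpull_prob x : kpull mf x [set: Z] = 1%E.
Proof. exact: prob_kernel. Qed.

HB.instance Definition _ :=
  Kernel_isProbability.Build _ _ _ _ _ (kpull mf) kpull_prob.

End kpull.

Section kpcomp.
Context d1 d2 d3 (X : measurableType d1) (Y : measurableType d2)
  (Z : measurableType d3) (R : realType).
Variables (l : R.-pker X ~> Y) (k : R.-pker (X * Y) ~> Z).

Definition kpcomp : X -> {measure set Z -> \bar R} := mkcomp l k.

HB.instance Definition _ := isKernel.Build _ _ X Z R kpcomp
  (measurable_fun_mkcomp_sfinite l k).

Let kpcomp_prob x : kpcomp x [set: Z] = 1%E.
Proof.
rewrite /kpcomp /mkcomp /= /kcomp (eq_integral (cst 1%E)).
  by rewrite integral_cst// mul1e; exact: prob_kernel.
by move=> y _; exact: prob_kernel.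
Qed.

HB.instance Definition _ :=
  Kernel_isProbability.Build _ _ _ _ _ kpcomp kpcomp_prob.

End kpcomp.

Section kprod.
Context d0 (X : measurableType d0) (R : realType) (I : finType).
Context (d : I -> measure_display) (T : forall i, measurableType (d i)).
Variable k : forall i, R.-pker X ~> T i.

Let upd i (p : (X * iprod T) * T i) : X * iprod T :=
  (p.1.1, dfwith p.1.2 i p.2).

Let measurable_upd i : measurable_fun [set: (X * iprod T) * T i] (@upd i).
Proof.
apply/measurable_fun_pairP; split => /=.
  exact: (measurableT_comp measurable_fst measurable_fst).
apply: measurable_fun_iprod => j.
have [<-|ij] := eqVneq i j.
  rewrite (_ : (fun _ => _) = snd); first exact: measurable_snd.
  by apply/funext => p /=; rewrite dfwithin.
rewrite (_ : (fun _ => _) = (fun x : iprod T => x j) \o snd \o fst).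
  apply: measurableT_comp; last exact: measurable_fst.
  apply: measurableT_comp; last exact: measurable_snd.
  exact: measurable_iprod_proj.
by apply/funext => p /=; rewrite dfwithout.
Qed.

(* From (a, x), redraw the coordinates of x listed in s, independently and
   with laws k i a; the other coordinates are left unchanged. *)
Fixpoint kresample (s : seq I) : R.-pker (X * iprod T) ~> iprod T :=
  match s with
  | [::] => kdirac (@measurable_snd _ _ X (iprod T))
  | i :: s' => kpcomp (kpull (k i) (@measurable_fst _ _ X (iprod T)))
                      (kpull (kresample s') (@measurable_upd i))
  end.

Lemma measurable_pair_point :
  measurable_fun [set: X] (fun a : X => (a, point : iprod T)).
Proof. exact: measurable_pair2. Qed.

(* Every coordinate is redrawn, so the starting point is irrelevant: this is
   the product kernel, as characterized on rectangles by kprodE. *)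
Definition kprod : R.-pker X ~> iprod T :=
  kpull (kresample (enum I)) measurable_pair_point.

Lemma kresampleE s a x (A : forall i, set (T i)) : uniq s ->
  (forall i, measurable (A i)) ->
  kresample s (a, x) [set y : iprod T | forall i, A i (y i)] =
  (\prod_(i <- s) k i a (A i) * \prod_(i | i \notin s) (\1_(A i) (x i))%:E)%E.
Proof.
move=> + mA; elim: s x => [|i s IH] x /=.
  move=> _; rewrite big_nil mul1e /kdirac /dirac /= prodEFin indicE.
  congr (_%:E); have [xA|xA] := boolP (x \in _).
    rewrite big1// => i _; rewrite indicE mem_set//.
    by move: xA; rewrite inE; exact.
  have [i Ai] : exists i, ~ A i (x i).
    by apply/existsNP => h; move: xA; rewrite notin_setE; exact.
  by rewrite (bigD1 i)//= indicE memNset// mul0r.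
move=> /andP[iNs us]; rewrite /kpcomp /mkcomp /= /kcomp /= /kpull /=.
rewrite big_cons.
set c1 : \bar R := (\prod_(j <- s) _)%E.
set c2 : \bar R := (\prod_(j | _) _)%E.
have c10 : (0 <= c1)%E by apply: prode_ge0 => j _.
have c20 : (0 <= c2)%E by apply: prode_ge0 => j _; rewrite lee_fin.
transitivity (\int[k i a]_y (c1 * c2 * (\1_(A i) y)%:E))%E.
  apply: eq_integral => y _; rewrite IH// (bigD1 i)//= dfwithin.
  rewrite -muleA [in RHS](muleC c2); congr (_ * (_ * _))%E.
  apply: eq_big => [j|j /andP[_ ji]]; first by rewrite inE negb_or andbC.
  by rewrite dfwithout// eq_sym.
rewrite ge0_integralZl ?mule_ge0//.
  by rewrite integral_indic// setIT muleC muleA.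
exact/measurable_EFinP/measurable_indic.
Qed.

Lemma kprodE a (A : forall i, set (T i)) :
  (forall i, measurable (A i)) ->
  kprod a [set x : iprod T | forall i, A i (x i)] =
  (\prod_i k i a (A i))%E.
Proof.
move=> mA; rewrite /kprod /= /kpull kresampleE ?enum_uniq//.
rewrite [X in (_ * X)%E]big1 ?mule1 ?big_enum//.
by move=> i; rewrite mem_enum.
Qed.

End kprod.

Section kjoint.
Context d1 d2 (X : measurableType d1) (Y : measurableType d2) (R : realType).
Variables (m : probability X R) (k : R.-pker X ~> Y).

(* m (dx) k (x, dy) *)
Definition kjoint (A : set (X * Y)) : \bar R :=
  (\int[m]_x k x (xsection A x))%E.

Let kjoint0 : kjoint set0 = 0%E.
Proof.
rewrite /kjoint (eq_integral (cst 0%E)) ?integral0// => x _.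
by rewrite xsection0 measure0.
Qed.

Let kjoint_ge0 A : (0 <= kjoint A)%E.
Proof. exact: integral_ge0. Qed.

Let kjoint_sigma_additive : semi_sigma_additive kjoint.
Proof.
move=> U mU tU mUU; rewrite [X in _ --> X](_ : _ =
  \int[m]_x (\sum_(n <oo) k x (xsection (U n) x)))%E; last first.
  apply: eq_integral => x _; apply/esym/cvg_lim => //.
  rewrite xsection_bigcup; apply: measure_semi_sigma_additive.
  - by move=> n; exact: measurable_xsection.
  - exact: trivIset_xsection.
  - by apply: bigcup_measurable => n _; exact: measurable_xsection.
apply/cvg_closeP; split.
  by apply: is_cvg_nneseries => n _ _; exact: integral_ge0.
rewrite closeE// integral_nneseries// => n.
by apply: measurable_fun_xsection_finite_kernel; rewrite inE.
Qed.

HB.instance Definition _ := isMeasure.Build _ _ _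
  kjoint kjoint0 kjoint_ge0 kjoint_sigma_additive.

Let kjoint_setT : kjoint setT = 1%E.
Proof.
rewrite /kjoint (eq_integral (cst 1%E)).
  by rewrite integral_cst// mul1e; exact: probability_setT.
move=> x _; rewrite (_ : xsection _ _ = setT) ?prob_kernel//.
by apply/seteqP; split => y // _; rewrite /xsection /= inE.
Qed.

HB.instance Definition _ :=
  Measure_isProbability.Build _ _ _ kjoint kjoint_setT.

End kjoint.

Lemma kjointX d1 d2 (X : measurableType d1) (Y : measurableType d2)
    (R : realType) (m : probability X R) (k : R.-pker X ~> Y) A B :
  measurable A -> measurable B ->
  kjoint m k (A `*` B) = (\int[m]_(x in A) k x B)%E.
Proof.
move=> mA mB; rewrite /kjoint [RHS]integral_mkcond; apply: eq_integral => x _.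
rewrite patchE; case: ifPn => xA; first by rewrite in_xsectionX.
by rewrite notin_xsectionX// measure0.
Qed.

Section partial_integration.
Context d0 (Theta : measurableType d0) (R : realType) (K : nat).
Context (d : 'I_K -> measure_display) (S : forall k, measurableType (d k)).
Implicit Types (A B : {set 'I_K}) (phi : Theta * iprod S -> R).

Definition subprod A := iprod (fun k : {k : 'I_K | k \in A} => S (val k)).

(* the point of S with coordinates x on A and y outside A *)
Definition glue A (x : subprod A) (y : subprod (~: A)) : iprod S :=
  fun k => match boolP (k \in A) with
  | AltTrue kA => x (exist _ k kA)
  | AltFalse kA => y (exist _ k (etrans (finset.in_setC k A) kA))
  end.

Variable Mk : forall k, R.-pker Theta ~> S k.

Definition subkernel A : R.-pker Theta ~> subprod A :=
  kprod (fun k : {k : 'I_K | k \in A} => Mk (val k)).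

(* M_([K] \ A) phi, as a function of theta and of the remaining coordinates *)
Definition partial_int A phi (p : Theta * subprod A) : R :=
  \int[subkernel (~: A) p.1]_y phi (p.1, glue p.2 y).

Definition full_int phi (t : Theta) : R := \int[kprod Mk t]_x phi (t, x).

Definition partial_int_defined phi := forall A (t : Theta) (x : subprod A),
  (subkernel (~: A) t).-integrable setT (fun y => (phi (t, glue x y))%:E).

Variable mu0 : probability Theta R.

Definition asymptotic_variance (N : nat) phi : R :=
  \int[mu0]_t (full_int phi t - \int[kjoint mu0 (kprod Mk)]_p phi p) ^+ 2 +
  \sum_(A : {set 'I_K} | A != finset.set0) (N%:R ^+ #|A|)^-1 *
    \sum_(B : {set 'I_K} | B \subset A) (-1) ^+ (#|A| - #|B|) *
      \int[mu0]_t \int[subkernel B t]_x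
        (partial_int phi (t, x) - full_int phi t) ^+ 2.

End partial_integration.

Section sampling.
Context d0 (Omega : measurableType d0) (R : realType) (P : probability Omega R).

Definition mutually_independent d (T : measurableType d)
    (Z : nat -> {RV P >-> T}) :=
  forall (J : {fset nat}) (A : nat -> set T), (forall m, measurable (A m)) ->
    P (\bigcap_(m in [set` J]) (Z m @^-1` A m)) =
    (\prod_(m <- J) P (Z m @^-1` A m))%E.

Definition iid d (T : measurableType d) (law : probability T R)
    (Z : nat -> {RV P >-> T}) :=
  (forall m A, measurable A -> distribution P (Z m) A = law A) /\
  mutually_independent Z.

Definition cvg_in_distribution (X : nat -> Omega -> R)
    (law : probability (measurableTypeR R) R) :=
  (forall n, measurable_fun [set: Omega] (X n)) /\
  forall f : R -> R, continuous f -> bounded_fun f ->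
    'E_P[f \o X n]%E @[n --> \oo] --> (\int[law]_x (f x)%:E)%E.

End sampling.

(* The normal law with mean m and variance v; normal_prob takes the standard
   deviation, and is not the Dirac mass when this is 0. *)
Definition normal_law (R : realType) (m v : R) :
    probability (measurableTypeR R) R :=
  if v == 0 then (@dirac _ (measurableTypeR R) m R : probability _ R)
  else (normal_prob m (Num.sqrt v) : probability _ R).

Section estimator.
Context d0 (Theta : measurableType d0) (R : realType) (K : nat).
Context (d : 'I_K -> measure_display) (S : forall k, measurableType (d k)).

(* the type of (theta, (X^1, ..., X^N)) *)
Definition sample (N : nat) : measurableType _ :=
  (Theta * iprod (fun _ : 'I_N => iprod S))%type.

Definition sample_law (mu0 : probability Theta R)
    (Mk : forall k, R.-pker Theta ~> S k) (N : nat) :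
    probability (sample N) R :=
  kjoint mu0 (kprod (fun _ : 'I_N => kprod Mk)).

Definition cross_estimator (phi : Theta * iprod S -> R) (N : nat)
    (Omega : Type) (Z : nat -> Omega -> sample N) (M : nat) (w : Omega) : R :=
  (M%:R * N%:R ^+ K)^-1 *
  \sum_(m < M) \sum_(n : {ffun 'I_K -> 'I_N})
    phi ((Z m w).1, fun k => (Z m w).2 (n k) k).

End estimator.

(* Main.v *)
Require Import Defs.
From HB Require Import structures.
From mathcomp Require Import all_boot all_order all_algebra finmap.
From mathcomp Require Import all_classical all_reals all_analysis.
From mathcomp Require Import measurable_realfun ring lra.

Set Implicit Arguments.
Unset Strict Implicit.
Unset Printing Implicit Defensive.
Import Order.TTheory GRing.Theory Num.Theory.
Import numFieldNormedType.Exports.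

Local Open Scope classical_set_scope.
Local Open Scope ring_scope.

(** The estimator is the mean of independent copies of one variable [g], the
    average of [phi (theta, X^n)] over the [N ^ K] selections [n]
    ([cross_average]). Every point [(theta, X^n)] has law [mu] ([select_law]),
    so that [g] has expectation [mu phi]. Unbiasedness is then linearity,
    consistency is the strong law of large numbers ([strong_law]), asymptotic
    normality is the central limit theorem ([central_limit]), and it remains to
    identify the variance of [g] with [asymptotic_variance].

    The second moment of [g] is the average over pairs of selections [n], [n']
    of the expectation of [phi (theta, X^n) * phi (theta, X^n')]. Given [theta],
    the two points share the coordinates in the set [A] where [n] and [n']
    agree, and are independent elsewhere; in other words, they are two
    independent completions of one draw of [(theta, x_A)]
    ([agreement_coupling]). By Fubini's theorem the expectation is the second
    moment [c A] of the partial integral of [phi] over the coordinates outside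
    [A] ([Rintegral_select_mul]), which is finite by Jensen's inequality
    ([Lfun2_partial_int]). On the other side, the variances in
    [asymptotic_variance] are the differences [c B - c set0]
    ([partial_full_variance]). Both expressions are thus linear in the [c B],
    and their coefficients agree: two uniform selections agree exactly on [B]
    with probability [\prod_k (if k \in B then N^-1 else 1 - N^-1)], and the
    expansion of this product is the alternating sum over the sets [A] that
    contain [B] ([agreement_sum], [alternating_sum_weight]).

    The strong law is proved for nonnegative variables along geometric
    subsequences, where truncation, Chebyshev's inequality and the Borel-Cantelli
    lemma need the first moment only ([deviation_ae]); the monotonicity of the
    partial sums fills the gaps ([mean_cvg_of_blocks]).

    The central limit theorem is proved by Lindeberg's replacement of the
    summands by Gaussian variables, one at a time. A Gaussian variable of
    variance [v] enters through the operator [gauss_smooth v] acting on the test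
    function, so that the replacements interpolate between the expectation of
    [f] at the normalized sum and [gauss_smooth v f 0] ([lindeberg_bound]). One
    replacement costs a Taylor error whose sum over all the steps tends to 0
    ([lindeberg_cvg0]). Test functions with a Taylor expansion suffice, because
    they approximate bounded continuous functions uniformly on intervals
    ([smooth_approximation]) and second moments control the tails
    ([clt_bounded]). *)

(** * Product spaces, kernels and iterated integrals *)

(** [G] separates finite measures. This holds of a generating pi-system, but
    unlike a pi-system the notion is inherited by products factor by factor. *)
Definition determining d (T : measurableType d) (R : realType)
    (G : set (set T)) :=
  forall m1 m2 : {measure set T -> \bar R}, (m1 setT < +oo)%E ->
    (forall A, G A -> m1 A = m2 A) ->
    forall A, measurable A -> m1 A = m2 A.

Definition rectangle (I : finType) (d : I -> measure_display)
    (T : forall i, measurableType (d i)) : set (set (iprod T)) :=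
  [set C | exists2 A : (forall i, set (T i)), (forall i, measurable (A i)) &
     C = [set x : iprod T | forall i, A i (x i)]].

Section rectangles.
Context (I : finType) (d : I -> measure_display)
  (T : forall i, measurableType (d i)) (R : realType).

Lemma rectangle_setT : @rectangle I d T setT.
Proof. by exists (fun=> setT) => //; apply/seteqP; split. Qed.

(** Rectangles form a pi-system which contains the cylinders that generate the
    product sigma-algebra. *)
Lemma determining_rectangle : determining R (@rectangle I d T).
Proof.
move=> m1 m2 m1oo m12 A mA.
apply: (measure_unique (@rectangle I d T) (fun=> setT)) => //.
- apply/seteqP; split.
    apply: smallest_sub; first exact: smallest_sigma_algebra.
    move=> _ [i [B [mB ->]]]; apply: sub_sigma_algebra.
    exists (dfwith (fun=> setT) i B).
      by move=> j; case: dfwithP.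
    apply/seteqP; split => x /=.
      by move=> Bx j; case: dfwithP.
    by move/(_ i); rewrite dfwithin.
  apply: smallest_sub; first exact: sigma_algebra_measurable.
  by move=> _ [B mB ->]; exact: measurable_iprod_rect.
- move=> _ _ [B mB ->] [C mC ->]; exists (fun i => B i `&` C i).
    by move=> i; exact: measurableI.
  apply/seteqP; split => x /=; first by move=> [? ?] i; split.
  by move=> h; split=> i; have [] := h i.
- by move=> _; exact: rectangle_setT.
- by rewrite bigcup_const//; exists 0%N.
Qed.

End rectangles.

Lemma determining_measurable d (T : measurableType d) (R : realType) :
  determining R (@measurable d T).
Proof. by move=> m1 m2 _ m12 A mA; exact: m12. Qed.

(** One factor is treated at a time: for a fixed [B], both measures restricted
    to the strip [setT `*` B] project to finite measures on the first factor. *)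
Lemma determining_prod d1 d2 (T1 : measurableType d1) (T2 : measurableType d2)
    (R : realType) (G1 : set (set T1)) (G2 : set (set T2)) :
  G1 setT -> G2 setT -> G2 `<=` measurable ->
  determining R G1 -> determining R G2 ->
  determining R [set C : set (T1 * T2) |
    exists A B, [/\ G1 A, G2 B & C = A `*` B]].
Proof.
move=> G1T G2T mG2 D1 D2 m1 m2 m1oo m12.
have m1fin (A : set (T1 * T2)) : measurable A -> (m1 A < +oo)%E.
  by move=> mA; rewrite (le_lt_trans _ m1oo)// le_measure ?inE.
have step1 A B : measurable A -> G2 B -> m1 (A `*` B) = m2 (A `*` B).
  move=> mA GB; have mB : measurable (setT `*` B : set (T1 * T2)).
    by apply: measurableX => //; exact: mG2.
  have E (m : {measure set (T1 * T2) -> \bar R}) C :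
      m (C `*` B) = pushforward (mrestr m mB) fst C.
    rewrite /pushforward /mrestr; congr (m _); apply/seteqP.
    by split => -[x y] /=; tauto.
  rewrite !E; apply: D1 => //.
    by have := m1fin _ mB; rewrite (E m1).
  move=> C GC; rewrite -[LHS]/(pushforward _ _ _) -[RHS]/(pushforward _ _ _).
  by rewrite -!E; apply: m12; exists C, B.
have step2 A B : measurable A -> measurable B -> m1 (A `*` B) = m2 (A `*` B).
  move=> mA mB0; have mB : measurable (A `*` setT : set (T1 * T2)).
    exact: measurableX.
  have E (m : {measure set (T1 * T2) -> \bar R}) C :
      m (A `*` C) = pushforward (mrestr m mB) snd C.
    rewrite /pushforward /mrestr; congr (m _); apply/seteqP.
    by split => -[x y] /=; tauto.
  rewrite !E; apply: D2 => //.
    by have := m1fin _ mB; rewrite (E m1).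
  move=> C GC; rewrite -[LHS]/(pushforward _ _ _) -[RHS]/(pushforward _ _ _).
  by rewrite -!E; exact: step1.
move=> A mA.
apply: (measure_unique [set A `*` B | A in measurable & B in measurable]
  (fun=> setT)) => //.
- exact: measurable_prod_measurableType.
- move=> _ _ [A1 mA1 [A2 mA2 <-]] [B1 mB1 [B2 mB2 <-]].
  exists (A1 `&` B1); first exact: measurableI.
  by exists (A2 `&` B2); [exact: measurableI|rewrite setXI].
- by move=> _; exists setT => //; exists setT => //; rewrite setXTT.
- by rewrite bigcup_const//; exists 0%N.
- by move=> _ [B mB [C mC <-]]; exact: step2.
Qed.

Section kernel_value.
Context d1 d2 (X : measurableType d1) (Y : measurableType d2) (R : realType).
Variables (k : R.-pker X ~> Y) (x : X).

(** The measure [k x] again, carrying the structure of a probability. *)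
Definition kernel_value : set Y -> \bar R := k x.

HB.instance Definition _ := Measure.on kernel_value.

Let kernel_value_setT : kernel_value [set: Y] = 1%E.
Proof. exact: prob_kernel. Qed.

HB.instance Definition _ :=
  Measure_isProbability.Build _ _ _ kernel_value kernel_value_setT.

End kernel_value.

Definition image_measure d1 d2 (X : measurableType d1) (Y : measurableType d2)
    (R : realType) (mu : {measure set X -> \bar R}) (f : X -> Y)
    (mf : measurable_fun setT f) : {measure set Y -> \bar R} :=
  measure_function_pushforward__canonical__measure_function_Measure mu mf.

Section kjoint_integral.
Context d1 d2 (X : measurableType d1) (Y : measurableType d2) (R : realType).
Variables (m : probability X R) (k : R.-pker X ~> Y).
Local Open Scope ereal_scope.

Let kpair (p : unit * X) : {measure set (X * Y)%type -> \bar R} :=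
  image_measure (k p.2) (measurable_pair1 p.2).

Let kpairE p A : kpair p A = k p.2 (xsection A p.2).
Proof. by rewrite xsectionE. Qed.

Let measurable_kpair U : measurable U -> measurable_fun [set: unit * X] (kpair ^~ U).
Proof.
move=> mU; rewrite (_ : (fun _ => _) = (fun x => k x (xsection U x)) \o snd).
  apply: measurableT_comp => //.
  by apply: measurable_fun_xsection_finite_kernel; rewrite inE.
by apply/funext => p; rewrite kpairE.
Qed.

HB.instance Definition _ := isKernel.Build _ _ _ _ _ kpair measurable_kpair.

Let kpair_prob p : kpair p [set: X * Y] = 1%E.
Proof.
rewrite kpairE (_ : xsection _ _ = setT) ?prob_kernel//.
by apply/seteqP; split => y // _; rewrite /xsection /= inE.
Qed.

HB.instance Definition _ :=
  Kernel_isProbability.Build _ _ _ _ _ kpair kpair_prob.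

(** [kjoint m k] is a composition of kernels: [m], viewed as a kernel from a
    point, followed by the kernel that sends [x] to the image of [k x] under
    [y |-> (x, y)]. *)
Lemma ge0_integral_kjoint (f : X * Y -> \bar R) :
  measurable_fun setT f -> (forall p, 0 <= f p) ->
  \int[kjoint m k]_p f p = \int[m]_x \int[k x]_y f (x, y).
Proof.
move=> mf f0.
pose m' : unit -> pprobability X R := cst m.
have mm' : measurable_fun setT m' by exact: measurable_cst.
transitivity (\int[kcomp (kprobability mm') kpair tt]_p f p).
  apply: eq_measure_integral => A mA _; rewrite /= /kcomp /kjoint.
  by apply: eq_integral => x _; rewrite kpairE.
rewrite integral_kcomp//; apply: eq_integral => x _.
by rewrite ge0_integral_pushforward//=.
Qed.

Lemma measurable_kernel_integral (f : X * Y -> \bar R) :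
  measurable_fun setT f -> (forall p, 0 <= f p) ->
  measurable_fun setT (fun x => \int[k x]_y f (x, y)).
Proof. by move=> mf f0; exact: measurable_fun_integral_sfinite_kernel. Qed.

Lemma measurable_kernel_Rintegral (f : X * Y -> R) :
  measurable_fun setT f ->
  measurable_fun setT (fun x => (\int[k x]_y f (x, y))%R).
Proof.
move=> mf; rewrite /Rintegral.
apply: measurableT_comp => //.
rewrite (_ : (fun x => _) = (fun x => \int[k x]_y ((fun p => (f p)%:E)^\+ (x, y))
   - \int[k x]_y ((fun p => (f p)%:E)^\- (x, y)))); last first.
  by apply/funext => x; rewrite [LHS]integralE; congr (_ - _);
    apply: eq_integral => y _; rewrite ?funeposE ?funenegE.
apply: emeasurable_funB; apply: measurable_kernel_integral => //.
  by apply/measurable_funepos/measurable_EFinP.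
by apply/measurable_funeneg/measurable_EFinP.
Qed.

Section integrable.
Variable f : X * Y -> R.
Hypothesis intf : (kjoint m k).-integrable setT (EFin \o f).

Let mf : measurable_fun setT f.
Proof. by apply/measurable_EFinP; case/integrableP : intf. Qed.

Lemma ae_integrable_kjoint :
  {ae m, forall x, (k x).-integrable setT (fun y => (f (x, y))%:E)}.
Proof.
have mabs : measurable_fun setT (fun p => `|(f p)%:E|).
  by apply: measurableT_comp => //; exact/measurable_EFinP.
have : m.-integrable setT (fun x => \int[k x]_y `|(f (x, y))%:E|).
  apply/integrableP; split; first exact: (measurable_kernel_integral mabs).
  under eq_integral do rewrite gee0_abs ?integral_ge0//.
  by rewrite -(ge0_integral_kjoint mabs)//; case/integrableP : intf.
move/integrable_ae => /(_ measurableT); apply: filterS => x /(_ I) fx.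
apply/integrableP; split.
  by apply/measurable_EFinP; exact: measurableT_comp.
by rewrite ltey_eq; rewrite fx.
Qed.

Let posneg x : (k x).-integrable setT (fun y => (f (x, y))%:E) ->
  ((\int[k x]_y f (x, y))%R)%:E = \int[k x]_y ((f (x, y))%:E).
Proof.
by move=> h; rewrite /Rintegral fineK//; apply: integrable_fin_num.
Qed.

(** The section of [f] at [x] is integrable for almost every [x] only; there the
    inner real integral is the difference of the integrals of the positive and
    negative parts, and its value elsewhere does not matter. *)
Lemma Rintegral_kjoint :
  (\int[kjoint m k]_p f p = \int[m]_x \int[k x]_y f (x, y))%R.
Proof.
have mp : measurable_fun setT (fun p => (f p)%:E)^\+.
  by apply/measurable_funepos/measurable_EFinP.
have mn : measurable_fun setT (fun p => (f p)%:E)^\-.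
  by apply/measurable_funeneg/measurable_EFinP.
rewrite {1}/Rintegral integralE !ge0_integral_kjoint//.
rewrite [RHS]/Rintegral; congr fine.
have E g : measurable_fun setT g -> (forall p, 0 <= g p) ->
    \int[kjoint m k]_p g p < +oo ->
    m.-integrable setT (fun x => \int[k x]_y g (x, y)).
  move=> mg g0 goo; apply/integrableP; split.
    exact: measurable_kernel_integral.
  under eq_integral do rewrite gee0_abs ?integral_ge0//.
  by rewrite -ge0_integral_kjoint.
rewrite -integralB//.
- apply: ae_eq_integral => //.
  + apply: emeasurable_funB; exact: measurable_kernel_integral.
  + by apply/measurable_EFinP; exact: measurable_kernel_Rintegral.
  + have := ae_integrable_kjoint; apply: filterS => x ix _.
    rewrite posneg// [RHS]integralE; congr (_ - _);
    by apply: eq_integral => y _; rewrite ?funeposE ?funenegE.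
- apply: E => //; have := integrable_funepos measurableT intf.
  by case/integrableP => _; under eq_integral do rewrite gee0_abs//.
- apply: E => //; have := integrable_funeneg measurableT intf.
  by case/integrableP => _; under eq_integral do rewrite gee0_abs//.
Qed.

End integrable.
End kjoint_integral.

(** * Change of variables and independent sequences *)

Section constant_kernel.
Context d1 d2 (X : measurableType d1) (Y : measurableType d2) (R : realType).
Variable m : probability Y R.

Let measurable_cst_pprobability :
  measurable_fun [set: X] (cst (m : pprobability Y R)).
Proof. exact: measurable_cst. Qed.

Definition constant_kernel : R.-pker X ~> Y :=
  kprobability measurable_cst_pprobability.

End constant_kernel.

Section image_integral.
Context d1 d2 (X : measurableType d1) (Y : measurableType d2) (R : realType).
Variables (m1 : {measure set X -> \bar R}) (m2 : {measure set Y -> \bar R}).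
Variable f : X -> Y.
Hypothesis mf : measurable_fun setT f.
Hypothesis m12 : forall A, measurable A -> m1 (f @^-1` A) = m2 A.

Lemma ge0_integral_image g : measurable_fun setT g -> (forall y, 0 <= g y)%E ->
  (\int[m1]_x g (f x) = \int[m2]_y g y)%E.
Proof.
move=> mg g0; rewrite -[LHS](@ge0_integral_pushforward _ _ _ _ _ f mf m1 setT)//.
by apply: eq_measure_integral => A mA _; rewrite -m12.
Qed.

Lemma integrable_image g : m2.-integrable setT g ->
  m1.-integrable setT (g \o f).
Proof.
move=> /integrableP[mg goo]; apply/integrableP; split.
  exact: measurableT_comp.
rewrite (ge0_integral_image (g := fun y => `|g y|%E))//.
exact: measurableT_comp.
Qed.

Lemma Rintegral_image g : measurable_fun setT g ->
  \int[m1]_x g (f x) = \int[m2]_y g y.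
Proof.
move=> mg; rewrite /Rintegral; congr fine.
rewrite [LHS]integralE [RHS]integralE; congr (_ - _)%E.
- rewrite -(ge0_integral_image (g := (fun y => (g y)%:E)^\+%E))//.
    by apply: eq_integral => y _; rewrite !funeposE.
  exact/measurable_funepos/measurable_EFinP.
- rewrite -(ge0_integral_image (g := (fun y => (g y)%:E)^\-%E))//.
    by apply: eq_integral => y _; rewrite !funenegE.
  exact/measurable_funeneg/measurable_EFinP.
Qed.

End image_integral.

Section iid.
Context d (T : measurableType d) d1 (Omega : measurableType d1) (R : realType).
Context (P : probability Omega R) (law : probability T R).
Variable Z : nat -> {RV P >-> T}.
Hypothesis iidZ : iid law Z.

Let mZ n : measurable_fun setT (Z n).
Proof. exact: measurable_funPT. Qed.

Lemma iid_law n A : measurable A -> P (Z n @^-1` A) = law A.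
Proof. by move=> mA; rewrite -(iidZ.1 n). Qed.

Definition past n (w : Omega) : iprod (fun _ : 'I_n => T) := fun i => Z i w.
Arguments past : clear implicits.

Lemma measurable_past n : measurable_fun setT (past n).
Proof. by apply: measurable_fun_iprod => i; exact: mZ. Qed.
Arguments measurable_past : clear implicits.

HB.instance Definition _ n :=
  isMeasurableFun.Build _ _ _ _ (past n) (measurable_past n).

Let past_present n w := (past n w, Z n w).

Let measurable_past_present n : measurable_fun setT (past_present n).
Proof. by apply/measurable_fun_pairP; split => //; exact: measurable_past. Qed.

Let prob_past_present n (A : 'I_n -> set T) B :
  (forall i, measurable (A i)) -> measurable B ->
  P [set w | (forall i, A i (Z i w)) /\ B (Z n w)] =
  ((\prod_(i < n) law (A i)) * law B)%E.
Proof.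
move=> mA mB.
(* the event [A i] for an index [i < n], and [B] for the index [n] *)
pose C m := if insub m is Some i then A i else B.
have mC m : measurable (C m) by rewrite /C; case: insubP.
have CA (i : 'I_n) : C i = A i by rewrite /C valK.
have CB : C n = B by rewrite /C insubF// ltnn.
pose J : {fset nat} := [fset m in iota 0 n.+1]%fset.
have := iidZ.2 J C mC.
have -> : \bigcap_(m in [set` J]) (Z m @^-1` C m) =
    [set w | (forall i, A i (Z i w)) /\ B (Z n w)].
  apply/seteqP; split => w /=.
    move=> h; split.
      move=> i; rewrite -CA; apply: h => /=.
      by rewrite in_fset mem_iota/= ltnS ltnW.
    by rewrite -CB; apply: h => /=; rewrite in_fset mem_iota/=.
  move=> [hA hB] m /=; rewrite in_fset mem_iota/= add0n ltnS leq_eqVlt.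
  move=> /predU1P[->|mn]; first by rewrite CB.
  by have := hA (Ordinal mn); rewrite -CA.
move=> ->; rewrite (perm_big (iota 0 n.+1)); last first.
  apply: uniq_perm; rewrite ?fset_uniq ?iota_uniq// => m.
  by rewrite in_fset.
rewrite -[n.+1]addn1 iotaD big_cat big_seq1/= add0n CB iid_law//; congr (_ * _)%E.
rewrite -[n in iota _ n]subn0 -/(index_iota 0 n) big_mkord.
by apply: eq_bigr => i _; rewrite CA iid_law.
Qed.

(** Mutual independence is the product formula on rectangles, and rectangles
    determine the joint law. *)
Lemma iid_past_present n (C : set (iprod (fun _ : 'I_n => T) * T)) :
  measurable C -> P (past_present n @^-1` C) =
  kjoint (distribution P (past n)) (constant_kernel _ law) C.
Proof.
move: C; pose m1 := image_measure P (@measurable_past_present n).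
apply: (@determining_prod _ _ _ _ R (@rectangle _ _ (fun _ : 'I_n => T)) measurable
  (rectangle_setT _) measurableT _ _ _ m1) => //.
- exact: determining_rectangle.
- exact: determining_measurable.
- by rewrite /m1/= /pushforward preimage_setT probability_setT ltry.
move=> _ [_ [B [[A mA ->] mB ->]]].
rewrite [RHS]kjointX//; last exact: measurable_iprod_rect.
rewrite /= /kprobability/= integral_cst//; last exact: measurable_iprod_rect.
transitivity (P [set w | (forall i, A i (Z i w)) /\ B (Z n w)]) => //.
rewrite prob_past_present// muleC; congr (_ * _)%E.
transitivity (P [set w | (forall i, A i (Z i w)) /\ setT (Z n w)]).
  by rewrite prob_past_present// probability_setT mule1.
by congr (P _); apply/seteqP; split => w//= [].
Qed.

(** Integration over [Z n] with the earlier variables frozen. *)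
Lemma integral_past_present n (f : iprod (fun _ : 'I_n => T) * T -> \bar R) :
  measurable_fun setT f -> (forall p, 0 <= f p)%E ->
  (\int[P]_w f (past n w, Z n w) =
   \int[P]_w \int[law]_y f (past n w, y))%E.
Proof.
move=> mf f0.
rewrite (ge0_integral_image (@measurable_past_present n) (@iid_past_present n))//.
rewrite ge0_integral_kjoint//.
rewrite [RHS](@ge0_integral_image _ _ _ _ _ P (distribution P (past n)) _
  (measurable_past n) _ (fun x => \int[law]_y f (x, y))%E)//.
- exact: (@measurable_kernel_integral _ _ _ _ _ (constant_kernel _ law)).
- by move=> x; exact: integral_ge0.
Qed.

Lemma Rintegral_past_present n (f : iprod (fun _ : 'I_n => T) * T -> R) :
  measurable_fun setT f ->
  P.-integrable setT (fun w => (f (past n w, Z n w))%:E) ->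
  \int[P]_w f (past n w, Z n w) = \int[P]_w \int[law]_y f (past n w, y).
Proof.
move=> mf intf.
rewrite (Rintegral_image (@measurable_past_present n) (@iid_past_present n))//.
rewrite Rintegral_kjoint; last first.
  apply/integrableP; split; first exact/measurable_EFinP.
  rewrite -(ge0_integral_image (@measurable_past_present n) (@iid_past_present n)
    (g := fun p => `|(f p)%:E|%E))//; first by case/integrableP : intf.
  by apply: measurableT_comp => //; exact/measurable_EFinP.
rewrite [RHS](@Rintegral_image _ _ _ _ _ P (distribution P (past n)) _
  (measurable_past n) _ (fun x => \int[law]_y f (x, y)))//.
exact: (@measurable_kernel_Rintegral _ _ _ _ _ (constant_kernel _ law)).
Qed.

Lemma Rintegral_iid n (f : T -> R) : measurable_fun setT f ->
  \int[P]_w f (Z n w) = \int[law]_y f y.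
Proof. by move=> mf; rewrite (Rintegral_image (mZ n) (@iid_law n)). Qed.

Lemma ge0_integral_iid n (f : T -> \bar R) : measurable_fun setT f ->
  (forall y, 0 <= f y)%E -> (\int[P]_w f (Z n w) = \int[law]_y f y)%E.
Proof. by move=> mf f0; rewrite (ge0_integral_image (mZ n) (@iid_law n)). Qed.

Lemma integrable_iid n (f : T -> \bar R) : law.-integrable setT f ->
  P.-integrable setT (fun w => f (Z n w)).
Proof. exact: (integrable_image (mZ n) (@iid_law n)). Qed.

(** Independence makes the product of two merely integrable variables
    integrable. *)
Lemma iid_mul_lt i j (f g : T -> R) : (i < j)%N ->
  law.-integrable setT (EFin \o f) -> law.-integrable setT (EFin \o g) ->
  P.-integrable setT (fun w => (f (Z i w) * g (Z j w))%:E) /\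
  \int[P]_w (f (Z i w) * g (Z j w)) = (\int[law]_y f y) * (\int[law]_y g y).
Proof.
move=> ij intf intg.
have mf : measurable_fun setT f by apply/measurable_EFinP; case/integrableP : intf.
have mg : measurable_fun setT g by apply/measurable_EFinP; case/integrableP : intg.
pose h (p : iprod (fun _ : 'I_j => T) * T) := f (p.1 (Ordinal ij)) * g p.2.
have mh : measurable_fun setT h.
  apply: measurable_funM; last exact: measurableT_comp.
  exact: (measurableT_comp mf (measurableT_comp
    (@measurable_iprod_proj _ _ (fun _ : 'I_j => T) (Ordinal ij)) measurable_fst)).
have int : P.-integrable setT (fun w => (f (Z i w) * g (Z j w))%:E).
  apply/integrableP; split.
    apply/measurable_EFinP/measurable_funM; exact: measurableT_comp.
  rewrite (integral_past_present (f := fun p => `|(h p)%:E|%E))//; last first.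
    by apply: measurableT_comp => //; exact/measurable_EFinP.
  under eq_integral.
    move=> w _.
    under eq_integral do rewrite /h/= normrM EFinM.
    rewrite ge0_integralZl//; [|by do 2 apply: measurableT_comp => //].
    over.
  rewrite ge0_integralZr//.
  - rewrite (ge0_integral_iid i (f := fun y => `|f y|%:E))//.
      apply: lte_mul_pinfty; first exact: integral_ge0.
        apply: integrable_fin_num => //; exact: integrable_abse intf.
      by case/integrableP : intg.
    by do 2 apply: measurableT_comp => //.
  - by do 2 apply: measurableT_comp => //; apply: measurableT_comp.
  - exact: integral_ge0.
split => //; rewrite (Rintegral_past_present (f := h))// /h/=.
under eq_Rintegral do rewrite RintegralZl//.
by rewrite RintegralZr ?(Rintegral_iid i mf)//; exact: (integrable_iid i intf).
Qed.

End iid.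

(** * Integrable and square-integrable functions *)

Section integrable_real.
Context d (T : measurableType d) (R : realType).
Implicit Type m : {measure set T -> \bar R}.

Lemma integrable_measurable m (f : T -> R) :
  m.-integrable setT (EFin \o f) -> measurable_fun setT f.
Proof. by move=> /integrableP[mf _]; exact/measurable_EFinP. Qed.

Lemma le_integrable_real m (f g : T -> R) : measurable_fun setT f ->
  (forall x, `|f x| <= g x) -> m.-integrable setT (EFin \o g) ->
  m.-integrable setT (EFin \o f).
Proof.
move=> mf fg ig; apply: le_integrable ig => //; first exact/measurable_EFinP.
by move=> x _ /=; rewrite lee_fin (le_trans (fg x))// ler_norm.
Qed.

Lemma integrable_realD m (f g : T -> R) : m.-integrable setT (EFin \o f) ->
  m.-integrable setT (EFin \o g) ->
  m.-integrable setT (EFin \o (fun x => f x + g x)).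
Proof. by move=> fi gi; exact: (integrableD measurableT fi gi). Qed.

Lemma integrable_realB m (f g : T -> R) : m.-integrable setT (EFin \o f) ->
  m.-integrable setT (EFin \o g) ->
  m.-integrable setT (EFin \o (fun x => f x - g x)).
Proof. by move=> fi gi; exact: (integrableB measurableT fi gi). Qed.

Lemma integrable_realZ m c (f : T -> R) : m.-integrable setT (EFin \o f) ->
  m.-integrable setT (EFin \o (fun x => c * f x)).
Proof. by move=> fi; exact: (integrableZl measurableT c fi). Qed.

Lemma Rintegral_sum m (I : Type) (s : seq I) (f : I -> T -> R) :
  (forall i, m.-integrable setT (EFin \o f i)) ->
  m.-integrable setT (EFin \o (fun x => \sum_(i <- s) f i x)) /\
  \int[m]_x (\sum_(i <- s) f i x) = \sum_(i <- s) \int[m]_x f i x.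
Proof.
move=> fi.
have int (u : seq I) : m.-integrable setT (EFin \o (fun x => \sum_(i <- u) f i x)).
  elim: u => [|i u IH].
    rewrite (_ : _ \o _ = cst 0%E); first exact: integrable0.
    by apply/funext => x /=; rewrite big_nil.
  rewrite (_ : (fun x => _) = fun x => f i x + \sum_(j <- u) f j x).
    exact: integrable_realD.
  by apply/funext => x /=; rewrite big_cons.
split => //; elim: s => [|i s IH].
  rewrite big_nil -[RHS](mul0r (fine (m setT))) -(Rintegral_cst m measurableT).
  by apply: eq_Rintegral => x _; rewrite big_nil.
rewrite big_cons -IH -RintegralD//.
by apply: eq_Rintegral => x _; rewrite big_cons.
Qed.

End integrable_real.

Section probability_integral.
Context d (T : measurableType d) (R : realType) (m : probability T R).
Implicit Types f g : T -> R.

Lemma Rintegral_cst1 c : \int[m]_x c = c.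
Proof.
by rewrite Rintegral_cst// [X in fine X]probability_setT mulr1.
Qed.

Lemma integrable_cst c : m.-integrable setT (EFin \o cst c : T -> \bar R).
Proof.
apply/integrableP; split; first exact/measurable_EFinP.
rewrite [X in (X < _)%E](integral_cst m measurableT `|c|%:E).
by rewrite [X in (_ * X)%E]probability_setT mule1 ltry.
Qed.

Lemma integrable_bounded c f : measurable_fun setT f ->
  (forall x, `|f x| <= c) -> m.-integrable setT (EFin \o f).
Proof. by move=> mf fc; exact: le_integrable_real (integrable_cst c). Qed.

Lemma Lfun2P f : f \in Lfun m 2%:E <-> measurable_fun setT f /\
  m.-integrable setT (fun x => (f x ^+ 2)%:E).
Proof.
split.
  move=> f2; split; first by move: f2; rewrite inE => /andP[/[!inE]].
  exact: Lfun2_integrable_sqr.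
move=> [mf /integrableP[_ f2]]; rewrite inE; apply/andP; split; rewrite inE//.
rewrite /finite_norm unlock /Lnorm/=.
apply: poweR_lty.
under eq_integral do rewrite /= powR_mulrn//.
by move: f2; congr (_ < _)%E; apply: eq_integral => x _; rewrite -normrX.
Qed.

Lemma Lfun2_integrable f : f \in Lfun m 2%:E -> m.-integrable setT (EFin \o f).
Proof.
by move=> f2; apply/Lfun1_integrable; apply: Lfun_subset12 => //; exact: fin_num_measure.
Qed.

Lemma Lfun2_mul f g : f \in Lfun m 2%:E -> g \in Lfun m 2%:E ->
  m.-integrable setT (EFin \o (fun x => f x * g x)).
Proof. by move=> f2 g2; exact/Lfun1_integrable/(Lfun2_mul_Lfun1 f2 g2). Qed.

Lemma Lfun2_bounded c f : measurable_fun setT f -> (forall x, `|f x| <= c) ->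
  f \in Lfun m 2%:E.
Proof.
move=> mf fc; apply/Lfun2P; split => //.
apply: (@integrable_bounded (c ^+ 2)); first exact: measurable_funX.
by move=> x; rewrite normrX lerXn2r ?nnegrE// (le_trans _ (fc x)).
Qed.

Lemma Lfun2_cst c : cst c \in Lfun m 2%:E.
Proof. exact: Lfun_cst. Qed.

Lemma Lfun2_lin c f g : f \in Lfun m 2%:E -> g \in Lfun m 2%:E ->
  (fun x => c * f x + g x) \in Lfun m 2%:E.
Proof.
move=> f2 g2; have p1 : (1 <= 2%:E :> \bar R)%E by rewrite lee_fin ler1n.
exact: ((Lfun_submod_closed m p1).2 c f g f2 g2).
Qed.

Lemma Lfun2D f g : f \in Lfun m 2%:E -> g \in Lfun m 2%:E ->
  (fun x => f x + g x) \in Lfun m 2%:E.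
Proof.
move=> f2 g2; have := Lfun2_lin 1 f2 g2.
by under eq_fun do rewrite mul1r.
Qed.

Lemma Lfun2Z c f : f \in Lfun m 2%:E -> (fun x => c * f x) \in Lfun m 2%:E.
Proof.
move=> f2; have := Lfun2_lin c f2 (Lfun2_cst 0).
by under eq_fun do rewrite /= addr0.
Qed.

Lemma Lfun2B f g : f \in Lfun m 2%:E -> g \in Lfun m 2%:E ->
  (fun x => f x - g x) \in Lfun m 2%:E.
Proof.
move=> f2 g2; have := Lfun2_lin (-1) g2 f2.
by under eq_fun do rewrite mulN1r addrC.
Qed.

Lemma Lfun2_sum (I : Type) (s : seq I) (h : I -> T -> R) :
  (forall i, h i \in Lfun m 2%:E) ->
  (fun x => \sum_(i <- s) h i x) \in Lfun m 2%:E.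
Proof.
move=> h2; elim: s => [|i s IH].
  rewrite (_ : (fun x => _) = cst 0); first exact: Lfun2_cst.
  by apply/funext => x; rewrite big_nil.
rewrite (_ : (fun x => _) = fun x => h i x + \sum_(j <- s) h j x).
  exact: Lfun2D.
by apply/funext => x; rewrite big_cons.
Qed.

Lemma Rintegral_sqrB f : f \in Lfun m 2%:E ->
  \int[m]_x (f x - \int[m]_y f y) ^+ 2 =
  \int[m]_x (f x ^+ 2) - (\int[m]_x f x) ^+ 2.
Proof.
move=> f2; set c := \int[m]_y f y.
have i1 := Lfun2_integrable f2; have [mf i2] := (Lfun2P f).1 f2.
transitivity (\int[m]_x (f x ^+ 2 - (2 * c * f x - c ^+ 2))).
  by apply: eq_Rintegral => x _; ring.
have i3 : m.-integrable setT (EFin \o (fun x => 2 * c * f x)).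
  exact: integrable_realZ.
have i4 : m.-integrable setT (EFin \o (fun x => 2 * c * f x - c ^+ 2)).
  by apply: integrable_realB => //; exact: integrable_cst.
rewrite RintegralB// RintegralB//; last exact: (integrable_cst (c ^+ 2)).
rewrite RintegralZl// Rintegral_cst1 -/c; ring.
Qed.

(** Markov's inequality, with any majorant [g] of the indicator of [A]. *)
Lemma probability_le_integral A (g : T -> \bar R) : measurable A ->
  measurable_fun setT g -> (forall x, 0 <= g x)%E -> (forall x, A x -> 1 <= g x)%E ->
  (m A <= \int[m]_x g x)%E.
Proof.
move=> mA mg g0 Ag; rewrite -[m A]mul1e -integral_cst// integral_mkcond.
apply: ge0_le_integral => //.
- by move=> x _; rewrite patchE; case: ifP.
- by apply/(measurable_restrictT _ _).1 => //; exact: measurable_cst.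
- by move=> x _; rewrite patchE; case: ifPn => // /set_mem; exact: Ag.
Qed.

End probability_integral.

Section iid_sum.
Context d (T : measurableType d) d1 (Omega : measurableType d1) (R : realType).
Context (P : probability Omega R) (law : probability T R).
Variable Z : nat -> {RV P >-> T}.
Hypothesis iidZ : iid law Z.

Lemma Lfun2_iid n f : f \in Lfun law 2%:E -> f \o Z n \in Lfun P 2%:E.
Proof.
move=> /Lfun2P[mf f2]; apply/Lfun2P; split.
  by apply: measurableT_comp => //; exact: measurable_funPT.
exact: (integrable_iid iidZ n f2).
Qed.

Lemma Lfun2_iid_sum n f : f \in Lfun law 2%:E ->
  (fun w => \sum_(i < n) f (Z i w)) \in Lfun P 2%:E.
Proof.
move=> f2; exact: (Lfun2_sum _ (fun i : 'I_n => Lfun2_iid i f2)).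
Qed.

(** The cross terms vanish, by independence and because [f] is centred. *)
Lemma Rintegral_iid_sum_sqr n f : f \in Lfun law 2%:E -> \int[law]_y f y = 0 ->
  \int[P]_w (\sum_(i < n) f (Z i w)) ^+ 2 = n%:R * \int[law]_y (f y ^+ 2).
Proof.
move=> f2 f0.
have i1 := Lfun2_integrable f2; have [mf i2] := (Lfun2P _ f).1 f2.
elim: n => [|n IH].
  rewrite mul0r -[RHS](Rintegral_cst1 P); apply: eq_Rintegral => w _.
  by rewrite big_ord0 expr0n.
pose S w := \sum_(i < n) f (Z i w); pose X w := f (Z n w).
have S2 : S \in Lfun P 2%:E by exact: Lfun2_iid_sum.
have X2 : X \in Lfun P 2%:E by exact: (Lfun2_iid n f2).
have iS := ((Lfun2P _ S).1 S2).2; have iX := ((Lfun2P _ X).1 X2).2.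
have iSX := Lfun2_mul S2 X2.
transitivity (\int[P]_w (S w ^+ 2 + (2 * (S w * X w) + X w ^+ 2))).
  by apply: eq_Rintegral => w _; rewrite big_ord_recr/=; rewrite /S /X; ring.
have i3 : P.-integrable setT (EFin \o (fun x => 2 * (S x * X x))).
  exact: integrable_realZ.
rewrite RintegralD//; last first.
  exact: integrable_realD.
rewrite RintegralD// RintegralZl// IH.
have -> : \int[P]_w (S w * X w) = 0.
  transitivity (\int[P]_w \sum_(i < n) (f (Z i w) * f (Z n w))).
    by apply: eq_Rintegral => w _; rewrite mulr_suml.
  have h (i : 'I_n) := iid_mul_lt iidZ (ltn_ord i) i1 i1.
  rewrite (Rintegral_sum _ (fun i => (h i).1)).2 big1// => i _.
  by rewrite (h i).2 f0 mul0r.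
rewrite (Rintegral_iid iidZ n (f := fun y => f y ^+ 2))//.
  by rewrite -natr1; ring.
exact: measurable_funX.
Qed.

End iid_sum.

(** * Geometric subsequences *)

Section geometric_blocks.
Variable R : realType.
Variable alpha : R.
Hypothesis alpha1 : 1 < alpha.

(** The integer part of [alpha ^+ n], plus 1 so that [alpha ^+ n] is a strict
    lower bound. *)
Definition block n := (Num.truncn (alpha ^+ n)).+1.

Let alpha0 : 0 < alpha. Proof. exact: lt_trans alpha1. Qed.

Let alphaX0 n : 0 < alpha ^+ n. Proof. exact: exprn_gt0. Qed.

Lemma block_gt n : alpha ^+ n < (block n)%:R.
Proof. exact: truncnS_gt. Qed.

Lemma block_le n : (block n)%:R <= 2 * alpha ^+ n.
Proof.
rewrite /block -natr1 mulr_natl mulr2n lerD//.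
  by have /andP[] := truncn_itv (ltW (alphaX0 n)).
by rewrite exprn_ege1 // ltW.
Qed.

Lemma block_nondecreasing n : (block n <= block n.+1)%N.
Proof.
by rewrite ltnS le_truncn// exprS ler_peMl// ltW.
Qed.

Lemma block_homo : {homo block : m n / (m <= n)%N}.
Proof. by apply: homo_leq => // [? ? ?|n]; [exact: leq_trans|exact: block_nondecreasing]. Qed.

Lemma alphaX_ge n : 1 + n%:R * (alpha - 1) <= alpha ^+ n.
Proof.
elim: n => [|n IH]; first by rewrite mul0r addr0 expr0.
rewrite exprS -natr1; have := @ler_wpM2l R alpha (ltW alpha0) _ _ IH.
apply: le_trans; have : 0 <= n%:R * (alpha - 1) ^+ 2 by rewrite mulr_ge0// sqr_ge0.
by nra.
Qed.

Lemma alphaX_unbounded (x : R) : exists n, x <= alpha ^+ n.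
Proof.
exists (Num.truncn (x / (alpha - 1))).+1; apply: le_trans (alphaX_ge _).
have a0 : 0 < alpha - 1 by rewrite subr_gt0.
have := truncnS_gt (x / (alpha - 1)); rewrite ltr_pdivrMr// => /ltW.
by move/le_trans; apply; rewrite lerDr.
Qed.

(** The terms grow geometrically, so that the sum is comparable to the last
    block below [y]. With [y] the value of a variable, this bounds the expected
    number of variables affected by a truncation at the level [block i] of the
    first [block i] variables, summed over [i]. *)
Lemma sum_block_lt (y : R) n : 0 <= y ->
  \sum_(i < n) (if (block i)%:R < y then (block i)%:R else 0) <=
  2 * alpha / (alpha - 1) * y.
Proof.
move=> y0; have a0 : 0 < alpha - 1 by rewrite subr_gt0.
have [c0 c1] : 0 <= alpha / (alpha - 1) /\ 0 <= (alpha - 1)^-1.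
  by rewrite divr_ge0 ?invr_ge0 ?(ltW a0) ?(ltW alpha0).
elim: n => [|n IH]; first by rewrite big_ord0 mulr_ge0// -mulrA mulr_ge0.
have [yn|yn] := ltP (alpha ^+ n) y; last first.
  rewrite big_ord_recr/= ifF ?addr0//; apply/negbTE; rewrite -leNgt.
  by rewrite (le_trans yn)// ltW// block_gt.
have {IH yn} : \sum_(i < n.+1) (2 * alpha ^+ i) <= 2 * alpha / (alpha - 1) * y.
  rewrite -mulr_sumr -!mulrA ler_pM2l//.
  have -> : \sum_(i < n.+1) alpha ^+ i = (alpha ^+ n.+1 - 1) / (alpha - 1).
    by rewrite subrX1 mulrC mulKf// gt_eqF.
  rewrite [leRHS]mulrCA [leLHS]mulrC; apply: ler_wpM2l => //; rewrite exprS.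
  rewrite (@le_trans _ _ (alpha * alpha ^+ n))// ?gerBl// ler_pM2l//.
  exact: ltW.
apply: le_trans; apply: ler_sum => i _; case: ifP => _; first exact: block_le.
by rewrite mulr_ge0// ltW.
Qed.

(** The terms decrease geometrically, so that the sum is comparable to its first
    one. With [y] the value of a variable, this bounds the variances of the
    means of truncated variables, summed over [i]. *)
Lemma sum_block_ge (y : R) n : 0 <= y ->
  \sum_(i < n) (if y <= (block i)%:R then y ^+ 2 / (block i)%:R else 0) <=
  2 * alpha / (alpha - 1) * y.
Proof.
rewrite le_eqVlt => /predU1P[<-|y0].
  by rewrite mulr0 big1// => i _; rewrite expr0n/= mul0r if_same.
have a0 : 0 < alpha - 1 by rewrite subr_gt0.
pose c := alpha / (alpha - 1); pose z := y / 2.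
have z0 : 0 < z by rewrite divr_gt0.
have c0 : 0 < c by rewrite divr_gt0.
pose G n := \sum_(i < n) (if z <= alpha ^+ i then (alpha ^+ i)^-1 else 0).
(* the correction [c / alpha ^+ n] makes the geometric sum telescope *)
have Gn : (alpha ^+ n < z -> G n = 0) /\
          (z <= alpha ^+ n -> G n <= c / z - c / alpha ^+ n).
  elim: n => [|n [IH1 IH2]].
    split; first by rewrite /G big_ord0.
    by move=> h; rewrite /G big_ord0 subr_ge0 ler_pM2l// lef_pV2// posrE.
  have GS : G n.+1 = G n + (if z <= alpha ^+ n then (alpha ^+ n)^-1 else 0).
    by rewrite /G big_ord_recr.
  have le1 : alpha ^+ n <= alpha ^+ n.+1 by rewrite exprS ler_peMl// ltW.
  split.
    move=> h; have h' : alpha ^+ n < z by exact: le_lt_trans h.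
    by rewrite GS (IH1 h') ifF ?addr0//; apply/negbTE; rewrite -ltNge.
  move=> h; rewrite GS; case: ifPn => hn.
    have -> : c / alpha ^+ n.+1 = c / alpha ^+ n - (alpha ^+ n)^-1.
      rewrite exprS /c; field; rewrite ?gt_eqF//.
    by have := IH2 hn; lra.
  rewrite -ltNge in hn; rewrite (IH1 hn) addr0 subr_ge0 ler_pM2l//.
  by rewrite lef_pV2// posrE.
have Gle : G n <= c / z.
  have [h|h] := ltP (alpha ^+ n) z; first by rewrite Gn.1// divr_ge0// ltW.
  by rewrite (le_trans (Gn.2 h))// gerBl divr_ge0// ltW.
apply: (@le_trans _ _ (y ^+ 2 * G n)).
  rewrite /G mulr_sumr; apply: ler_sum => i _; case: ifPn => hy; last first.
    by rewrite mulr_ge0 ?sqr_ge0//; case: ifP => // _; rewrite invr_ge0 ltW.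
  have := le_trans hy (block_le i); rewrite -ler_pdivrMl// mulrC => ->.
  rewrite ler_wpM2l ?sqr_ge0// lef_pV2 ?posrE//; first exact/ltW/block_gt.
apply: (le_trans (ler_wpM2l (sqr_ge0 _) Gle)).
rewrite le_eqVlt; apply/orP; left; apply/eqP; rewrite /z /c; field.
by rewrite !gt_eqF.
Qed.

(** The exponent 2 instead of 1 absorbs the rounding of the blocks. *)
Lemma block_ratio : \forall n \near \oo,
  (block n.+1)%:R <= alpha ^+ 2 * (block n)%:R.
Proof.
have a0 : 0 < alpha - 1 by rewrite subr_gt0.
have [n0 hn0] := alphaX_unbounded ((alpha - 1)^-1).
exists n0 => // n /= n0n.
have h1 : (block n.+1)%:R <= alpha ^+ n.+1 + 1.
  by rewrite /block -natr1 lerD2r; have /andP[] := truncn_itv (ltW (alphaX0 n.+1)).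
have h2 : 1 <= alpha ^+ n.+1 * (alpha - 1).
  rewrite -ler_pdivrMr// div1r (le_trans hn0)//.
  by rewrite ler_weXn2l ?ltW// (leq_trans n0n).
have h3 : alpha ^+ 2 * alpha ^+ n <= alpha ^+ 2 * (block n)%:R.
  by rewrite ler_wpM2l ?exprn_ge0 ?(ltW alpha0)// ltW// block_gt.
apply: le_trans h3; apply: (le_trans h1).
rewrite -exprD add2n [leRHS]exprS; nra.
Qed.

End geometric_blocks.

(** Partial sums of nonnegative terms are monotone, so that for indices between
    two consecutive blocks the mean differs from the means at the blocks by at
    most the factor [alpha ^+ 2], which is arbitrarily close to 1. *)
Lemma mean_cvg_of_blocks (R : realType) (a : nat -> R) (m : R) :
  (forall n, 0 <= a n) ->
  (forall j, let k := block (1 + j.+1%:R^-1 : R) in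
     (\sum_(i < k n) a i) / (k n)%:R @[n --> \oo] --> m) ->
  (\sum_(i < n) a i) / n%:R @[n --> \oo] --> m.
Proof.
move=> a_ge0 h.
have m0 : 0 <= m.
  have := h 0%N => /= /cvg_lim => <-//; apply: limr_ge.
    by apply/cvg_ex; exists m; exact: h.
  by apply: nearW => n; rewrite divr_ge0// sumr_ge0.
have Sle n p : (n <= p)%N -> \sum_(i < n) a i <= \sum_(i < p) a i.
  by move=> np; rewrite -(subnKC np) big_split_ord /= lerDl sumr_ge0.
apply/cvgrPdist_le => e e0.
pose eta := Num.min 1 (e / (2 * (m + 1))).
have eta0 : 0 < eta by rewrite lt_min ltr01 divr_gt0// mulr_gt0// ltr_wpDl.
pose delta := Num.min 1 (e / 2).
have delta0 : 0 < delta by rewrite lt_min ltr01 divr_gt0.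
pose j := Num.truncn (3 / eta).
pose alpha : R := 1 + j.+1%:R^-1.
have alpha1 : 1 < alpha by rewrite ltrDl invr_gt0 ltr0n.
have alpha2 : alpha ^+ 2 <= 1 + eta.
  have h1 : j.+1%:R^-1 <= eta / 3.
    rewrite -[leRHS]invrK invf_div lef_pV2 ?posrE ?divr_gt0 ?ltr0n//.
    exact/ltW/truncnS_gt.
  have h2 : 0 < j.+1%:R^-1 :> R by rewrite invr_gt0 ltr0n.
  have h3 : eta <= 1 by rewrite ge_min lexx.
  rewrite /alpha; move: h1 h2; set b : R := _^-1; clearbody b => h1 h2.
  nra.
have /cvgrPdist_le /(_ _ delta0) hj := h j.
pose k := block alpha; move: hj; rewrite -/alpha -/k => hj.
have [n0 _ Hn0] : \forall n \near \oo, `|m - (\sum_(i < k n) a i) / (k n)%:R| <= delta /\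
    (k n.+1)%:R <= alpha ^+ 2 * (k n)%:R.
  by near=> n; split; near: n; [exact: hj|exact: block_ratio].
exists (k n0) => // N /= kN.
have Nge0 : (0 < N)%N by apply: leq_trans kN.
have [n] : exists n, (N < k n)%N.
  have [n hn] := alphaX_unbounded alpha1 (N%:R).
  by exists n; rewrite -(ltr_nat R) (le_lt_trans hn)// block_gt.
pose Q n := (N < k n)%N.
move=> hn; have exQ : exists n, Q n by exists n.
(* [p.+1] is the first block beyond [N]: [k p <= N < k p.+1] *)
case: (ex_minnP exQ) => -[|p] Qp pmin.
  by move: Qp; rewrite /Q ltnNge (leq_trans _ kN)// block_homo.
have n0p : (n0 <= p)%N.
  rewrite leqNgt; apply/negP => pn0.
  by move: Qp; rewrite /Q ltnNge (leq_trans _ kN)// block_homo.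
have kpN : (k p <= N)%N.
  by rewrite leqNgt; apply/negP => /pmin; rewrite ltnn.
have [H1 H2] := Hn0 p n0p.
have [H3 _] := Hn0 p.+1 (leq_trans n0p (leqnSn _)).
have L1 := Sle _ _ kpN; have L2 := Sle _ _ (ltnW Qp).
have kp0 : 0 < (k p)%:R :> R by rewrite ltr0n.
have kp10 : 0 < (k p.+1)%:R :> R by rewrite ltr0n.
have N0 : 0 < N%:R :> R by rewrite ltr0n.
have N1 : (k p)%:R <= N%:R :> R by rewrite ler_nat.
have N2 : N%:R <= (k p.+1)%:R :> R by rewrite ler_nat ltnW.
have D1 : delta <= 1 by rewrite ge_min lexx.
have D2 : delta <= e / 2 by rewrite ge_min lexx orbT.
have E1 : eta * (m + 1) <= e / 2.
  have : eta <= e / (2 * (m + 1)) by rewrite ge_min lexx orbT.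
  rewrite ler_pdivlMr ?mulr_gt0// ?ltr_wpDl//; lra.
move: H1 H3; rewrite !ler_norml => /andP[_ H1] /andP[H3 _].
have {}H1 : (m - delta) * (k p)%:R <= \sum_(i < k p) a i.
  by rewrite -ler_pdivlMr//; lra.
have {}H3 : \sum_(i < k p.+1) a i <= (m + delta) * (k p.+1)%:R.
  by rewrite -ler_pdivrMr//; lra.
move: L1 L2 H1 H3.
set S0 := \sum_(i < k p) a i; set S1 := \sum_(i < k p.+1) a i; set S := \sum_(i < N) a i.
move=> L1 L2 H1 H3.
have F1 : S <= (m + delta) * (1 + eta) * N%:R.
  apply: (le_trans L2); apply: (le_trans H3).
  rewrite -mulrA ler_wpM2l ?addr_ge0// ?(ltW delta0)//.
  apply: (le_trans H2); apply: (@le_trans _ _ ((1 + eta) * (k p)%:R)).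
    by rewrite ler_wpM2r// ltW.
  by rewrite ler_wpM2l// addr_ge0// ltW.
have F2 : (m * (1 - eta) - delta) * N%:R <= S.
  apply: le_trans L1; apply: le_trans H1.
  have : N%:R * (1 - eta) <= (k p)%:R :> R.
    have : N%:R <= (1 + eta) * (k p)%:R :> R.
      by apply: (le_trans N2); apply: (le_trans H2); rewrite ler_wpM2r// ltW.
    have : 0 < eta ^+ 2 by rewrite exprn_gt0.
    nra.
  nra.
have G1 : S / N%:R <= m + e.
  rewrite ler_pdivrMr//; apply: (le_trans F1); rewrite ler_wpM2r ?(ltW N0)//.
  nra.
have G2 : m - e <= S / N%:R.
  rewrite ler_pdivlMr//; apply: le_trans F2; rewrite ler_wpM2r ?(ltW N0)//.
  nra.
by apply/andP; split; lra.
Unshelve. all: by end_near.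
Qed.

(** * The strong law of large numbers *)

Section slln_nonneg.
Context d (T : measurableType d) d1 (Omega : measurableType d1) (R : realType).
Context (P : probability Omega R) (law : probability T R).
Variable Z : nat -> {RV P >-> T}.
Hypothesis iidZ : iid law Z.
Variable g : T -> R.
Hypotheses (ig : law.-integrable setT (EFin \o g)) (g0 : forall y, 0 <= g y).

Let mg : measurable_fun setT g. Proof. exact: integrable_measurable ig. Qed.

Let mZ n : measurable_fun setT (Z n).
Proof. exact: measurable_funPT. Qed.

Section blocks.
Variable alpha : R.
Hypothesis alpha1 : 1 < alpha.

Let k := block alpha.

Let k0 n : 0 < (k n)%:R :> R. Proof. by rewrite ltr0n. Qed.

(** All the variables of a block are truncated at the same level [k n], so that
    they stay independent and identically distributed. *)
Let trunc n y : R := if g y <= (k n)%:R then g y else 0.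
Let excess n y : R := if (k n)%:R < g y then 1 else 0.
Let mean n := \int[law]_y trunc n y.

Let mtrunc n : measurable_fun setT (trunc n).
Proof. by apply: measurable_fun_ifT => //; exact: measurable_fun_ler. Qed.

Let mexcess n : measurable_fun setT (excess n).
Proof. by apply: measurable_fun_ifT => //; exact: measurable_fun_ltr. Qed.

Let trunc_bound n y : `|trunc n y| <= (k n)%:R.
Proof. by rewrite /trunc; case: ifPn => h; rewrite ?normr0// ger0_norm. Qed.

Let excess_ge0 n y : 0 <= excess n y.
Proof. by rewrite /excess; case: ifP. Qed.

Let trunc2 n : trunc n \in Lfun law 2%:E.
Proof. exact: (Lfun2_bounded law (mtrunc n) (trunc_bound n)). Qed.

Let iexcess n : law.-integrable setT (EFin \o excess n).
Proof.
by apply: (@integrable_bounded _ _ _ _ 1) => // y; rewrite /excess; case: ifP;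
  rewrite ?normr1 ?normr0.
Qed.

Section deviation.
Variable eps : R.
Hypothesis eps0 : 0 < eps.

Let ctr n y := trunc n y - mean n.

(** [1 <= dev n] as soon as the centred truncated sum exceeds [eps * k n] or
    one of the variables of the block is above the truncation level. *)
Let dev n w : R := (eps * (k n)%:R) ^- 2 * (\sum_(i < k n) ctr n (Z i w)) ^+ 2 +
  \sum_(i < k n) excess n (Z i w).

(** An upper bound for [dev n] in expectation, as a function of one variable. *)
Let q n y : R := (eps ^- 2 * (trunc n y ^+ 2 / (k n)%:R)) + (k n)%:R * excess n y.

Let ctr2 n : ctr n \in Lfun law 2%:E.
Proof. by apply: Lfun2B => //; exact: Lfun2_cst. Qed.

Let mdev n : measurable_fun setT (dev n).
Proof.
apply: measurable_funD.
  apply: measurable_funM => //; apply: measurable_funX.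
  apply: measurable_sum => i; apply: measurableT_comp => //.
  by have [] := (Lfun2P _ _).1 (ctr2 n).
by apply: measurable_sum => i; apply: measurableT_comp.
Qed.

Let dev_ge0 n w : 0 <= dev n w.
Proof.
by rewrite addr_ge0// ?sumr_ge0// mulr_ge0 ?sqr_ge0// invr_ge0 sqr_ge0.
Qed.

Let iq n : law.-integrable setT (EFin \o q n).
Proof.
apply: integrable_realD; last exact: integrable_realZ.
apply: integrable_realZ.
under [X in _.-integrable _ (_ \o X)]eq_fun do rewrite mulrC.
by apply: integrable_realZ; have [] := (Lfun2P _ _).1 (trunc2 n).
Qed.

Let Rintegral_dev n : P.-integrable setT (EFin \o dev n) /\
  \int[P]_w dev n w <= \int[law]_y q n y.
Proof.
have S2 := Lfun2_iid_sum iidZ (k n) (ctr2 n).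
have [_ iS] := (Lfun2P _ _).1 S2.
have ie (i : 'I_(k n)) := integrable_iid iidZ i (iexcess n).
have [iE IE] := Rintegral_sum (index_enum _) ie.
have i1 := integrable_realZ ((eps * (k n)%:R) ^- 2) iS.
split; first exact: integrable_realD.
rewrite RintegralD// RintegralZl// (Rintegral_iid_sum_sqr iidZ)//; last first.
  rewrite RintegralB//; last exact: integrable_cst.
  - by rewrite Rintegral_cst1 subrr.
  - exact: Lfun2_integrable.
rewrite IE (eq_bigr (fun=> \int[law]_y excess n y)); last first.
  by move=> i _; rewrite (Rintegral_iid iidZ i (mexcess n)).
rewrite sumr_const card_ord Rintegral_sqrB//.
have [_ it2] := (Lfun2P _ _).1 (trunc2 n).
have -> : \int[law]_y q n y = eps ^- 2 / (k n)%:R * \int[law]_y (trunc n y ^+ 2) +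
    (k n)%:R * \int[law]_y excess n y.
  transitivity (\int[law]_y ((eps ^- 2 / (k n)%:R) * (trunc n y ^+ 2) +
      (k n)%:R * excess n y)).
    by apply: eq_Rintegral => y _; rewrite /q; ring.
  by rewrite RintegralD ?RintegralZl//; exact: integrable_realZ.
rewrite -[X in _ + X <= _]mulr_natl; apply: lerD => //.
have -> : (eps * (k n)%:R) ^- 2 * ((k n)%:R *
   (\int[law]_x trunc n x ^+ 2 - (\int[law]_x trunc n x) ^+ 2)) =
   eps ^- 2 / (k n)%:R *
   (\int[law]_x trunc n x ^+ 2 - (\int[law]_x trunc n x) ^+ 2).
  by field; rewrite !gt_eqF.
by rewrite ler_wpM2l ?divr_ge0 ?invr_ge0 ?sqr_ge0// gerBl sqr_ge0.
Qed.

(** The point of geometric blocks: [\sum_n q n] is at most a multiple of [g],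
    whereas only the integrability of [g] is available. *)
Let sum_q_le n y : \sum_(i < n) q i y <=
  (eps ^- 2 + 1) * (2 * alpha / (alpha - 1)) * g y.
Proof.
rewrite big_split/= -mulr_sumr mulrDl mulrDl mul1r.
have e0 : 0 <= eps ^- 2 by rewrite invr_ge0 sqr_ge0.
apply: lerD.
  rewrite -mulrA ler_wpM2l//; apply: le_trans (sum_block_ge alpha1 n (g0 y)).
  apply: ler_sum => i _; rewrite /trunc -/k; case: ifP => // _.
  by rewrite expr0n/= mul0r.
apply: le_trans (sum_block_lt alpha1 n (g0 y)).
by apply: ler_sum => i _; rewrite /excess -/k; case: ifP; rewrite ?mulr1 ?mulr0.
Qed.

Let q_ge0 n y : 0 <= q n y.
Proof.
rewrite addr_ge0// mulr_ge0//; first by rewrite invr_ge0 sqr_ge0.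
by rewrite divr_ge0// sqr_ge0.
Qed.

(** By Markov's inequality and [sum_q_le] the probabilities of the events
    [1 <= dev n] have a finite sum, and the Borel-Cantelli lemma applies. *)
Lemma deviation_ae :
  {ae P, forall w, \forall n \near \oo,
    `|(\sum_(i < k n) g (Z i w)) / (k n)%:R - mean n| < eps}.
Proof.
pose E n := [set w | 1 <= dev n w].
have mE n : measurable (E n).
  rewrite -[E n]setTI (_ : setT `&` E n = setT `&` (fun w => 1 <= dev n w) @^-1` [set true]).
    by apply: measurable_fun_ler => //.
  by apply/seteqP; split => w/= [].
have PE n : (P (E n) <= \int[law]_y (q n y)%:E)%E.
  have [id Id] := Rintegral_dev n.
  apply: (@le_trans _ _ (\int[P]_w (dev n w)%:E)%E).
    apply: probability_le_integral => //.
    - exact/measurable_EFinP.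
    - by move=> w; rewrite lee_fin.
  rewrite -(fineK (integrable_fin_num _ id))// -(fineK (integrable_fin_num _ (iq n)))//.
have : P (lim_sup_set E) = 0%E.
  apply: lim_sup_set_cvg0 => //.
  apply: (@le_lt_trans _ _ (\sum_(n <oo) \int[law]_y (q n y)%:E)%E).
  by apply: lee_nneseries => [n _ _|n _]; [exact: measure_ge0|exact: PE].
  rewrite -integral_nneseries//; last 2 first.
  - by move=> n; exact/measurable_EFinP/(integrable_measurable (iq n)).
  - by move=> n y _; rewrite lee_fin.
  have := integrable_realZ ((eps ^- 2 + 1) * (2 * alpha / (alpha - 1))) ig.
  move=> /integrableP[mC]; apply: le_lt_trans.
  apply: ge0_le_integral => //.
  - by move=> y _; apply: nneseries_ge0 => n _ _; rewrite lee_fin.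
  - apply: ge0_emeasurable_sum => //.
    + by move=> n y _ _; rewrite lee_fin.
    + by move=> n _; exact/measurable_EFinP/(integrable_measurable (iq n)).
  - exact: measurableT_comp.
  - move=> y _; apply: lime_le.
      by apply: is_cvg_nneseries => n _ _; rewrite lee_fin.
    apply: nearW => n; rewrite big_mkord sumEFin lee_fin.
    by rewrite (le_trans (sum_q_le n y))// ler_norm.
move=> PE0; exists (lim_sup_set E); split => //.
  apply: bigcap_measurable => // n _; exact: bigcup_measurable.
move=> w /= h; apply: contrapT => h'; apply: h.
have [n nE] : exists n, forall j, (n <= j)%N -> ~ E j w.
  apply: contrapT => H; apply: h' => n _.
  apply: contrapT => H'; apply: H; exists n => j nj Ejw; apply: H'.
  by exists j.
exists n => // p /= /nE /negP; rewrite -ltNge => dev1.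
have noexc i : (i < k p)%N -> g (Z i w) <= (k p)%:R.
  move=> ik; rewrite leNgt; apply/negP => gk.
  move: dev1; rewrite /dev ltNge => /negP; apply.
  have ex1 : excess p (Z (Ordinal ik) w) = 1 by rewrite /excess gk.
  apply: (@le_trans _ _ (\sum_(j < k p) excess p (Z j w))).
    by rewrite -ex1 (bigD1 (Ordinal ik) (F := fun j => excess p (Z j w)))//= lerDl sumr_ge0.
  by rewrite lerDr mulr_ge0 ?sqr_ge0// invr_ge0 sqr_ge0.
have sq : (eps * (k p)%:R) ^- 2 * (\sum_(i < k p) ctr p (Z i w)) ^+ 2 < 1.
  by apply: le_lt_trans dev1; rewrite /dev lerDl sumr_ge0.
have sumE : (\sum_(i < k p) g (Z i w)) / (k p)%:R - mean p =
    (\sum_(i < k p) ctr p (Z i w)) / (k p)%:R.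
  rewrite sumrB sumr_const card_ord mulrBl -[mean p *+ _]mulr_natr mulfK ?gt_eqF//.
  congr (_ / _ - _); apply: eq_bigr => i _; rewrite /trunc noexc//.
rewrite sumE normrM normfV (gtr0_norm (k0 p)) ltr_pdivrMr//.
rewrite -ltr_sqr ?nnegrE// ?mulr_ge0 ?(ltW eps0)// real_normK ?num_real//.
by move: sq; rewrite mulrC ltr_pdivrMr ?mul1r// exprn_gt0 ?mulr_gt0.
Qed.

End deviation.

Let mean_cvg : mean n @[n --> \oo] --> \int[law]_y g y.
Proof.
have := @dominated_convergence _ _ _ law setT measurableT
  (fun n y => (trunc n y)%:E) (EFin \o g) (EFin \o g).
case => //.
- by move=> n; exact/measurable_EFinP.
- exact/measurable_EFinP.
- apply: aeW => y _; apply: cvg_near_cst.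
  have [n0 hn0] := alphaX_unbounded alpha1 (g y).
  exists n0 => // n /= n0n; rewrite /trunc /= ifT//.
  by rewrite (le_trans hn0)// (le_trans (ltW (block_gt alpha n0)))// ler_nat block_homo.
- apply: aeW => y n _ /=; rewrite lee_fin /trunc; case: ifPn => _.
    by rewrite ger0_norm.
  by rewrite normr0.
move=> _ _ /=; rewrite /mean => h.
apply: (@fine_cvg _ _ _ _ _ (\int[law]_y g y)).
by rewrite fineK//; exact: integrable_fin_num.
Qed.

Lemma slln_blocks :
  {ae P, forall w, (\sum_(i < k n) g (Z i w)) / (k n)%:R @[n --> \oo]
    --> \int[law]_y g y}.
Proof.
have h j : {ae P, forall w, \forall n \near \oo,
    `|(\sum_(i < k n) g (Z i w)) / (k n)%:R - mean n| < j.+1%:R^-1}.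
  by apply: deviation_ae; rewrite invr_gt0 ltr0n.
have := ae_foralln h; apply: filterS => w hw.
apply/cvgrPdist_le => e e0.
have e20 : 0 < e / 2 by rewrite divr_gt0.
have /cvgrPdist_le/(_ _ e20) hm := mean_cvg.
pose j := Num.truncn (2 / e).
have hj : j.+1%:R^-1 <= e / 2.
  rewrite -[leRHS]invrK invf_div lef_pV2 ?posrE ?divr_gt0 ?ltr0n//.
  exact/ltW/truncnS_gt.
near=> n.
have h1 : `|\int[law]_y g y - mean n| <= e / 2 by near: n.
have h2 : `|(\sum_(i < k n) g (Z i w)) / (k n)%:R - mean n| < j.+1%:R^-1.
  by near: n; exact: hw.
rewrite -(subrKA (mean n)) (le_trans (ler_normD _ _))// [leRHS]splitr lerD//.
by rewrite distrC (le_trans (ltW h2)).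
Unshelve. all: by end_near.
Qed.

End blocks.

Lemma slln_nonneg :
  {ae P, forall w, (\sum_(i < n) g (Z i w)) / n%:R @[n --> \oo]
    --> \int[law]_y g y}.
Proof.
have a1 (j : nat) : 1 < 1 + j.+1%:R^-1 :> R by rewrite ltrDl invr_gt0 ltr0n.
have := ae_foralln (fun j => slln_blocks (a1 j)); apply: filterS => w hw.
by apply: (@mean_cvg_of_blocks _ (fun i => g (Z i w))) => // j; exact: hw.
Qed.

End slln_nonneg.

(** The positive and negative parts of [g] have monotone partial sums, for which
    convergence along geometric subsequences is enough. *)
Theorem strong_law d (T : measurableType d) d1 (Omega : measurableType d1)
    (R : realType) (P : probability Omega R) (law : probability T R)
    (Z : nat -> {RV P >-> T}) (g : T -> R) :
  iid law Z -> law.-integrable setT (EFin \o g) ->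
  {ae P, forall w, (\sum_(i < n) g (Z i w)) / n%:R @[n --> \oo]
    --> \int[law]_y g y}.
Proof.
move=> iidZ ig.
have ip := integrable_funrpos measurableT ig.
have im := integrable_funrneg measurableT ig.
have := slln_nonneg iidZ im (@funrneg_ge0 _ _ g).
have := slln_nonneg iidZ ip (@funrpos_ge0 _ _ g).
apply: filterS2 => w hp hm.
have gE y : g y = g^\+ y - g^\- y by rewrite -[in LHS](funrposBneg g).
have -> : \int[law]_y g y = \int[law]_y g^\+ y - \int[law]_y g^\- y.
  by rewrite -RintegralB//; apply: eq_Rintegral => y _.
rewrite (_ : (fun n => _) = fun n => (\sum_(i < n) g^\+ (Z i w)) / n%:R -
    (\sum_(i < n) g^\- (Z i w)) / n%:R).
  exact: cvgB.
apply/funext => n; rewrite -mulrBl -sumrB; congr (_ / _).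
by apply: eq_bigr => i _.
Qed.

(** * Gaussian smoothing *)

Section density.
Context d (T : measurableType d) (R : realType).
Variables (mu nu : {measure set T -> \bar R}) (p : T -> R).
Hypotheses (mp : measurable_fun setT p) (p0 : forall x, 0 <= p x).
Hypothesis nuE : forall A, measurable A -> nu A = (\int[mu]_(x in A) (p x)%:E)%E.
Local Open Scope ereal_scope.
Import HBNNSimple.

Let mpE : measurable_fun setT (fun x => (p x)%:E).
Proof. exact/measurable_EFinP. Qed.

(** The formula extends from indicators to simple functions by linearity, then
    to nonnegative functions by monotone convergence. *)
Lemma ge0_integral_density (f : T -> \bar R) :
  measurable_fun setT f -> (forall x, 0 <= f x) ->
  \int[nu]_x f x = \int[mu]_x (f x * (p x)%:E).
Proof.
move=> mf f0; pose f_ := nnsfun_approx measurableT mf.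
have fcvg x : EFin \o f_ ^~ x @ \oo --> f x by exact: cvg_nnsfun_approx.
have mf_ n : measurable_fun setT (fun x => (f_ n x)%:E).
  exact/measurable_EFinP.
have nd_ x m n : (m <= n)%N -> (f_ m x)%:E <= (f_ n x)%:E.
  by move=> mn; rewrite lee_fin; exact/lefP/nd_nnsfun_approx.
transitivity (limn (fun n => \int[nu]_x (f_ n x)%:E)).
  rewrite -monotone_convergence//; last 2 first.
  - by move=> n x _; rewrite lee_fin.
  - by move=> x _ m n; exact: nd_.
  by apply: eq_integral => x _; apply/esym/cvg_lim => //; exact: fcvg.
transitivity (limn (fun n => \int[mu]_x ((f_ n x)%:E * (p x)%:E))); last first.
  rewrite -monotone_convergence//; last 3 first.
  - by move=> n; exact: emeasurable_funM.
  - by move=> n x _; rewrite mule_ge0 ?lee_fin.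
  - by move=> x _ m n mn; rewrite lee_wpmul2r ?lee_fin// -lee_fin nd_.
  apply: eq_integral => x _; apply/cvg_lim => //.
  by apply: cvgeZr => //; exact: fcvg.
congr (limn _); apply/funext => n.
under eq_integral do rewrite fimfunE -fsumEFin//.
transitivity (\int[mu]_x \sum_(r \in range (f_ n))
    ((r * \1_(f_ n @^-1` [set r]) x)%:E * (p x)%:E)); last first.
  apply: eq_integral => x _; rewrite [in RHS]fimfunE -fsumEFin// ge0_mule_fsuml//.
  by move=> r; rewrite EFinM; exact: nnfun_muleindic_ge0.
rewrite !ge0_integral_fsum//; last 4 first.
- move=> r; apply: emeasurable_funM => //; exact/measurable_EFinP/measurableT_comp.
- by move=> r x _; rewrite EFinM; apply: mule_ge0; rewrite ?lee_fin//; exact: nnfun_muleindic_ge0.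
- by move=> r; exact/measurable_EFinP/measurableT_comp.
- by move=> r x _; rewrite EFinM nnfun_muleindic_ge0.
apply: eq_fsbigr => r rf.
have r0 : (0 <= r)%R by move: rf => /set_mem [x _ <-].
rewrite integralZl_indic_nnsfun// integral_indic// setIT nuE//.
under [RHS]eq_integral do rewrite EFinM -muleA.
rewrite ge0_integralZl//; last 2 first.
- by apply: emeasurable_funM => //; exact/measurable_EFinP/measurable_indic.
- by move=> x _; rewrite mule_ge0 ?lee_fin.
congr (_ * _); rewrite integral_mkcond; apply: eq_integral => x _.
rewrite patchE indicE; case: ifPn => _; by rewrite ?mul1e ?mul0e.
Qed.

End density.

Section lebesgue_affine.
Variable R : realType.
Local Notation mu := (@lebesgue_measure R).
Variables (s c : R).
Hypothesis s0 : 0 < s.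

Let aff (x : R) : measurableTypeR R := s * x + c.

Let maff : measurable_fun [set: measurableTypeR R] aff.
Proof. by apply: measurable_funD => //; exact: measurable_funM. Qed.

Let sn : {nonneg R} := NngNum (ltW s0).

(** Lebesgue measure is the only measure that gives intervals their length, and
    [s] times its image under the affine map does so. *)
Lemma ge0_integral_affine (g : R -> \bar R) : measurable_fun setT g ->
  (forall x, 0 <= g x)%E ->
  (\int[mu]_x g (s * x + c)%R = (s^-1)%:E * \int[mu]_x g x)%E.
Proof.
move=> mg g0.
pose m := mscale sn (image_measure mu maff).
have E A : measurable A -> mu A = m A.
  move=> mA; apply: (@lebesgue_measure_unique R m) => // _ [[a b]] _ <-.
  rewrite -[RHS]/(s%:E * mu (aff @^-1` `]a, b]%classic))%E.
  have -> : aff @^-1` `]a, b]%classic = `](a - c) / s, (b - c) / s]%classic.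
    apply/seteqP; split => x; rewrite /aff /= !in_itv/= ltr_pdivrMr// ler_pdivlMr//;
    by rewrite [x * s]mulrC ltrBlDr lerBrDr.
  rewrite !lebesgue_measure_itv/= !lte_fin.
  have -> : ((a - c) / s < (b - c) / s)%R = (a < b)%R.
    by rewrite ltr_pM2r ?invr_gt0// ltrD2r.
  case: ifPn => _; last by rewrite mule0.
  rewrite -!EFinD -EFinM; congr (_%:E); field.
  by rewrite gt_eqF.
rewrite [X in ((_)%:E * X)%E](eq_measure_integral m); last by move=> A mA _; exact: E.
rewrite ge0_integral_mscale// muleA -EFinM mulVf ?gt_eqF// mul1e.
by rewrite ge0_integral_pushforward.
Qed.

End lebesgue_affine.

Section standard_normal.
Variable R : realType.
Local Notation mu := (@lebesgue_measure R).
Local Notation phi := (@normal_pdf R 0 1).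
Local Notation gamma := (@normal_prob R 0 1).

Lemma normal_pdf01E (x : R) : phi x = normal_peak 1 * expR (- x ^+ 2 / 2).
Proof. by rewrite normal_pdfE// /normal_fun subr0 expr1n. Qed.

Let mphi : measurable_fun setT phi. Proof. exact: measurable_normal_pdf. Qed.

Let phi0 x : 0 <= phi x. Proof. exact: normal_pdf_ge0. Qed.

Lemma ge0_integral_gamma (f : R -> \bar R) : measurable_fun setT f ->
  (forall x, 0 <= f x)%E ->
  (\int[gamma]_x f x = \int[mu]_x (f x * (phi x)%:E))%E.
Proof. by move=> mf f0; rewrite (@ge0_integral_density _ _ _ mu gamma phi). Qed.

(** For [w = (u - a * z) / b], the form [z ^+ 2 + w ^+ 2] equals
    [(z ^+ 2 - 2 * a * z * u + u ^+ 2) / b ^+ 2], which is symmetric in [u] and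
    [z]. *)
Lemma normal_pdf_rotate (a b u z : R) : a ^+ 2 + b ^+ 2 = 1 -> b != 0 ->
  phi z * phi (b^-1 * u + - (b^-1 * (a * z))) =
  phi u * phi (b^-1 * z + - (b^-1 * (a * u))).
Proof.
move=> ab b0; rewrite !normal_pdf01E mulrACA [RHS]mulrACA; congr (_ * _).
rewrite -!expRD; congr expR; apply/eqP; rewrite -subr_eq0; apply/eqP.
transitivity ((a ^+ 2 + b ^+ 2 - 1) * (u ^+ 2 - z ^+ 2) / (2 * b ^+ 2)); first by field.
by rewrite ab subrr !mul0r.
Qed.

Let gamma_setT : (\int[mu]_x (phi x)%:E = 1)%E.
Proof. exact: integral_normal_pdf. Qed.

Local Open Scope ereal_scope.

(** After the substitution [u = a * z + b * w] in the inner integral,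
    [normal_pdf_rotate] leaves the density of [u] times a normal density in [z],
    which integrates to 1. *)
Lemma ge0_gamma_rotate (a b : R) (F : R -> \bar R) :
  (a ^+ 2 + b ^+ 2 = 1)%R -> (0 < b)%R ->
  measurable_fun setT F -> (forall x, 0 <= F x) ->
  \int[gamma]_z \int[gamma]_w F (a * z + b * w)%R = \int[gamma]_u F u.
Proof.
move=> ab b0 mF F0; have b_neq0 : b != 0%R by rewrite gt_eqF.
have maff (s t : R) : measurable_fun setT (fun x : R => (s * x + t)%R).
  by apply: measurable_funD => //; exact: measurable_funM.
pose H (p : R * R) := F p.2 * (b^-1 * (phi p.1 * phi (b^-1 * p.2 + - (b^-1 * (a * p.1)))))%:E.
have mH : measurable_fun setT H.
  apply: emeasurable_funM; first exact: measurableT_comp.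
  apply/measurable_EFinP; apply: measurable_funM => //; apply: measurable_funM.
    exact: measurableT_comp.
  apply: measurableT_comp => //; apply: measurable_funB; apply: measurable_funM => //.
  by apply: measurable_funM.
have H0 p : 0 <= H p.
  by rewrite mule_ge0// lee_fin !mulr_ge0// invr_ge0 ltW.
transitivity (\int[mu]_z \int[mu]_u H (z, u)).
  have inner z : (\int[gamma]_w F (a * z + b * w)%R) * (phi z)%:E =
      \int[mu]_u H (z, u).
    rewrite ge0_integral_gamma//; last first.
      by apply: measurableT_comp => //; under eq_fun do rewrite addrC; exact: maff.
    pose G u := F u * (phi (b^-1 * u + - (b^-1 * (a * z)))%R)%:E.
    have mG : measurable_fun setT G.
      apply: emeasurable_funM => //; apply/measurable_EFinP.
      by apply: measurableT_comp => //; exact: maff.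
    have G0 u : 0 <= G u by rewrite mule_ge0// lee_fin.
    transitivity ((\int[mu]_w G (b * w + a * z)%R) * (phi z)%:E).
      apply: (congr1 (fun t => t * (phi z)%:E)); apply: eq_integral => w _.
      rewrite /G [(a * z + _)%R]addrC.
      apply: (congr1 (fun t => F (b * w + a * z)%R * (phi t)%:E)).
      by rewrite mulrDr mulKf// addrK.
    rewrite ge0_integral_affine// muleAC -EFinM -ge0_integralZl//; last first.
      by rewrite lee_fin mulr_ge0// invr_ge0 ltW.
    apply: eq_integral => u _; rewrite /H /G/= muleCA -EFinM.
    by rewrite -(mulrA b^-1%R (phi z)).
  rewrite ge0_integral_gamma//.
  - by apply: eq_integral => z _; exact: inner.
  - apply: (@measurable_fun_fubini_tonelli_F _ _ _ _ _ gamma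
      (fun p : R * R => F (a * p.1 + b * p.2)%R)) => //.
    apply: measurableT_comp => //; apply: measurable_funD; apply: measurable_funM => //.
  - by move=> z; exact: integral_ge0.
rewrite (@fubini_tonelli _ _ _ _ _ mu mu H)// ge0_integral_gamma//.
apply: eq_integral => u _.
pose c := (- (b^-1 * (a * u)))%R.
have mpc : measurable_fun setT (fun z => (phi (b^-1 * z + c)%R)%:E).
  by apply/measurable_EFinP; apply: measurableT_comp => //; exact: maff.
transitivity (\int[mu]_z ((F u * (phi u)%:E * (b^-1)%:E) * (phi (b^-1 * z + c)%R)%:E)).
  apply: eq_integral => z _; rewrite /H/= normal_pdf_rotate// -!muleA -!EFinM.
  by congr (_ * _%:E); ring.
rewrite ge0_integralZl//; last 2 first.
- by move=> x _; rewrite lee_fin.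
- by rewrite !mule_ge0// lee_fin// invr_ge0 ltW.
have := @ge0_integral_affine _ b^-1%R c _ (fun z => (phi z)%:E).
rewrite invr_gt0 => -> //; last exact/measurable_EFinP.
by rewrite gamma_setT mule1 invrK -[LHS]muleA -EFinM mulVf// mule1.
Qed.

Lemma lebesgue_image_opp A : measurable A ->
  mu ((-%R : R -> measurableTypeR R) @^-1` A) = mu A.
Proof. exact: lebesgue_measureN. Qed.

Lemma normal_pdf01N (x : R) : phi (- x) = phi x.
Proof. by rewrite !normal_pdf01E sqrrN. Qed.

Lemma gamma_opp (A : set R) : measurable A ->
  gamma ((-%R : R -> measurableTypeR R) @^-1` A) = gamma A.
Proof.
move=> mA.
rewrite -[LHS]/(\int[mu]_(x in -%R @^-1` A) (phi x)%:E).
rewrite -[RHS]/(\int[mu]_(x in A) (phi x)%:E).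
rewrite [RHS]integral_mkcond -(ge0_integral_image _ lebesgue_image_opp); last 3 first.
- exact: oppr_measurable.
- by apply/(measurable_restrictT _ _).1 => //; exact/measurable_funTS/measurable_EFinP.
- by move=> y; rewrite patchE; case: ifP => // _; rewrite lee_fin.
rewrite [LHS]integral_mkcond; apply: eq_integral => x _; rewrite !patchE.
by rewrite normal_pdf01N; congr (if _ then _ else _); apply/idP/idP; rewrite !inE.
Qed.

Lemma is_derive_normal_pdf01 (x : R) :
  is_derive x (1%R : R) (fun t : R => (- phi t)%R) (x * phi x)%R.
Proof.
have h : is_derive x (1%R : R) (fun t : R => - t ^+ 2 / 2)%R (- x)%R.
  apply: is_derive_eq.
  by rewrite /= /GRing.scale/=; field.
have h2 := @is_derive1_comp _ expR _ x _ _ (is_derive_expR _) h.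
rewrite (_ : (fun t => _) = (- normal_peak 1) *: (expR \o (fun t => - t ^+ 2 / 2)))%R.
  apply: is_derive_eq; rewrite normal_pdf01E /GRing.scale/=; ring.
by apply/funext => t /=; rewrite normal_pdf01E -mulNr.
Qed.

Lemma cvg_normal_pdf01 : phi x @[x --> +oo%R] --> (0%R : R).
Proof.
rewrite (_ : phi = (fun x => normal_peak 1 * expR (- (x ^+ 2 / 2)))%R).
  rewrite -[X in _ --> X](mulr0 (normal_peak 1)).
  apply: cvgMr; apply: (cvg_comp (fun x : R => x ^+ 2 / 2)%R (fun x => expR (- x))).
    apply: gt0_cvgMly; first by rewrite invr_gt0.
    exact: cvgr_expr2.
  exact: cvgr_expR.
by apply/funext => x; rewrite normal_pdf01E mulNr.
Qed.

Lemma integral_tail (u : R) : (0 <= u)%R ->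
  \int[mu]_(x in `[u, +oo[) (x * phi x)%:E = (phi u)%:E.
Proof.
move=> u0; have cphi : continuous phi by exact: continuous_normal_pdf.
rewrite (@ge0_continuous_FTC2y _ _ (fun t => - phi t)%R _ 0%R).
- by rewrite -EFinB sub0r opprK.
- by move=> x ux; rewrite mulr_ge0// (le_trans u0).
- apply: continuous_subspaceT => x; apply: cvgM; [exact: cvg_id|exact: cphi].
- rewrite -[X in _ --> X]oppr0; apply: cvgN; exact: cvg_normal_pdf01.
- by move=> x _; have [] := is_derive_normal_pdf01 x.
- by apply: cvg_at_right_filter; apply: cvgN; exact: cphi.
- move=> x _; rewrite derive1E; have dx := is_derive_normal_pdf01 x.
  by rewrite derive_val.
Qed.

(** For [0 <= z], [z ^+ 2] is the integral of [z] over [u] in [0, z]; after an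
    exchange of integrals [integral_tail] turns the second moment into the total
    mass of the density. *)
Lemma second_moment_gamma : \int[gamma]_x (x ^+ 2)%:E = 1.
Proof.
have cphi : continuous phi by exact: continuous_normal_pdf.
have m2 : measurable_fun setT (fun x : R => (x ^+ 2)%:E).
  exact/measurable_EFinP/measurable_funX.
rewrite ge0_integral_gamma//; last by move=> x; rewrite lee_fin sqr_ge0.
under eq_integral do rewrite -EFinM.
rewrite ge0_symfun_integralT//; last 3 first.
- by move=> x; rewrite mulr_ge0// sqr_ge0.
- by move=> x; apply: cvgM; [exact: exprn_continuous|exact: cphi].
- by move=> x /=; rewrite sqrrN normal_pdf01N.
rewrite -gamma_setT ge0_symfun_integralT//; last by move=> x /=; rewrite normal_pdf01N.
congr (_ * _); rewrite -set_itvcy.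
pose H (p : R * R) : \bar R :=
  ((if (0 <= p.2) && (p.2 <= p.1) then 1 else 0) * (p.1 * phi p.1))%:E.
have mH : measurable_fun setT H.
  apply/measurable_EFinP/measurable_funM; last first.
    by apply: measurable_funM => //; exact: measurableT_comp.
  apply: measurable_fun_ifT => //; apply: measurable_and.
    exact: measurable_fun_ler.
  exact: measurable_fun_ler.
have H0 p : 0 <= H p.
  rewrite lee_fin /H; case: ifPn; last by rewrite mul0r.
  by move=> /andP[a b]; rewrite mul1r mulr_ge0// (le_trans a).
transitivity (\int[mu]_z \int[mu]_u H (z, u)).
  rewrite integral_mkcond; apply: eq_integral => z _; rewrite patchE.
  case: ifPn => [/set_mem|/negP]; rewrite ?inE /= in_itv/= andbT => z0.
    transitivity (\int[mu]_(u in `[0%R, z]) (z * phi z)%:E); last first.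
      rewrite integral_mkcond; apply: eq_integral => u _; rewrite patchE /H/= mem_setE in_itv/=.
      by case: ifP; rewrite ?mul1r ?mul0r.
    rewrite [RHS](integral_cst mu (measurable_itv `[0%R, z]) (z * phi z)%:E).
    rewrite [X in _ * X]lebesgue_measure_itv/= lte_fin.
    move: z0; rewrite le_eqVlt => /predU1P[<-|z0].
      by rewrite ltxx expr0n/= !mul0r mule0.
    by rewrite z0 sube0 -EFinM; congr (_%:E); ring.
  rewrite [RHS]integral0_eq// => u _; rewrite /H ifF ?mul0r//.
  by apply/negbTE/negP => /andP[a b]; apply: z0; rewrite (le_trans a).
rewrite (@fubini_tonelli _ _ _ _ _ mu mu H)//.
rewrite [RHS]integral_mkcond; apply: eq_integral => u _; rewrite patchE.
case: ifPn => [/set_mem|/negP]; rewrite ?inE /= in_itv/= andbT => u0.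
  rewrite -(integral_tail u0) [RHS]integral_mkcond; apply: eq_integral => z _.
  by rewrite patchE /H/= mem_setE in_itv/= andbT u0/=; case: ifP; rewrite ?mul1r ?mul0r.
rewrite [LHS]integral0_eq// => z _; rewrite /H ifF ?mul0r//.
by apply/negbTE/negP => /andP[a b]; apply: u0.
Qed.

Lemma Lfun2_gamma_id : (fun x : R => x) \in Lfun gamma 2%:E.
Proof.
apply/Lfun2P; split=> //.
apply/integrableP; split; first exact/measurable_EFinP/measurable_funX.
rewrite (_ : \int[_]_x _ = 1); first exact: ltry.
rewrite -second_moment_gamma; apply: eq_integral => x _ /=.
by rewrite ger0_norm// sqr_ge0.
Qed.

Local Close Scope ereal_scope.

Lemma gamma_sqr : \int[gamma]_x (x ^+ 2) = 1.
Proof. by rewrite /Rintegral second_moment_gamma. Qed.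

Lemma gamma_mean : \int[gamma]_x x = 0.
Proof.
have ii : gamma.-integrable setT (fun x : R => x%:E) := Lfun2_integrable Lfun2_gamma_id.
have : \int[gamma]_x (- x) = \int[gamma]_x x.
  apply: (@Rintegral_image _ _ _ _ _ gamma gamma (-%R : R -> measurableTypeR R) _ _ (fun y => y)) => //.
  by move=> A mA; exact: gamma_opp.
have -> : \int[gamma]_x (- x) = - \int[gamma]_x x.
  rewrite -mulN1r -RintegralZl//; apply: eq_Rintegral => x _; by rewrite mulN1r.
lra.
Qed.

(** The heat semigroup: the expectation of [f] under the normal law of mean [x]
    and variance [v], including [v = 0]. *)
Definition gauss_smooth (v : R) (f : R -> R) (x : R) :=
  \int[gamma]_z f (x + Num.sqrt v * z).

Let mshift (x s : R) : measurable_fun setT (fun z : R => x + s * z).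
Proof. by apply: measurable_funD => //; exact: measurable_funM. Qed.

Section bounded.
Variables (f : R -> R) (B : R).
Hypotheses (mf : measurable_fun setT f) (fB : forall x, `|f x| <= B).

Let mfshift (x s : R) : measurable_fun setT (fun z : R => f (x + s * z)).
Proof. exact: measurableT_comp. Qed.

Let ifshift (x s : R) : gamma.-integrable setT (EFin \o (fun z : R => f (x + s * z))).
Proof. exact: (@integrable_bounded _ _ _ gamma B _ (mfshift x s) (fun z => fB _)). Qed.

Lemma gauss_smooth_bounded v x : `|gauss_smooth v f x| <= B.
Proof.
have ii := ifshift x (Num.sqrt v).
apply: (le_trans (le_normr_Rintegral measurableT ii)).
rewrite -[leRHS](Rintegral_cst1 gamma B); apply: le_Rintegral => //.
- exact: (integrable_norm ii).
- exact: integrable_cst.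
Qed.

Lemma measurable_gauss_smooth v : measurable_fun setT (gauss_smooth v f).
Proof.
apply: (@measurable_kernel_Rintegral _ _ _ _ _ (constant_kernel _ gamma)
   (fun p : R * R => f (p.1 + Num.sqrt v * p.2))).
apply: measurableT_comp => //; apply: measurable_funD => //.
by apply: measurable_funM.
Qed.

Lemma gauss_smooth_normal_law v : 0 <= v ->
  (\int[normal_law 0 v]_x (f x)%:E = (gauss_smooth v f 0)%:E)%E.
Proof.
move=> v0; rewrite /normal_law /gauss_smooth.
have [->|vn0] := eqVneq v 0.
  rewrite integral_dirac//; last exact/measurable_EFinP.
  rewrite diracE mem_set// mul1e; congr (_%:E).
  by under eq_Rintegral do rewrite sqrtr0 mul0r addr0; rewrite Rintegral_cst1.
have vgt0 : 0 < v by rewrite lt_neqAle eq_sym vn0.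
have s0 : 0 < Num.sqrt v by rewrite sqrtr_gt0.
set s := Num.sqrt v in s0 *.
have sn0 : s != 0 by rewrite gt_eqF.
have E g : measurable_fun setT g -> (forall x, 0 <= g x)%E ->
    (\int[normal_prob 0 s]_x g x = \int[gamma]_z g (0 + s * z)%R)%E.
  move=> mg g0.
  have mpn : measurable_fun setT (@normal_pdf R 0 s) by exact: measurable_normal_pdf.
  have pn0 x : 0 <= normal_pdf 0 s x by exact: normal_pdf_ge0.
  rewrite [LHS](@ge0_integral_density _ _ _ mu (normal_prob 0 s) (normal_pdf 0 s) mpn pn0 _ g mg g0)//.
  have mgs : measurable_fun setT (fun z => g (0 + s * z)) := measurableT_comp mg (mshift 0 s).
  rewrite [RHS](ge0_integral_gamma mgs (fun z => g0 _)).
  pose h x : \bar R := (g x * (s * normal_pdf 0 s x)%:E)%E.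
  have mh : measurable_fun setT h.
    by apply: emeasurable_funM => //; apply/measurable_EFinP; exact: measurable_funM.
  transitivity (\int[mu]_x h (s * x + 0)%R)%E.
    rewrite ge0_integral_affine//; last first.
      by move=> x; rewrite mule_ge0// lee_fin mulr_ge0// ltW.
    rewrite -ge0_integralZl//; last 2 first.
    - by move=> x _; rewrite mule_ge0// lee_fin mulr_ge0// ltW.
    - by rewrite lee_fin invr_ge0 ltW.
    apply: eq_integral => x _; rewrite /h muleCA -EFinM mulKf//.
  apply: eq_integral => x _; rewrite /h addrC; congr (_ * _%:E)%E.
  rewrite add0r normal_pdf01E normal_pdfE// /normal_fun subr0 mulrA; congr (_ * expR _).
    rewrite /normal_peak expr1n mul1r -mulrnAr sqrtrM ?sqr_ge0// sqrtr_sqr ger0_norm ?ltW//.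
    by field; rewrite sn0/= gt_eqF// sqrtr_gt0 mulrn_wgt0// pi_gt0.
  by rewrite -[s ^+ 2 *+ 2]mulr_natr; field.
have mp : measurable_fun setT ((fun x => (f x)%:E)^\+)%E.
  by apply/measurable_funepos/measurable_EFinP.
have mn : measurable_fun setT ((fun x => (f x)%:E)^\-)%E.
  by apply/measurable_funeneg/measurable_EFinP.
rewrite [LHS]integralE (E _ mp (fun x => funepos_ge0 _ x)) (E _ mn (fun x => funeneg_ge0 _ x)).
rewrite /Rintegral fineK; last by apply: integrable_fin_num => //; exact: ifshift.
rewrite [RHS]integralE; congr (_ - _)%E.
- by apply: eq_integral => x _; rewrite !funeposE.
- by apply: eq_integral => x _; rewrite !funenegE.
Qed.

(** Sums of independent normal variables are normal. The bound [B] is added to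
    [f] to return to nonnegative functions, covered by [ge0_gamma_rotate]. *)
Lemma gauss_smoothD a b x : 0 <= a -> 0 <= b ->
  gauss_smooth a (gauss_smooth b f) x = gauss_smooth (a + b) f x.
Proof.
move=> a0; rewrite le_eqVlt => /predU1P[<-|b0].
  rewrite addr0; apply: eq_Rintegral => z _; rewrite /gauss_smooth sqrtr0.
  by under eq_Rintegral do rewrite mul0r addr0; rewrite Rintegral_cst1.
have ab0 : 0 < a + b by rewrite ltr_wpDl.
pose c := Num.sqrt (a + b); pose al := Num.sqrt a / c; pose be := Num.sqrt b / c.
have c0 : 0 < c by rewrite sqrtr_gt0.
have albe : al ^+ 2 + be ^+ 2 = 1.
  rewrite /al /be !exprMn !sqr_sqrtr ?(ltW b0)// -mulrDl exprVn sqr_sqrtr ?(ltW ab0)//.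
  by rewrite divff// gt_eqF.
have be0 : 0 < be by rewrite divr_gt0// sqrtr_gt0.
pose h (u : R) := f (x + c * u) + B.
have h0 u : 0 <= h u by rewrite /h -lerBlDr sub0r; have := fB (x + c * u); rewrite ler_norml => /andP[].
have mh : measurable_fun setT h by apply: measurable_funD => //; exact: mfshift.
have hB u : `|h u| <= B + B by rewrite (le_trans (ler_normD _ _))// lerD// ger0_norm// (le_trans _ (fB 0)).
have := @ge0_gamma_rotate al be (EFin \o h) albe be0.
have mEh : measurable_fun setT (EFin \o h) by exact/measurable_EFinP.
move=> /(_ mEh) /(_ (fun u => h0 u)).
have E z : (\int[gamma]_w (EFin \o h) (al * z + be * w)%R =
    (gauss_smooth b f (x + Num.sqrt a * z) + B)%:E)%E.
  have -> : gauss_smooth b f (x + Num.sqrt a * z) + B =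
      \int[gamma]_w h (al * z + be * w).
    rewrite /gauss_smooth -[X in _ + X](Rintegral_cst1 gamma) -RintegralD//; last exact: integrable_cst.
    apply: eq_Rintegral => w _; rewrite /h; congr (f _ + _).
    by rewrite /al /be; field; rewrite gt_eqF.
  rewrite /Rintegral fineK//; apply: integrable_fin_num => //.
  apply: (@integrable_bounded _ _ _ _ (B + B)) => //.
  apply: measurableT_comp => //; exact: mshift.
under eq_integral do rewrite E.
move=> /(congr1 fine); rewrite -/(Rintegral _ _ _) -/(Rintegral _ _ _).
have -> : \int[gamma]_x0 (gauss_smooth b f (x + Num.sqrt a * x0) + B) =
    gauss_smooth a (gauss_smooth b f) x + B.
  rewrite RintegralD ?Rintegral_cst1//; last exact: integrable_cst.
  apply: (@integrable_bounded _ _ _ _ B).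
    exact: (measurableT_comp (measurable_gauss_smooth b) (mshift x (Num.sqrt a))).
  by move=> z; exact: gauss_smooth_bounded.
rewrite /h RintegralD ?Rintegral_cst1//; last exact: integrable_cst.
by move/addIr.
Qed.

End bounded.
End standard_normal.

(** * Smooth approximation of bounded continuous functions *)

Section smooth_approximation.
Variable R : realType.
Implicit Types f g h : R -> R.
Local Notation mu := (@lebesgue_measure R).

Definition unif_cont f := forall eps, 0 < eps -> exists2 del, 0 < del &
  forall x y, `|x - y| < del -> `|f x - f y| <= eps.

(** Heine's theorem, with only one of the two points confined to the compact
    interval. *)
Lemma continuous_unif_cont_on f A eps : continuous f -> 0 < eps ->
  exists2 del, 0 < del &
    forall x y, `|x| <= A -> `|x - y| < del -> `|f x - f y| <= eps.
Proof.
move=> cf eps0.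
have /compact_near_coveringP cK := @segment_compact R (- A) A.
pose Q (del x : R) := forall y, `|x - y| < del -> `|f x - f y| <= eps.
have : \forall del \near 0^'+, `[- A, A] `<=` Q del.
  apply: cK => x0 _.
  have e20 : 0 < eps / 2 by rewrite divr_gt0.
  have /cvgrPdist_le/(_ _ e20)/nbhs_ballP[r /= r0 hr] := cf x0.
  have r20 : 0 < r / 2 by rewrite divr_gt0.
  exists (ball x0 (r / 2), [set del : R | del < r / 2]).
    by split; [exact: nbhsx_ballx|exact: nbhs_right_lt].
  move=> [x del] [/= xr dr] y xy; rewrite /ball/= in xr.
  have h1 : `|f x0 - f x| <= eps / 2 by apply: hr; rewrite /ball/=; lra.
  have h2 : `|f x0 - f y| <= eps / 2.
    apply: hr; rewrite /ball/= -(subrKA x).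
    by rewrite (le_lt_trans (ler_normD _ _))//; lra.
  rewrite -(subrKA (f x0)) (le_trans (ler_normD _ _))// distrC; lra.
move=> [del /= del0 hdel]; exists (del / 2); first by rewrite divr_gt0.
move=> x y xA; apply: (hdel (del / 2)) => //.
- by rewrite /ball/= sub0r normrN gtr0_norm ?divr_gt0// ltr_pdivrMr// ltr_pMr// ltr1n.
- by rewrite divr_gt0.
- by rewrite /= in_itv/= -ler_norml.
Qed.

(** A class that is stable, up to a larger [A], under the moving averages used to
    regularize. *)
Definition bump (A B : R) f :=
  [/\ continuous f, unif_cont f, forall x, `|f x| <= B &
      forall x, A < `|x| -> f x = 0].

Lemma cutoff f a B : 0 < a -> continuous f -> (forall x, `|f x| <= B) ->
  exists2 g, bump (a + 1) B g & forall x, `|x| <= a -> g x = f x.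
Proof.
move=> a0 cf fB.
(* [max 0 (min 1 t)], in a form whose continuity is that of the norm *)
pose clamp (t : R) : R := (1 + `|t| - `|t - 1|) / 2.
have clamp_le0 t : t <= 0 -> clamp t = 0.
  by move=> t0; rewrite /clamp !ler0_norm//; lra.
have clamp_ge1 t : 1 <= t -> clamp t = 1.
  by move=> t1; rewrite /clamp !ger0_norm//; lra.
have clamp01 t : 0 <= t -> t <= 1 -> clamp t = t.
  by move=> t0 t1; rewrite /clamp ger0_norm// ler0_norm//; lra.
pose chi (x : R) : R := clamp (a + 1 - `|x|).
have cchi : continuous chi.
  have cs (x : R) : (a + 1 - `|t|) @[t --> x] --> (a + 1 - `|x|).
    by apply: cvgB; [exact: cvg_cst|exact: norm_continuous].
  move=> x; apply: cvgM; last exact: cvg_cst.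
  apply: cvgB; first by apply: cvgD; [exact: cvg_cst|exact: (cvg_norm (cs x))].
  by apply: cvg_norm; apply: (cvgB (cs x)); exact: cvg_cst.
have chi01 x : `|chi x| <= 1.
  rewrite /chi; have [h|h] := leP (a + 1 - `|x|) 0.
    by rewrite clamp_le0// normr0.
  have [h'|h'] := leP (a + 1 - `|x|) 1; last by rewrite clamp_ge1 ?normr1// ltW.
  by rewrite clamp01 ?(ltW h)// ger0_norm// ltW.
pose g x := f x * chi x.
have cg : continuous g by move=> x; apply: cvgM; [exact: cf|exact: cchi].
have g0 x : a + 1 < `|x| -> g x = 0.
  by move=> ax; rewrite /g /chi clamp_le0 ?mulr0//; lra.
exists g; last first.
  by move=> x xa; rewrite /g /chi clamp_ge1 ?mulr1//; lra.
split => //; last first.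
  move=> x; rewrite normrM -[leRHS]mulr1 ler_pM//.
move=> eps eps0.
have [del del0 hdel] := continuous_unif_cont_on (a + 1) cg eps0.
exists del => // x y xy.
have [xa|xa] := leP `|x| (a + 1); first exact: hdel.
have [ya|ya] := leP `|y| (a + 1).
  by rewrite distrC; apply: hdel => //; rewrite distrC.
by rewrite !g0// subrr normr0 ltW.
Qed.

Lemma mean_value f df (x y : R) : (forall x : R, is_derive x (1:R) f (df x)) ->
  exists2 t, `|t| <= `|y| & f (x + y) - f x = df (x + t) * y.
Proof.
move=> fdf.
have cf : continuous f.
  by move=> z; apply/differentiable_continuous/derivable1_diffP; have [] := fdf z.
have [y0|y0] := leP 0 y.
  have [|c + E] := @MVT_segment _ f df x (x + y) _ (fun x _ => fdf x) (continuous_subspaceT cf).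
    by rewrite lerDl.
  rewrite in_itv/= => /andP[c1 c2]; exists (c - x).
    by rewrite !ger0_norm// ?subr_ge0// lerBlDl.
  by rewrite E [x + (c - x)]addrC subrK [x + y]addrC addrK.
have [|c + E] := @MVT_segment _ f df (x + y) x _ (fun x _ => fdf x) (continuous_subspaceT cf).
  by rewrite gerDl ltW.
rewrite in_itv/= => /andP[c1 c2]; exists (c - x).
  by rewrite (ler0_norm (ltW y0)) ler0_norm ?subr_le0//; lra.
by rewrite -opprB E [x + (c - x)]addrC subrK; ring.
Qed.

Lemma bump_antiderivative A B g : bump A B g ->
  exists F : R -> R, forall x : R, is_derive x (1:R) F (g x).
Proof.
move=> [cg _ gB g0].
have mg : measurable_fun setT g by exact: continuous_measurable_fun.
have ig : mu.-integrable setT (EFin \o g).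
  apply: (@le_integrable_real _ _ _ mu _ (fun x => B * \1_(`[- A, A]) x)) => //.
    move=> x; rewrite indicE mem_setE in_itv/= -ler_norml.
    by have [xA|xA] := leP `|x| A; rewrite ?mulr1 ?mulr0// g0// normr0.
  exact: (integrable_realZ B (integrable_indic_itv (- A) A true false)).
pose F (x : R) : R := \int[mu]_(t in `]-oo, x]) g t.
have key (x : R) : derivable F x 1 /\ derive1 F x = g x.
  have x1 : x < x + 1 by rewrite ltrDl.
  have ix : mu.-integrable [set` Interval -oo%O (BRight (x + 1))] (EFin \o g).
    by apply: integrableS ig.
  exact: (continuous_FTC1 x1 ix (ltNyr _) (cg x)).
exists F => x; case: (key x); move: F {key} => F d e.
by apply: DeriveDef => //; rewrite -derive1E.
Qed.

(** [h] is the mean of [g] over the interval from [x] to [x + del]. By uniform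
    continuity it is close to [g] when [del] is small, and it has one derivative
    more than [g]. *)
Lemma bump_average A B g eps : bump A B g -> 0 < eps ->
  exists h del, [/\ 0 < del, bump (A + 1) B h, forall x, `|h x - g x| <= eps,
    forall x : R, is_derive x (1:R) h ((g (x + del) - g x) / del) &
    exists L, forall x y, `|h (x + y) - h x| <= L * `|y|].
Proof.
move=> bg eps0; have [cg ug gB g0] := bg.
have [F dF] := bump_antiderivative bg.
have [del0 del00 hdel] := ug _ eps0.
pose del := Num.min (del0 / 2) 1.
have delgt0 : 0 < del by rewrite lt_min ltr01 divr_gt0.
have del1 : del <= 1 by rewrite ge_min lexx orbT.
have deldel0 : del < del0.
  by rewrite gt_min ltr_pdivrMr// ltr_pMr// ltr1n.
pose h (x : R) : R := (F (x + del) - F x) / del.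
have hE x : exists2 t, `|t| <= del & h x = g (x + t).
  have [t td E] := mean_value x del dF; exists t.
    by rewrite (le_trans td)// gtr0_norm.
  by rewrite /h E mulfK// gt_eqF.
have dh (x : R) : is_derive x (1:R) h ((g (x + del) - g x) / del).
  have d1 : is_derive x (1:R) (F \o (fun t => t + del)) (g (x + del) * 1).
    have ds : is_derive x (1:R) (fun t : R => t + del) 1.
      by apply: is_derive_eq; rewrite addr0.
    exact: (@is_derive1_comp _ F (fun t => t + del) x _ _ (dF (x + del)) ds).
  have dF0 := dF x.
  rewrite (_ : h = (del^-1) *: ((F \o (fun t => t + del)) - F)); last first.
    by apply/funext => t; rewrite /h /= mulrC.
  by apply: is_derive_eq; rewrite mulr1 /GRing.scale/= mulrC.
have B0 : 0 <= B by rewrite (le_trans _ (gB 0)).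
have hL x y : `|h (x + y) - h x| <= (B + B) / del * `|y|.
  have [t _ ->] := mean_value x y dh.
  rewrite normrM ler_wpM2r// normrM normfV (gtr0_norm delgt0) ler_wpM2r ?invr_ge0 ?(ltW delgt0)//.
  by rewrite (le_trans (ler_normB _ _))// lerD.
exists h, del; split => //; last by exists ((B + B) / del).
  split.
  - by move=> x; apply/differentiable_continuous/derivable1_diffP; have [] := dh x.
  - move=> e e0; pose L := (B + B) / del + 1.
    have L0 : 0 < L by rewrite ltr_wpDl// divr_ge0 ?addr_ge0 ?(ltW delgt0).
    exists (e / L); first by rewrite divr_gt0.
    move=> x y xy; have := hL y (x - y); rewrite [y + _]addrC subrK => /le_trans; apply.
    apply: (@le_trans _ _ (L * `|x - y|)); first by rewrite ler_wpM2r// lerDl.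
    by rewrite mulrC -ler_pdivlMr// ltW.
  - by move=> x; have [t _ ->] := hE x.
  - move=> x Ax; have [t td ->] := hE x; apply: g0.
    have := ler_normB (x + t) t; rewrite addrK => ?; lra.
move=> x; have [t td ->] := hE x; apply: hdel.
by rewrite addrAC subrr add0r (le_lt_trans td).
Qed.

(** The expansion needed by Lindeberg's method, with a quadratic bound for large
    increments and a cubic one for small increments. Unlike differentiability,
    it passes to mixtures of translates without further argument. *)
Definition taylor (C D : R) f f1 f2 := forall x y,
  `|f (x + y) - f x - f1 x * y - f2 x * y ^+ 2 / 2| <=
    Num.min (C * y ^+ 2) (D * `|y| ^+ 3).

Lemma taylor_of_derive f f1 f2 C D : (forall x : R, is_derive x (1:R) f (f1 x)) ->
  (forall x : R, is_derive x (1:R) f1 (f2 x)) -> (forall x, `|f2 x| <= C) ->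
  (forall x y, `|f2 (x + y) - f2 x| <= D * `|y|) ->
  taylor (2 * C) D f f1 f2.
Proof.
move=> df df1 f2C f2D x y.
have D0 : 0 <= D by have := f2D 0 1; rewrite normr1 mulr1; apply: le_trans.
have dshift (g g1 : R -> R) (z : R) : (forall z : R, is_derive z (1:R) g (g1 z)) ->
    is_derive z (1:R) (fun y => g (x + y)) (g1 (x + z)).
  move=> dg; rewrite -[X in is_derive _ _ _ X]mulr1.
  have ds : is_derive z (1:R) (fun t : R => x + t) 1.
    rewrite (_ : (fun t : R => _) = (fun t => t + x)).
      by apply: is_derive_eq; rewrite addr0.
    by apply/funext => t; rewrite addrC.
  exact: (@is_derive1_comp _ g (fun y => x + y) z _ _ (dg (x + z)) ds).
pose r (y : R) : R := f (x + y) - f x - f1 x * y - f2 x * y ^+ 2 / 2.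
have dr (z : R) : is_derive z (1:R) r (f1 (x + z) - f1 x - f2 x * z).
  have d1 := dshift _ _ z df.
  by apply: is_derive_eq; rewrite /GRing.scale/=; field.
have [t ty] := mean_value 0 y dr.
have [s st E2] := mean_value x t df1.
rewrite !add0r {2}/r addr0 subrr mulr0 expr0n/= mulr0 mul0r !subr0 -/(r y) => ->.
have -> : f1 (x + t) - f1 x - f2 x * t = (f2 (x + s) - f2 x) * t by rewrite E2; ring.
rewrite !normrM le_min; apply/andP; split.
  rewrite -[y ^+ 2]real_normK ?num_real// expr2 mulrA.
  rewrite ler_wpM2r// ler_pM//.
  by rewrite (le_trans (ler_normB _ _))// mulr_natl mulr2n lerD.
rewrite exprS expr2 !mulrA ler_wpM2r// ler_pM//.
by rewrite (le_trans (f2D _ _))// ler_wpM2l// (le_trans st).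
Qed.

(** [f] is cut off and then averaged three times, which gives two continuous
    derivatives, the second one Lipschitz. *)
Lemma smooth_approximation f a B eps : 0 < a -> 0 < eps -> continuous f ->
  (forall x, `|f x| <= B) ->
  exists h h1 h2 C D, [/\ [/\ continuous h, continuous h1 & continuous h2],
    taylor C D h h1 h2,
    exists E, forall x, [/\ `|h x| <= B, `|h1 x| <= E & `|h2 x| <= E] &
    forall x, `|x| <= a -> `|h x - f x| <= eps].
Proof.
move=> a0 eps0 cf fB.
have e30 : 0 < eps / 3 by rewrite divr_gt0.
have [g bg gf] := cutoff a0 cf fB.
have [g1 [d1 [d10 bg1 g1g dg1 [L1 hL1]]]] := bump_average bg e30.
have [g2 [d2 [d20 bg2 g2g dg2 _]]] := bump_average bg1 e30.
have [h [d3 [d30 bh hg dh _]]] := bump_average bg2 e30.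
have [cg1 _ g1B _] := bg1; have [cg2 _ g2B _] := bg2; have [ch _ hB _] := bh.
have [_ _ gB _] := bg.
have B0 : 0 <= B by rewrite (le_trans _ (fB 0)).
pose Av (d : R) (u : R -> R) (x : R) : R := (u (x + d) - u x) / d.
have dAv (d : R) (u u' : R -> R) (x : R) : (forall x : R, is_derive x (1:R) u (u' x)) -> is_derive x (1:R) (Av d u) (Av d u' x).
  move=> du.
  have e1 : is_derive x (1:R) (u \o (fun t => t + d)) (u' (x + d) * 1).
    have ds : is_derive x (1:R) (fun t : R => t + d) 1.
      by apply: is_derive_eq; rewrite addr0.
    exact: (@is_derive1_comp _ u (fun t => t + d) x _ _ (du (x + d)) ds).
  have e2 := du x.
  rewrite (_ : Av d u = (d^-1) *: ((u \o (fun t => t + d)) - u)); last first.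
    by apply/funext => t; rewrite /Av /= mulrC.
  by apply: is_derive_eq; rewrite mulr1 /GRing.scale/= mulrC.
have cAv d u : continuous u -> continuous (Av d u).
  move=> cu x; apply: cvgM; last exact: cvg_cst.
  apply: cvgB; last exact: cu.
  apply: (cvg_comp (fun t => t + d) u); last exact: cu.
  by apply: cvgD; [exact: cvg_id|exact: cvg_cst].
have bAv d u M : 0 < d -> (forall x, `|u x| <= M) -> forall x, `|Av d u x| <= 2 * M / d.
  move=> d0 uM x; rewrite normrM normfV (gtr0_norm d0) ler_wpM2r ?invr_ge0 ?(ltW d0)//.
  by rewrite (le_trans (ler_normB _ _))// mulr_natl mulr2n lerD.
pose h1 := Av d3 g2; pose h2 := Av d3 (Av d2 g1).
have h2C := bAv _ _ _ d30 (bAv _ _ _ d20 g1B).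
have h1C := bAv _ _ _ d30 g2B.
have h2L x y : `|h2 (x + y) - h2 x| <= (2 * (2 * L1 / d2) / d3) * `|y|.
  have LAv d u L : 0 < d -> (forall x, `|u (x + y) - u x| <= L * `|y|) ->
      forall x, `|Av d u (x + y) - Av d u x| <= 2 * L / d * `|y|.
    move=> d0 uL z; rewrite /Av -mulrBl normrM normfV (gtr0_norm d0) mulrAC.
    rewrite ler_wpM2r ?invr_ge0 ?(ltW d0)//.
    rewrite (_ : _ - _ - _ = (u (z + d + y) - u (z + d)) - (u (z + y) - u z)).
      rewrite (le_trans (ler_normB _ _))//; have := uL (z + d); have := uL z; lra.
    by rewrite -[z + y + d]addrA [y + d]addrC addrA; ring.
  exact: (LAv _ _ _ d30 (LAv _ _ _ d20 (fun z => hL1 z y))).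
exists h, h1, h2, (2 * (2 * (2 * B / d2) / d3)), (2 * (2 * L1 / d2) / d3); split.
- by split; [exact: ch|exact: (cAv _ _ cg2)|exact: (cAv _ _ (cAv _ _ cg1))].
- exact: (taylor_of_derive dh (fun x => dAv _ _ _ _ dg2) h2C h2L).
- exists (Num.max (2 * B / d3) (2 * (2 * B / d2) / d3)) => x; split => //.
    by rewrite le_max h1C.
  by rewrite le_max h2C orbT.
- move=> x xa; rewrite -(gf x xa).
  have := hg x; have := g2g x; have := g1g x.
  have -> : h x - g x = (h x - g2 x) + ((g2 x - g1 x) + (g1 x - g x)) by ring.
  move=> i1 i2 i3; rewrite (le_trans (ler_normD _ _))//.
  have := ler_normD (g2 x - g1 x) (g1 x - g x); lra.
Qed.

End smooth_approximation.

(** * The central limit theorem *)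

Lemma taylor_ge0 (R : realType) (C D : R) f f1 f2 : taylor C D f f1 f2 ->
  0 <= C /\ 0 <= D.
Proof.
move=> t; have := le_trans (normr_ge0 _) (t 0 1).
by rewrite le_min expr1n normr1 expr1n !mulr1 => /andP[].
Qed.

Section taylor_integral.
Context d (T : measurableType d) (R : realType) (rho : probability T R).
Variables (C D E : R) (f f1 f2 : R -> R).
Hypotheses (tf : taylor C D f f1 f2).
Hypotheses (mf : measurable_fun setT f) (fE : forall x, `|f x| <= E).
Variable u : T -> R.
Hypotheses (u2 : u \in Lfun rho 2%:E) (u0 : \int[rho]_t u t = 0).

(** Up to the factor [c ^+ 2], the expected Taylor error of an increment
    [c * u]. *)
Definition lindeberg (c : R) :=
  \int[rho]_t Num.min (C * u t ^+ 2) (D * c * `|u t| ^+ 3).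

Let mu_ : measurable_fun setT u. Proof. by have [] := (Lfun2P _ _).1 u2. Qed.

Let iu2 : rho.-integrable setT (fun t => (u t ^+ 2)%:E).
Proof. by have [] := (Lfun2P _ _).1 u2. Qed.

Let mlind (c : R) :
  measurable_fun setT (fun t => Num.min (C * u t ^+ 2) (D * c * `|u t| ^+ 3)).
Proof.
apply: measurable_minr; apply: measurable_funM => //; apply: measurable_funX => //.
exact: measurableT_comp.
Qed.

Let lind_ge0 (c : R) t : 0 <= c ->
  0 <= Num.min (C * u t ^+ 2) (D * c * `|u t| ^+ 3).
Proof.
have [C0 D0] := taylor_ge0 tf.
move=> c0; rewrite le_min; apply/andP; split.
  by rewrite mulr_ge0// sqr_ge0.
by rewrite mulr_ge0// ?exprn_ge0// mulr_ge0.
Qed.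

Let ilind (c : R) : 0 <= c -> rho.-integrable setT
  (EFin \o (fun t => Num.min (C * u t ^+ 2) (D * c * `|u t| ^+ 3))).
Proof.
move=> c0; apply: (@le_integrable_real _ _ _ rho _ (fun t => C * u t ^+ 2)) => //.
- by move=> t; rewrite ger0_norm ?lind_ge0// ge_min lexx.
- exact: integrable_realZ.
Qed.

(** The first-order term vanishes because [u] is centred. *)
Lemma taylor_step (c x : R) : 0 <= c ->
  `|\int[rho]_t f (x + c * u t) - f x - f2 x * (c ^+ 2 * \int[rho]_t (u t ^+ 2)) / 2|
  <= c ^+ 2 * lindeberg c.
Proof.
move=> c0.
have if_ : rho.-integrable setT (EFin \o (fun t => f (x + c * u t))).
  apply: (@integrable_bounded _ _ _ _ E) => //.
  apply: measurableT_comp => //; apply: measurable_funD => //; exact: measurable_funM.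
have i1 : rho.-integrable setT (EFin \o (fun t => f1 x * c * u t)).
  by apply: integrable_realZ; exact: Lfun2_integrable.
have i2 : rho.-integrable setT (EFin \o (fun t => f2 x * c ^+ 2 / 2 * u t ^+ 2)).
  exact: integrable_realZ.
have i0 := integrable_cst rho (f x).
have i3 := integrable_realB if_ i0.
have i4 := integrable_realB i3 i1.
have i5 := integrable_realB i4 i2.
have -> : \int[rho]_t f (x + c * u t) - f x -
    f2 x * (c ^+ 2 * \int[rho]_t (u t ^+ 2)) / 2 =
  \int[rho]_t (f (x + c * u t) - cst (f x) t - f1 x * c * u t -
    f2 x * c ^+ 2 / 2 * u t ^+ 2).
  rewrite RintegralB// RintegralB// RintegralB// Rintegral_cst1.
  rewrite (RintegralZl _ _ (Lfun2_integrable u2))// (RintegralZl _ _ iu2)// u0.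
  by field.
apply: (le_trans (le_normr_Rintegral measurableT i5)).
rewrite /lindeberg -RintegralZl//; last exact: ilind.
apply: le_Rintegral => //.
- exact: (integrable_norm i5).
- by apply: integrable_realZ; exact: ilind.
move=> t _ /=; have := tf x (c * u t).
rewrite (_ : _ - f2 x * _ / 2 = f (x + c * u t) - f x - f1 x * c * u t -
    f2 x * c ^+ 2 / 2 * u t ^+ 2); last by field.
move=> /le_trans; apply.
rewrite minr_pMr ?sqr_ge0// normrM (ger0_norm c0) !exprMn.
rewrite le_eqVlt; apply/orP; left; apply/eqP; congr (Num.min _ _); ring.
Qed.

(** The cubic bound gives pointwise convergence and the quadratic one the
    domination, so that two moments of [u] suffice. *)
Lemma lindeberg_cvg0 : lindeberg (Num.sqrt n%:R)^-1 @[n --> \oo] --> 0.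
Proof.
pose F n t := Num.min (C * u t ^+ 2) (D * (Num.sqrt n%:R)^-1 * `|u t| ^+ 3).
have c0 n : 0 <= (Num.sqrt n%:R)^-1 :> R by rewrite invr_ge0.
have csqrt : (Num.sqrt n%:R)^-1 @[n --> \oo] --> (0:R).
  apply/cvgrPdist_le => e e0; exists (Num.truncn (e ^- 2)).+1 => // n /= hn.
  rewrite sub0r normrN ger0_norm// -[leRHS]invrK lef_pV2 ?posrE ?invr_gt0//; last first.
    by rewrite sqrtr_gt0 ltr0n (leq_trans _ hn).
  rewrite -(ler_sqr (_ : _ \in Num.nneg)) ?nnegrE ?invr_ge0 ?(ltW e0)//.
  rewrite sqr_sqrtr// exprVn (le_trans (ltW (truncnS_gt _)))// ler_nat//.
have := @dominated_convergence _ _ _ rho setT measurableT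
  (fun n t => (F n t)%:E) (cst 0%E) (fun t => (C * u t ^+ 2)%:E).
case => //.
- by move=> n; apply/measurable_EFinP; exact: mlind.
- apply: aeW => t _; apply: cvg_EFin; first by apply: nearW.
  apply: (@squeeze_cvgr _ _ _ _ (cst 0) (fun n => D * (Num.sqrt n%:R)^-1 * `|u t| ^+ 3)).
  + by apply: nearW => n; rewrite lind_ge0//= /F ge_min lexx orbT.
  + exact: cvg_cst.
  + rewrite -[X in _ --> X](mul0r (`|u t| ^+ 3)); apply: cvgMl.
    by rewrite -[X in _ --> X](mulr0 D); apply: cvgMr.
- exact: integrable_realZ.
- by apply: aeW => t n _ /=; rewrite lee_fin ger0_norm ?lind_ge0// /F ge_min lexx.
move=> _ _ /=; rewrite integral0 => h.
exact: (fine_cvg h).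
Qed.

End taylor_integral.

(** The bounds of [taylor] are uniform in the base point, hence preserved by
    averages over it. *)
Lemma gauss_smooth_taylor (R : realType) (C D E v : R) (f f1 f2 : R -> R) :
  measurable_fun setT f -> measurable_fun setT f1 -> measurable_fun setT f2 ->
  (forall x, [/\ `|f x| <= E, `|f1 x| <= E & `|f2 x| <= E]) ->
  taylor C D f f1 f2 ->
  taylor C D (gauss_smooth v f) (gauss_smooth v f1) (gauss_smooth v f2).
Proof.
move=> mf mf1 mf2 B tf x y; pose s := Num.sqrt v.
pose g := @normal_prob R 0 1.
have ii (h : R -> R) (z : R) : measurable_fun setT h -> (forall x, `|h x| <= E) ->
    g.-integrable setT (EFin \o (fun t : R => h (z + s * t))).
  move=> mh hE; apply: (@integrable_bounded _ _ _ g E) => //.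
  apply: measurableT_comp => //; apply: measurable_funD => //; exact: measurable_funM.
have fE z : `|f z| <= E by have [] := B z.
have f1E z : `|f1 z| <= E by have [] := B z.
have f2E z : `|f2 z| <= E by have [] := B z.
have i1 := integrable_realB (ii f (x + y) mf fE) (ii f x mf fE).
have j1 := integrable_realZ y (ii f1 x mf1 f1E).
have j2 := integrable_realZ (y ^+ 2 / 2) (ii f2 x mf2 f2E).
have i2 := integrable_realB i1 j1.
have i3 := integrable_realB i2 j2.
have -> : gauss_smooth v f (x + y) - gauss_smooth v f x - gauss_smooth v f1 x * y -
    gauss_smooth v f2 x * y ^+ 2 / 2 =
  \int[g]_t (f (x + y + s * t) - f (x + s * t) - y * f1 (x + s * t) -
     (y ^+ 2 / 2) * f2 (x + s * t)).
  rewrite RintegralB// RintegralB// RintegralB//; [|exact: ii|exact: ii].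
  rewrite (RintegralZl _ _ (ii f1 x mf1 f1E))// (RintegralZl _ _ (ii f2 x mf2 f2E))//.
  by rewrite /gauss_smooth -/g -/s; ring.
apply: (le_trans (le_normr_Rintegral measurableT i3)).
rewrite -[leRHS](Rintegral_cst1 g); apply: le_Rintegral => //.
- exact: (integrable_norm i3).
- exact: integrable_cst.
move=> t _ /=; have := tf (x + s * t) y; rewrite [x + s * t + y]addrAC.
by rewrite [y * _]mulrC [_ / 2 * _]mulrC !mulrA.
Qed.

Section lindeberg_swap.
Context d (T : measurableType d) d1 (Omega : measurableType d1) (R : realType).
Context (P : probability Omega R) (law : probability T R).
Variable Z : nat -> {RV P >-> T}.
Hypothesis iidZ : iid law Z.
Variable u : T -> R.
Hypotheses (u2 : u \in Lfun law 2%:E) (u0 : \int[law]_t u t = 0).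
Let v := \int[law]_t (u t ^+ 2).

Let v0 : 0 <= v. Proof. by apply: Rintegral_ge0 => t _; exact: sqr_ge0. Qed.

Local Notation gamma := (@normal_prob R 0 1).

(** The Gaussian variable with the same first two moments as [u]. *)
Let ug (z : R) := Num.sqrt v * z.

Let ug2 : ug \in Lfun gamma 2%:E.
Proof. exact: (Lfun2Z (Num.sqrt v) (Lfun2_gamma_id R)). Qed.

Let ug0 : \int[gamma]_z ug z = 0.
Proof.
rewrite RintegralZl//; last exact: (Lfun2_integrable (Lfun2_gamma_id R)).
by rewrite gamma_mean mulr0.
Qed.

Let ugsqr : \int[gamma]_z (ug z ^+ 2) = v.
Proof.
transitivity (\int[gamma]_z (v * z ^+ 2)).
  by apply: eq_Rintegral => z _; rewrite /ug exprMn sqr_sqrtr.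
rewrite RintegralZl//; first by rewrite gamma_sqr mulr1.
by have [] := (Lfun2P _ _).1 (Lfun2_gamma_id R).
Qed.

Let S n w := \sum_(i < n) u (Z i w).

Let mu_ : measurable_fun setT u. Proof. by have [] := (Lfun2P _ _).1 u2. Qed.

Let mS n : measurable_fun setT (S n).
Proof.
by apply: measurable_sum => i; apply: measurableT_comp.
Qed.

Section test_function.
Variables (C D E : R) (f f1 f2 : R -> R).
Hypotheses (mf : measurable_fun setT f) (mf1 : measurable_fun setT f1)
  (mf2 : measurable_fun setT f2).
Hypothesis fE : forall x, [/\ `|f x| <= E, `|f1 x| <= E & `|f2 x| <= E].
Hypothesis tf : taylor C D f f1 f2.

Let err (c : R) := lindeberg law C D u c + lindeberg gamma C D ug c.

Let fE0 x : `|f x| <= E. Proof. by have [] := fE x. Qed.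

Let mG a := measurable_gauss_smooth mf a.
Let GE a := gauss_smooth_bounded mf fE0 a.

(** One replacement. The [j]-th summand is integrated out given the previous
    ones, and a Gaussian of variance [v / n] is split off [gauss_smooth] by
    [gauss_smoothD]. Both are increments with the same mean and variance, so that
    the expansions of [taylor_step] differ by the error terms only. The Gaussian
    variables appear as averaging operators and need no probability space. *)
Let swap n j : (j < n)%N -> forall c : R, c = (Num.sqrt n%:R)^-1 ->
  `|\int[P]_w gauss_smooth ((n - j.+1)%:R * (v / n%:R)) f (c * S j.+1 w) -
    \int[P]_w gauss_smooth ((n - j)%:R * (v / n%:R)) f (c * S j w)| <= err c / n%:R.
Proof.
move=> jn c cE; have n0 : 0 < n%:R :> R by rewrite ltr0n (leq_trans _ jn).
have c0 : 0 <= c by rewrite cE invr_ge0.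
have c2 : c ^+ 2 = n%:R^-1 by rewrite cE exprVn sqr_sqrtr// ltW.
have vn0 : 0 <= v / n%:R by rewrite divr_ge0// ltW.
pose a := (n - j.+1)%:R * (v / n%:R).
have a0 : 0 <= a by rewrite mulr_ge0.
pose h := gauss_smooth a f; have mh : measurable_fun setT h := mG a.
have hE x : `|h x| <= E := GE a x.
have th := gauss_smooth_taylor a mf mf1 mf2 fE tf.
have -> : \int[P]_w h (c * S j.+1 w) = \int[P]_w \int[law]_y h (c * S j w + c * u y).
  pose F (p : iprod (fun _ : 'I_j => T) * T) := h (c * (\sum_(i < j) u (p.1 i)) + c * u p.2).
  have mF : measurable_fun setT F.
    apply: measurableT_comp => //; apply: measurable_funD; apply: measurable_funM => //.
      apply: measurable_sum => i.
      exact: (measurableT_comp mu_ (measurableT_comp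
        (@measurable_iprod_proj _ _ (fun _ : 'I_j => T) i) measurable_fst)).
    exact: measurableT_comp.
  have mZ i : measurable_fun setT (Z i) by exact: measurable_funPT.
  have := Rintegral_past_present iidZ (n := j) mF.
  rewrite /F/= => <-.
    by apply: eq_Rintegral => w _; rewrite /S big_ord_recr/= mulrDr.
  apply: (@integrable_bounded _ _ _ _ E) => //.
  apply: measurableT_comp => //; apply: measurable_funD; apply: measurable_funM => //.
    exact: mS.
  exact: measurableT_comp.
have -> : gauss_smooth ((n - j)%:R * (v / n%:R)) f = gauss_smooth (v / n%:R) h.
  apply/funext => x; rewrite /h (gauss_smoothD mf fE0)//.
  by rewrite /a subnS -{2}[v / n%:R]mul1r -mulrDl addrC natr1 prednK// subn_gt0.
have mcS i : measurable_fun setT (fun w => c * S i w).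
  by apply: measurable_funM => //; exact: mS.
have mL : measurable_fun setT (fun x : R => \int[law]_y h (x + c * u y)).
  apply: (@measurable_kernel_Rintegral _ _ _ _ _ (constant_kernel _ law)
     (fun p : R * T => h (p.1 + c * u p.2))).
  apply: measurableT_comp => //; apply: measurable_funD => //.
  by apply: measurable_funM => //; exact: measurableT_comp.
have LE x : `|\int[law]_y h (x + c * u y)| <= E.
  have ih : law.-integrable setT (EFin \o (fun y => h (x + c * u y))).
    apply: (@integrable_bounded _ _ _ _ E) => //.
    apply: measurableT_comp => //; apply: measurable_funD => //; exact: measurable_funM.
  apply: (le_trans (le_normr_Rintegral measurableT ih)).
  rewrite -[leRHS](Rintegral_cst1 law); apply: le_Rintegral => //.
  - exact: (integrable_norm ih).
  - exact: integrable_cst.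
have i1 : P.-integrable setT (EFin \o (fun w => \int[law]_y h (c * S j w + c * u y))).
  apply: (@integrable_bounded _ _ _ _ E) => //.
  exact: (measurableT_comp mL (mcS j)).
have i2 : P.-integrable setT (EFin \o (fun w => gauss_smooth (v / n%:R) h (c * S j w))).
  apply: (@integrable_bounded _ _ _ _ E).
    exact: (measurableT_comp (measurable_gauss_smooth mh _) (mcS j)).
  by move=> w; exact: gauss_smooth_bounded.
rewrite -RintegralB//.
have i3 := integrable_realB i1 i2.
apply: (le_trans (le_normr_Rintegral measurableT i3)).
rewrite -[leRHS](Rintegral_cst1 P); apply: le_Rintegral => //.
- exact: (integrable_norm i3).
- exact: integrable_cst.
move=> w _; set x := c * S j w.
have s1 := taylor_step th mh hE u2 u0 x c0.
have s2 := taylor_step th mh hE ug2 ug0 x c0.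
have -> : gauss_smooth (v / n%:R) h x = \int[gamma]_z h (x + c * ug z).
  apply: eq_Rintegral => z _; rewrite /ug mulrA [c * _]mulrC.
  by rewrite sqrtrM// sqrtrV ?ltW// cE.
move: s1 s2; rewrite ugsqr -/v.
set A := \int[law]_y _; set B := \int[gamma]_z _; set G := _ / 2; move=> s1 s2.
rewrite /err mulrC -c2 mulrDr.
have -> : A - B = (A - h x - G) - (B - h x - G) by ring.
by rewrite (le_trans (ler_normB _ _))// lerD.
Qed.

Lemma lindeberg_bound n : (0 < n)%N ->
  `|\int[P]_w f ((Num.sqrt n%:R)^-1 * S n w) - gauss_smooth v f 0| <=
  err (Num.sqrt n%:R)^-1.
Proof.
move=> n0; set c := (Num.sqrt n%:R)^-1.
have nR0 : 0 < n%:R :> R by rewrite ltr0n.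
(* [a j] keeps [j] of the original summands and replaces the others *)
pose a j := \int[P]_w gauss_smooth ((n - j)%:R * (v / n%:R)) f (c * S j w).
have an : a n = \int[P]_w f (c * S n w).
  apply: eq_Rintegral => w _; rewrite subnn mul0r /gauss_smooth sqrtr0.
  by under eq_Rintegral do rewrite mul0r addr0; rewrite Rintegral_cst1.
have a0 : a 0%N = gauss_smooth v f 0.
  rewrite /a subn0 mulrCA divff ?gt_eqF// mulr1.
  under eq_Rintegral do rewrite /S big_ord0 mulr0.
  by rewrite Rintegral_cst1.
rewrite -an -a0 -telescope_sumr// big_mkord.
apply: (le_trans (ler_norm_sum _ _ _)).
apply: (@le_trans _ _ (\sum_(i < n) err c / n%:R)).
  by apply: ler_sum => i _; exact: swap.
by rewrite sumr_const card_ord -[leLHS]mulr_natr divfK// gt_eqF.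
Qed.

Lemma clt_smooth : \int[P]_w f ((Num.sqrt n%:R)^-1 * S n w) @[n --> \oo] -->
  gauss_smooth v f 0.
Proof.
have e0 : err (Num.sqrt n%:R)^-1 @[n --> \oo] --> (0:R).
  rewrite -[X in _ --> X]addr0; apply: cvgD.
    exact: (lindeberg_cvg0 tf u2).
  exact: (lindeberg_cvg0 tf ug2).
apply/cvgrPdist_le => e egt0.
move/cvgrPdist_le : e0 => /(_ _ egt0) [N _ hN].
exists N.+1 => // n /= Nn.
rewrite distrC (le_trans (lindeberg_bound (leq_ltn_trans (leq0n _) Nn)))//.
have := hN n (ltnW Nn); rewrite sub0r normrN; exact: le_trans (ler_norm _).
Qed.

End test_function.

(** Where [a < `|x|], the functions differ by at most [2 * B], which is at most
    [2 * B * x ^+ 2 / a ^+ 2] and integrates to a multiple of the second moment. *)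
Let moment_bound (f h : R -> R) (a B e : R) d2 (O : measurableType d2)
    (m : probability O R) (X : O -> R) :
  0 < a -> 0 <= e -> measurable_fun setT f -> measurable_fun setT h ->
  (forall x, `|f x| <= B) -> (forall x, `|h x| <= B) ->
  (forall x, `|x| <= a -> `|h x - f x| <= e) -> X \in Lfun m 2%:E ->
  `|\int[m]_w f (X w) - \int[m]_w h (X w)| <=
    e + 2 * B / a ^+ 2 * \int[m]_w (X w ^+ 2).
Proof.
move=> a0 e0 mf mh fB hB hf X2; have [mX iX] := (Lfun2P _ _).1 X2.
have i1 : m.-integrable setT (EFin \o (fun w => f (X w))).
  by apply: (@integrable_bounded _ _ _ _ B) => //; exact: measurableT_comp.
have i2 : m.-integrable setT (EFin \o (fun w => h (X w))).
  by apply: (@integrable_bounded _ _ _ _ B) => //; exact: measurableT_comp.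
have i3 := integrable_realB i1 i2.
have i4 : m.-integrable setT (EFin \o (fun w => 2 * B / a ^+ 2 * X w ^+ 2)).
  exact: integrable_realZ.
have ie := integrable_cst m e.
rewrite -RintegralB//; apply: (le_trans (le_normr_Rintegral measurableT i3)).
rewrite -RintegralZl// -[e in leRHS](Rintegral_cst1 m) -RintegralD//.
apply: le_Rintegral => //.
- exact: (integrable_norm i3).
- exact: (integrable_realD ie i4).
move=> w _; set x := X w.
have a20 : 0 < a ^+ 2 by rewrite exprn_gt0.
have B0 : 0 <= B by rewrite (le_trans (normr_ge0 _) (fB 0)).
have [xa|xa] := leP `|x| a.
  rewrite distrC (le_trans (hf _ xa))// lerDl mulr_ge0 ?sqr_ge0//.
  by rewrite divr_ge0 ?mulr_ge0// ltW.
apply: (@le_trans _ _ (2 * B)).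
  by rewrite (le_trans (ler_normB _ _))// mulr_natl mulr2n lerD.
rewrite -[leLHS]add0r lerD// mulrAC ler_pdivlMr// ler_wpM2l ?mulr_ge0//.
by rewrite -(real_normK (num_real x)) lerXn2r ?nnegrE// ltW.
Qed.

(** [f] is replaced by a smooth approximation on a large interval; the normalized
    sum and its Gaussian limit have the same second moment [v], so that
    [moment_bound] makes the error uniform in [n]. *)
Lemma clt_bounded (f : R -> R) (B : R) : continuous f -> (forall x, `|f x| <= B) ->
  \int[P]_w f ((Num.sqrt n%:R)^-1 * S n w) @[n --> \oo] --> gauss_smooth v f 0.
Proof.
move=> cf fB; apply/cvgrPdist_le => e e0.
have B0 : 0 <= B by rewrite (le_trans (normr_ge0 _) (fB 0)).
have e6 : 0 < e / 6 by rewrite divr_gt0.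
(* the tail term of [moment_bound] is then at most [e / 6] *)
pose a := 1 + 2 * B * v / (e / 6).
have Bv0 : 0 <= 2 * B * v / (e / 6) by rewrite divr_ge0 ?mulr_ge0// ltW.
have a0 : 0 < a by rewrite ltr_pwDl.
have tail : 2 * B / a ^+ 2 * v <= e / 6.
  rewrite mulrAC ler_pdivrMr ?exprn_gt0// -ler_pdivrMl// mulrC.
  have a1 : 1 <= a by rewrite lerDl.
  rewrite (@le_trans _ _ a)//; first by rewrite /a lerDr.
  by rewrite expr2 ler_peMl// ltW.
have [h [h1 [h2 [C [D [[ch ch1 ch2] th [E hE] hf]]]]]] :=
  smooth_approximation a0 e6 cf fB.
have mf : measurable_fun setT f by exact: continuous_measurable_fun.
have mh : measurable_fun setT h by exact: continuous_measurable_fun.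
have hB x : `|h x| <= B by have [] := hE x.
have hME x : [/\ `|h x| <= Num.max B E, `|h1 x| <= Num.max B E &
    `|h2 x| <= Num.max B E].
  by have [p q r] := hE x; rewrite !le_max p q r !orbT.
have := clt_smooth mh (continuous_measurable_fun ch1)
  (continuous_measurable_fun ch2) hME th.
move/cvgrPdist_le => /(_ _ e6) [N _ hN].
exists N.+1 => // n /= Nn.
have n0 : 0 < n%:R :> R by rewrite ltr0n (leq_trans _ Nn).
set c := (Num.sqrt n%:R)^-1.
have S2 : (fun w => c * S n w) \in Lfun P 2%:E
  by exact: (Lfun2Z c (Lfun2_iid_sum iidZ n u2)).
have S2v : \int[P]_w ((c * S n w) ^+ 2) = v.
  under eq_Rintegral do rewrite exprMn.
  rewrite RintegralZl//; last exact: ((Lfun2P _ _).1 (Lfun2_iid_sum iidZ n u2)).2.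
  rewrite (Rintegral_iid_sum_sqr iidZ n u2 u0) mulrA /c exprVn sqr_sqrtr ?ltW//.
  by rewrite mulVf ?mul1r// gt_eqF.
have b1 := moment_bound a0 (ltW e6) mf mh fB hB hf S2.
have b2 := moment_bound a0 (ltW e6) mf mh fB hB hf ug2.
rewrite S2v in b1; rewrite ugsqr in b2.
have b3 := hN n (ltnW Nn).
have GE k : gauss_smooth v k 0 = \int[gamma]_z k (ug z).
  by apply: eq_Rintegral => z _; rewrite add0r.
rewrite !GE in b3 *.
have := b1; have := b2; have := b3; have := tail; rewrite -/c !ler_norml.
set p := 2 * B / a ^+ 2 * v; lra.
Qed.

End lindeberg_swap.

Lemma central_limit d (T : measurableType d) d1 (Omega : measurableType d1)
    (R : realType) (P : probability Omega R) (law : probability T R)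
    (Z : nat -> {RV P >-> T}) (g : T -> R) :
  iid law Z -> g \in Lfun law 2%:E ->
  cvg_in_distribution P
    (fun n w => Num.sqrt n%:R *
       ((\sum_(i < n) g (Z i w)) / n%:R - \int[law]_t g t))
    (normal_law 0 (\int[law]_t (g t - \int[law]_s g s) ^+ 2)).
Proof.
move=> iidZ g2; set c := \int[law]_t g t.
have mg : measurable_fun setT g by have [] := (Lfun2P _ _).1 g2.
have mX n : measurable_fun [set: Omega] (fun w => Num.sqrt n%:R *
    ((\sum_(i < n) g (Z i w)) / n%:R - c)).
  apply: measurable_funM => //; apply: measurable_funB => //.
  apply: measurable_funM => //; apply: measurable_sum => i.
  by apply: measurableT_comp.
split=> // f cf bf.
have [B fB] : exists B, forall x, `|f x| <= B.
  by case: bf => M [_ hM]; exists (M + 1) => x; apply: hM => //; rewrite ltrDl.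
have mf : measurable_fun setT f by exact: continuous_measurable_fun.
pose u t := g t - c.
have u2 : u \in Lfun law 2%:E by exact: (Lfun2B g2 (Lfun2_cst law c)).
have u0 : \int[law]_t u t = 0.
  rewrite RintegralB//; first by rewrite (Rintegral_cst1 law) subrr.
    exact: Lfun2_integrable.
  exact: (integrable_cst law c).
rewrite (gauss_smooth_normal_law mf fB); last first.
  by apply: Rintegral_ge0 => t _; exact: sqr_ge0.
have := clt_bounded iidZ u2 u0 cf fB.
move=> h.
have iX n : P.-integrable setT (EFin \o (fun w => f (Num.sqrt n%:R *
    ((\sum_(i < n) g (Z i w)) / n%:R - c)))).
  by apply: (@integrable_bounded _ _ _ _ B) => //; exact: measurableT_comp (mX n).
apply: cvg_EFin.
  apply: nearW => n; rewrite unlock.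
  exact: (integrable_fin_num measurableT (iX n)).
apply: cvg_trans h; apply: near_eq_cvg; exists 1%N => // n /= n0.
have nR0 : 0 < n%:R :> R by rewrite ltr0n.
rewrite expectation.unlock; apply: eq_Rintegral => w _ /=; congr f.
rewrite /u sumrB sumr_const card_ord -[c *+ n]mulr_natr.
have s0 : Num.sqrt n%:R != 0 :> R by rewrite gt_eqF// sqrtr_gt0.
have := sqr_sqrtr (ltW nR0); move: s0; set s := Num.sqrt _ => s0 <-.
by field.
Qed.

(** * Couplings of two cross-selected samples *)

(* distinguishes it from the gluing of two functions *)
Local Notation glue := Defs.glue.

Section glue.
Context (K : nat).
Context (d : 'I_K -> measure_display) (S : forall k, measurableType (d k)).
Variable A : {set 'I_K}.

Lemma glueT (x : subprod S A) (y : subprod S (~: A)) k (kA : k \in A) :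
  glue x y k = x (exist _ k kA).
Proof.
refine (match boolP (k \in A) as a in alt_spec _ _ b return
  (match a with
   | AltTrue kA' => x (exist _ k kA')
   | AltFalse kA' => y (exist _ k (etrans (finset.in_setC k A) kA'))
   end = x (exist _ k kA)) with AltTrue kA' => _ | AltFalse kA' => _ end).
  by rewrite (bool_irrelevance kA' kA).
by exfalso; move: kA'; rewrite kA.
Qed.

Lemma glueF (x : subprod S A) (y : subprod S (~: A)) k (kA : k \in ~: A) :
  glue x y k = y (exist _ k kA).
Proof.
refine (match boolP (k \in A) as a in alt_spec _ _ b return
  (match a with
   | AltTrue kA' => x (exist _ k kA')
   | AltFalse kA' => y (exist _ k (etrans (finset.in_setC k A) kA'))
   end = y (exist _ k kA)) with AltTrue kA' => _ | AltFalse kA' => _ end).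
  by exfalso; move: (kA); rewrite finset.in_setC kA'.
by congr (y (exist _ k _)); exact: bool_irrelevance.
Qed.

Lemma measurable_glue d1 (X : measurableType d1) (f : X -> subprod S A)
    (g : X -> subprod S (~: A)) :
  measurable_fun setT f -> measurable_fun setT g ->
  measurable_fun setT (fun p => glue (f p) (g p)).
Proof.
move=> mf mg; apply: measurable_fun_iprod => k.
have [kA|kA] := boolP (k \in A).
  under eq_fun do rewrite (glueT _ _ kA).
  exact: (measurableT_comp (@measurable_iprod_proj _ _ _ (exist _ k kA)) mf).
rewrite -finset.in_setC in kA.
under eq_fun do rewrite (glueF _ _ kA).
exact: (measurableT_comp (@measurable_iprod_proj _ _ _ (exist _ k kA)) mg).
Qed.

Lemma glue_rect (E : forall k, set (S k)) (x : subprod S A) (y : subprod S (~: A)) :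
  (forall k, E k (glue x y k)) <->
  (forall i, E (val i) (x i)) /\ (forall i, E (val i) (y i)).
Proof.
split=> [h|[h1 h2] k].
  split=> -[k kA]; first by rewrite -(glueT x y); exact: h.
  by rewrite -(glueF x y); exact: h.
have [kA|kA] := boolP (k \in A); first by rewrite (glueT _ _ kA); exact: (h1 (exist _ k kA)).
by rewrite -finset.in_setC in kA; rewrite (glueF _ _ kA); exact: (h2 (exist _ k kA)).
Qed.

End glue.

Section kernels.
Context d0 (Theta : measurableType d0) (R : realType) (K : nat).
Context (d : 'I_K -> measure_display) (S : forall k, measurableType (d k)).
Variable Mk : forall k, R.-pker Theta ~> S k.
Local Open Scope ereal_scope.

Lemma subkernelE A t (E : forall k, set (S k)) : (forall k, measurable (E k)) ->
  subkernel Mk A t [set x : subprod S A | forall i, E (val i) (x i)] =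
  \prod_(k in A) Mk k t (E k).
Proof.
move=> mE.
rewrite [LHS](@kprodE _ _ _ _ _ _ (fun i : {k | k \in A} => Mk (val i)) t
  (fun i => E (val i)))//.
by rewrite (@big_sub _ _ _ _ A (fun k => Mk k t (E k))).
Qed.

(** Where the selections agree, both conditions bear on the same draw; elsewhere
    they bear on two independent draws. *)
Lemma selection_pairE N (n n' : 'I_K -> 'I_N) t (E E' : forall k, set (S k)) :
  (forall k, measurable (E k)) -> (forall k, measurable (E' k)) ->
  kprod (fun _ : 'I_N => kprod Mk) t
    [set X : iprod (fun _ : 'I_N => iprod S) |
       (forall k, E k (X (n k) k)) /\ (forall k, E' k (X (n' k) k))] =
  (\prod_(k | n k == n' k) Mk k t (E k `&` E' k)) *
  ((\prod_(k | n k != n' k) Mk k t (E k)) *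
   (\prod_(k | n k != n' k) Mk k t (E' k))).
Proof.
move=> mE mE'.
(* the conditions that the event puts on the coordinate [k] of the [j]-th draw *)
pose F j k := (if n k == j then E k else setT) `&`
              (if n' k == j then E' k else setT).
have mF j k : measurable (F j k).
  by apply: measurableI; case: ifP.
rewrite (_ : [set X | _] = [set X : iprod (fun _ : 'I_N => iprod S) |
    forall j, [set x : iprod S | forall k, F j k (x k)] (X j)]); last first.
  apply/seteqP; split=> X /=.
    by move=> [h h'] j k; split; case: eqP => // <-.
  by move=> h; split=> k; [have [] := h (n k) k|have [] := h (n' k) k];
    rewrite eqxx.
rewrite [LHS](@kprodE _ _ _ _ _ _ (fun _ : 'I_N => kprod Mk) t
  (fun j => [set x : iprod S | forall k, F j k (x k)])); last first.
  by move=> j; exact: measurable_iprod_rect.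
under eq_bigr => j _ do rewrite (@kprodE _ _ _ _ _ _ Mk t (F j))//.
rewrite exchange_big/= (bigID (fun k => n k == n' k))/= -big_split/=.
congr (_ * _); apply: eq_bigr => k.
  move=> /eqP nn'; rewrite (bigD1 (n k))//= /F -nn' eqxx big1 ?mule1// => j jn.
  by rewrite eq_sym (negbTE jn) setIT prob_kernel.
move=> nn'; rewrite (bigD1 (n k))//= (bigD1 (n' k)) 1?eq_sym//= /F !eqxx.
rewrite (eq_sym (n' k)) (negbTE nn') setIT setTI big1 ?mule1// => j /andP[jn jn'].
by rewrite eq_sym (negbTE jn) eq_sym (negbTE jn') setIT prob_kernel.
Qed.

End kernels.

Lemma integral_kjointX d1 d2 (X : measurableType d1) (Y : measurableType d2)
    (R : realType) (m : probability X R) (k : R.-pker X ~> Y) A B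
    (g : X -> \bar R) :
  measurable A -> measurable B -> measurable_fun setT g ->
  (forall x, 0 <= g x)%E ->
  (\int[kjoint m k]_(p in A `*` B) g p.1 = \int[m]_(x in A) (g x * k x B))%E.
Proof.
move=> mA mB mg g0; have mAB : measurable (A `*` B) by exact: measurableX.
have mh : measurable_fun setT ((fun p : X * Y => g p.1) \_ (A `*` B)).
  apply: (measurable_restrictT (fun p : X * Y => g p.1) mAB).1.
  apply: measurable_funTS; exact: (measurableT_comp mg measurable_fst).
rewrite integral_mkcond [RHS]integral_mkcond ge0_integral_kjoint.
- apply: eq_integral => x _; rewrite patchE; case: ifPn => xA.
    rewrite -integral_cst// [RHS]integral_mkcond; apply: eq_integral => y _.
    rewrite !patchE in_setX/= xA/=; by case: ifP.
  apply: integral0_eq => y _; rewrite patchE in_setX/= (negbTE xA).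
  by [].
- exact: mh.
- by move=> p; rewrite patchE; case: ifP.
Qed.

Lemma kjoint_fst d1 d2 (X : measurableType d1) (Y : measurableType d2)
    (R : realType) (m : probability X R) (k : R.-pker X ~> Y) (A : set X) :
  measurable A -> kjoint m k (fst @^-1` A) = m A.
Proof.
move=> mA; rewrite (_ : fst @^-1` A = A `*` setT); last first.
  by apply/seteqP; split => -[x y] //= [].
rewrite kjointX// (eq_integral (cst 1%E)).
  by rewrite integral_cst// mul1e.
by move=> x _; exact: prob_kernel.
Qed.

Section coupling.
Context d0 (Theta : measurableType d0) (R : realType) (K : nat).
Context (d : 'I_K -> measure_display) (S : forall k, measurableType (d k)).
Variables (mu0 : probability Theta R) (Mk : forall k, R.-pker Theta ~> S k).

Definition marginal A : probability (Theta * subprod S A)%type R :=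
  kjoint mu0 (subkernel Mk A).

(** The law of the coordinates outside [A], for a [theta] that is read off the
    past by [f]. *)
Definition redraw A d1 (X : measurableType d1) (f : X -> Theta)
    (mf : measurable_fun setT f) : R.-pker X ~> subprod S (~: A) :=
  kpull (subkernel Mk (~: A)) mf.

Definition completed A :
    probability (Theta * subprod S A * subprod S (~: A))%type R :=
  kjoint (marginal A) (redraw A measurable_fst).

Let mfst2 A : measurable_fun setT
  (fun p : Theta * subprod S A * subprod S (~: A) => p.1.1).
Proof. exact: (measurableT_comp measurable_fst measurable_fst). Qed.

(** Given [(theta, x_A)], two independent completions are drawn. *)
Definition coupled A :
    probability (Theta * subprod S A * subprod S (~: A) * subprod S (~: A))%type R :=
  kjoint (completed A) (redraw A (@mfst2 A)).

Definition complete A (p : Theta * subprod S A * subprod S (~: A)) :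
    Theta * iprod S := (p.1.1, glue p.1.2 p.2).

Lemma measurable_complete A : measurable_fun setT (@complete A).
Proof.
apply/measurable_fun_pairP; split; first exact: mfst2.
apply: measurable_glue; last exact: measurable_snd.
exact: (measurableT_comp measurable_snd measurable_fst).
Qed.

Lemma coupled_rect A (E0 : set Theta) (EA : set (subprod S A))
    (EB EC : set (subprod S (~: A))) :
  measurable E0 -> measurable EA -> measurable EB -> measurable EC ->
  coupled A (E0 `*` EA `*` EB `*` EC) =
  (\int[mu0]_(t in E0) (subkernel Mk A t EA *
     (subkernel Mk (~: A) t EB * subkernel Mk (~: A) t EC)))%E.
Proof.
move=> m0 mA mB mC.
have mk d1 (Y : measurableType d1) (k : R.-pker Theta ~> Y) B : measurable B ->
    measurable_fun setT (k ^~ B) by move=> mE; exact: measurable_kernel.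
have mE0A : measurable (E0 `*` EA) by exact: measurableX.
have mE0AB : measurable (E0 `*` EA `*` EB) by exact: measurableX.
have mgC := mk _ _ (subkernel Mk (~: A)) EC mC.
have mgB := mk _ _ (subkernel Mk (~: A)) EB mB.
have s1 := @kjointX _ _ _ _ _ (completed A) (redraw A (@mfst2 A)) _ _ mE0AB mC.
have s2 := @integral_kjointX _ _ _ _ _ (marginal A) (redraw A measurable_fst)
  _ _ _ mE0A mB (measurableT_comp mgC measurable_fst) (fun q => measure_ge0 _ _).
have s3 := @integral_kjointX _ _ _ _ _ mu0 (subkernel Mk A) _ _ _ m0 mA
  (emeasurable_funM mgC mgB) (fun t => mule_ge0 (measure_ge0 _ _) (measure_ge0 _ _)).
apply: (etrans s1); apply: (etrans s2); apply: (etrans s3).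
by apply: eq_integral => t _; rewrite muleC [X in (_ * X)%E]muleC.
Qed.

(** The point [(theta, X^n)]. *)
Definition select N (n : 'I_K -> 'I_N) (z : sample Theta S N) : Theta * iprod S :=
  (z.1, fun k => z.2 (n k) k).

Lemma measurable_selection N (n : 'I_K -> 'I_N) : measurable_fun setT
  (fun (X : iprod (fun _ : 'I_N => iprod S)) => (fun k => X (n k) k) : iprod S).
Proof.
apply: measurable_fun_iprod => k.
exact: (measurableT_comp (@measurable_iprod_proj _ _ _ k)
  (@measurable_iprod_proj _ _ (fun _ : 'I_N => iprod S) (n k))).
Qed.

Lemma measurable_select N (n : 'I_K -> 'I_N) : measurable_fun setT (select n).
Proof.
apply/measurable_fun_pairP; split; first exact: measurable_fst.
exact: (measurableT_comp (measurable_selection n) measurable_snd).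
Qed.

Definition coupled_pair A
    (p : Theta * subprod S A * subprod S (~: A) * subprod S (~: A)) :
    Theta * (iprod S * iprod S) :=
  (p.1.1.1, (glue p.1.1.2 p.1.2, glue p.1.1.2 p.2)).

Lemma measurable_coupled_pair A : measurable_fun setT (@coupled_pair A).
Proof.
have m1 := measurableT_comp (@measurable_snd _ _ Theta (subprod S A))
  (measurableT_comp (@measurable_fst _ _ _ (subprod S (~: A)))
    (@measurable_fst _ _ (Theta * subprod S A * subprod S (~: A))%type
       (subprod S (~: A)))).
apply/measurable_fun_pairP; split.
  exact: (measurableT_comp (@mfst2 A) measurable_fst).
apply/measurable_fun_pairP; split.
  apply: (measurable_glue m1); exact: (measurableT_comp measurable_snd measurable_fst).
exact: (measurable_glue m1 measurable_snd).
Qed.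

Section agreement.
Variables (N : nat) (n n' : 'I_K -> 'I_N).
Local Notation A := [set k | n k == n' k]%SET.

Definition select_pair (z : sample Theta S N) : Theta * (iprod S * iprod S) :=
  (z.1, ((select n z).2, (select n' z).2)).

Lemma measurable_select_pair : measurable_fun setT select_pair.
Proof.
apply/measurable_fun_pairP; split; first exact: measurable_fst.
apply/measurable_fun_pairP; split;
  exact: (measurableT_comp measurable_snd (measurable_select _)).
Qed.

(** Given [theta], [X^n] and [X^n'] share their coordinates where [n] and [n']
    agree and are independent elsewhere: they are two completions of the same
    point. Both laws are computed on rectangles. *)
Lemma agreement_coupling C : measurable C ->
  sample_law mu0 Mk N (select_pair @^-1` C) = coupled A (@coupled_pair A @^-1` C).
Proof.
have GT := @rectangle_setT _ _ S.
have mG : @rectangle _ _ S `<=` measurable.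
  by move=> _ [B mB ->]; exact: measurable_iprod_rect.
have D2 := determining_prod GT GT mG (@determining_rectangle _ _ S R)
  (@determining_rectangle _ _ S R).
have D := determining_prod measurableT _ _ (@determining_measurable _ Theta R) D2.
apply: (D _ _
  (image_measure (sample_law mu0 Mk N) measurable_select_pair)
  (image_measure (coupled A) (@measurable_coupled_pair A))).
- by exists setT, setT; split => //; rewrite setXTT.
- move=> _ [E1 [E2 [/mG m1 /mG m2 ->]]]; exact: measurableX.
- by rewrite -[X in (X < _)%E]/(sample_law mu0 Mk N _) probability_setT ltry.
move=> _ [E0 [_ [m0 [_ [_ [[E mE ->] [E' mE' ->] ->]]] ->]]].
rewrite -[LHS]/(sample_law mu0 Mk N _) -[RHS]/(coupled A _).
pose Q := [set X : iprod (fun _ : 'I_N => iprod S) |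
       (forall k, E k (X (n k) k)) /\ (forall k, E' k (X (n' k) k))].
have mQ : measurable Q.
  have mE_ (m : 'I_K -> 'I_N) (F : forall k, set (S k)) : (forall k, measurable (F k)) ->
      measurable [set X : iprod (fun _ : 'I_N => iprod S) | forall k, F k (X (m k) k)].
    move=> mF; rewrite -[X in measurable X]setTI.
    exact: (measurable_selection m measurableT (measurable_iprod_rect mF)).
  exact: measurableI (mE_ n _ mE) (mE_ n' _ mE').
transitivity (sample_law mu0 Mk N (E0 `*` Q)).
  by congr (sample_law _ _ _ _); apply/seteqP; split => -[t X].
rewrite [LHS](kjointX _ _ m0 mQ).
pose EA := [set x : subprod S A | forall i, (E (val i) `&` E' (val i)) (x i)].
pose EB (F : forall k, set (S k)) :=
  [set y : subprod S (~: A) | forall i, F (val i) (y i)].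
have mEA : measurable EA.
  apply: (@measurable_iprod_rect _ _ _ (fun i : {k | k \in A} =>
    E (val i) `&` E' (val i))) => i.
  exact: measurableI.
have mEB F : (forall k, measurable (F k)) -> measurable (EB F).
  move=> mF; exact: (@measurable_iprod_rect _ _ _
    (fun i : {k | k \in (~: A)} => F (val i))).
transitivity (coupled A (E0 `*` EA `*` EB E `*` EB E')); last first.
  congr (coupled A _); apply/seteqP; split => -[[[t x] y] y'] /=.
    move=> [[[tE xE] yE] yE']; split=> //; split; apply/glue_rect; split=> // i.
      by have [] := xE i.
    by have [] := xE i.
  move=> [tE [/glue_rect[xE yE] /glue_rect[xE' yE']]].
  by split => //; split => //; split.
rewrite (coupled_rect m0 mEA (mEB _ mE) (mEB _ mE')).
apply: eq_integral => t _.
rewrite (selection_pairE _ _ _ _ mE mE').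
rewrite /EA (subkernelE _ _ _ (fun k => measurableI _ _ (mE k) (mE' k))).
rewrite /EB (subkernelE _ _ _ mE) (subkernelE _ _ _ mE').
by congr (_ * (_ * _))%E; apply: eq_bigl => k; rewrite !finset.inE.
Qed.

End agreement.

Local Notation mu := (kjoint mu0 (kprod Mk)).

(** Given [theta] the coordinates are independent, so that those outside [A] can
    be drawn after those in [A]. *)
Lemma completed_law A C : measurable C ->
  completed A (@complete A @^-1` C) = mu C.
Proof.
have GT := @rectangle_setT _ _ S.
have mG : @rectangle _ _ S `<=` measurable.
  by move=> _ [B mB ->]; exact: measurable_iprod_rect.
have D := determining_prod measurableT GT mG (@determining_measurable _ Theta R)
  (@determining_rectangle _ _ S R).
apply: (D (image_measure (completed A) (@measurable_complete A)) mu).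
  by rewrite -[X in (X < _)%E]/(completed A _) probability_setT ltry.
move=> _ [E0 [_ [m0 [E mE ->] ->]]]; rewrite -[LHS]/(completed A _).
pose EA (B : {set 'I_K}) (F : forall k, set (S k)) :=
  [set y : subprod S B | forall i, F (val i) (y i)].
have mEA B : measurable (EA B E).
  exact: (@measurable_iprod_rect _ _ _ (fun i : {k | k \in B} => E (val i))).
transitivity (completed A (E0 `*` EA A E `*` EA (~: A) E)).
  congr (completed A _); apply/seteqP; split => -[[t x] y] /=.
    by move=> [tE /glue_rect[xE yE]].
  by move=> [[tE xE] yE]; split=> //; exact/glue_rect.
have mgB : measurable_fun setT (fun t => subkernel Mk (~: A) t (EA (~: A) E)).
  exact: measurable_kernel.
have s1 := @kjointX _ _ _ _ _ (marginal A) (redraw A measurable_fst) _ _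
  (measurableX m0 (mEA A)) (mEA (~: A)).
have s2 := @integral_kjointX _ _ _ _ _ mu0 (subkernel Mk A) _ _ _ m0 (mEA A)
  mgB (fun t => measure_ge0 _ _).
apply: (etrans s1); apply: (etrans s2).
rewrite [RHS](kjointX _ _ m0 (measurable_iprod_rect mE)).
apply: eq_integral => t _; rewrite kprodE// /EA !(subkernelE _ _ _ mE).
rewrite muleC [RHS](bigID (fun k => k \in A))/=; congr (_ * _)%E.
by apply: eq_bigl => k; rewrite finset.in_setC.
Qed.

(** The marginal law in the case [n' = n] of [agreement_coupling]. *)
Lemma select_law N (n : 'I_K -> 'I_N) C : measurable C ->
  sample_law mu0 Mk N (select n @^-1` C) = mu C.
Proof.
move=> mC; pose C' := [set p : Theta * (iprod S * iprod S) | C (p.1, p.2.1)].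
have mC' : measurable C'.
  have mp : measurable_fun setT (fun p : Theta * (iprod S * iprod S) => (p.1, p.2.1)).
    apply/measurable_fun_pairP; split; first exact: measurable_fst.
    exact: (measurableT_comp measurable_fst measurable_snd).
  by rewrite -[C']setTI; exact: mp.
have := agreement_coupling n n mC'.
rewrite -[select_pair n n @^-1` C']/(select n @^-1` C) => ->.
rewrite -(completed_law [set k | n k == n k]%SET mC).
set A := [set k | n k == n k]%SET.
have mD : measurable (@complete A @^-1` C).
  by rewrite -[X in measurable X]setTI; exact: measurable_complete.
exact: (kjoint_fst (completed A) (redraw A (@mfst2 A)) mD).
Qed.

Lemma glue_set0_law (x : subprod S finset.set0) t C : measurable C ->
  subkernel Mk (~: finset.set0) t ((fun y => glue x y) @^-1` C) = kprod Mk t C.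
Proof.
have mg : measurable_fun setT (fun y : subprod S (~: finset.set0) => glue x y).
  by apply: measurable_glue => //; exact: measurable_cst.
apply: (determining_rectangle
  (m1 := image_measure (kernel_value (subkernel Mk (~: finset.set0)) t) mg)
  (m2 := kernel_value (kprod Mk) t)).
  by rewrite -[X in (X < _)%E]/(kernel_value (subkernel Mk (~: finset.set0)) t _)
    probability_setT ltry.
move=> _ [E mE ->]; rewrite -[RHS]/(kprod Mk t _) kprodE//.
transitivity (subkernel Mk (~: finset.set0) t
  [set y : subprod S (~: finset.set0) | forall i, E (val i) (y i)]).
  congr (subkernel _ _ _ _); apply/seteqP; split=> y /=.
    by move=> /glue_rect[].
  by move=> h; apply/glue_rect; split => // -[k k0]; exfalso; rewrite finset.inE in k0.
rewrite (subkernelE _ _ _ mE); apply: eq_bigl => k.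
by rewrite finset.in_setC finset.inE.
Qed.

End coupling.

(** * Second moments of partial integrals *)

Section second_moments.
Context d0 (Theta : measurableType d0) (R : realType) (K : nat).
Context (d : 'I_K -> measure_display) (S : forall k, measurableType (d k)).
Variables (mu0 : probability Theta R) (Mk : forall k, R.-pker Theta ~> S k).
Variable phi : Theta * iprod S -> R.
Local Notation mu := (kjoint mu0 (kprod Mk) : probability (Theta * iprod S)%type R).

Lemma Lfun2_image d1 d2 (X : measurableType d1) (Y : measurableType d2)
    (m1 : probability X R) (m2 : probability Y R) (f : X -> Y) g :
  measurable_fun setT f ->
  (forall A, measurable A -> m1 (f @^-1` A) = m2 A) ->
  g \in Lfun m2 2%:E -> g \o f \in Lfun m1 2%:E.
Proof.
move=> mf m12 /Lfun2P[mg ig]; apply/Lfun2P; split.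
  exact: measurableT_comp.
exact: (integrable_image mf m12 ig).
Qed.

(** Jensen's inequality for the square. Nothing is to be proved when the right-hand
    side is infinite; otherwise the difference is a variance. *)
Lemma sqr_Rintegral_le d1 (X : measurableType d1) (m : probability X R) (f : X -> R) :
  measurable_fun setT f ->
  (((\int[m]_y f y) ^+ 2)%:E <= \int[m]_y (f y ^+ 2)%:E)%E.
Proof.
move=> mf.
have [->|fin] := eqVneq (\int[m]_y (f y ^+ 2)%:E)%E +oo%E; first by rewrite leey.
have i2 : m.-integrable setT (fun y => (f y ^+ 2)%:E).
  apply/integrableP; split; first by apply/measurable_EFinP; exact: measurable_funX.
  under eq_integral do rewrite gee0_abs ?lee_fin ?sqr_ge0//.
  by rewrite ltey.
have f2 : f \in Lfun m 2%:E by apply/Lfun2P.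
have h : 0 <= \int[m]_y (f y ^+ 2) - (\int[m]_y f y) ^+ 2.
  by rewrite -Rintegral_sqrB//; apply: Rintegral_ge0 => y _; exact: sqr_ge0.
rewrite -[leRHS]fineK; last exact: integrable_fin_num.
by rewrite lee_fin -subr_ge0.
Qed.

(** By Jensen's inequality in each fibre, conditional expectation contracts the
    L2 norm. *)
Lemma Lfun2_kernel_Rintegral d1 d2 (X : measurableType d1) (Y : measurableType d2)
    (m : probability X R) (k : R.-pker X ~> Y) (f : X * Y -> R) :
  f \in Lfun (kjoint m k) 2%:E ->
  (fun x => \int[k x]_y f (x, y)) \in Lfun m 2%:E.
Proof.
move=> /Lfun2P[mf if2]; have mk := measurable_kernel_Rintegral k mf.
apply/Lfun2P; split => //; apply/integrableP; split.
  by apply/measurable_EFinP; exact: measurable_funX.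
under eq_integral do rewrite gee0_abs ?lee_fin ?sqr_ge0//.
have mf2 : measurable_fun setT (fun p => (f p ^+ 2)%:E).
  by apply/measurable_EFinP; exact: measurable_funX.
have f0 p : (0 <= (f p ^+ 2)%:E)%E by rewrite lee_fin sqr_ge0.
apply: (@le_lt_trans _ _ (\int[m]_x \int[k x]_y (f (x, y) ^+ 2)%:E)%E).
  apply: ge0_le_integral.
  - exact: measurableT.
  - by move=> x _; rewrite lee_fin sqr_ge0.
  - by apply/measurable_EFinP; exact: measurable_funX.
  - exact: (measurable_kernel_integral k mf2 f0).
  - move=> x _; have mfx := measurableT_comp mf (measurable_pair1 x).
    exact: (sqr_Rintegral_le (kernel_value k x) mfx).
rewrite -(ge0_integral_kjoint m k mf2 f0).
have /integrableP[_] := if2; apply: le_lt_trans; apply: ge0_le_integral.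
- exact: measurableT.
- by move=> q _; exact: f0.
- exact: mf2.
- exact: (measurableT_comp _ mf2).
- by move=> q _; exact: lee_abs.
Qed.

Lemma partial_int_set0 t (x : subprod S finset.set0) :
  measurable_fun setT phi -> partial_int Mk phi (t, x) = full_int Mk phi t.
Proof.
move=> mphi; rewrite /partial_int /full_int/=.
have mg : measurable_fun setT (fun y : subprod S (~: finset.set0) => glue x y).
  by apply: measurable_glue => //; exact: measurable_cst.
have mt : measurable_fun setT (fun y : iprod S => phi (t, y)).
  exact: (measurableT_comp mphi (measurable_pair1 t)).
exact: (Rintegral_image mg (fun A => @glue_set0_law _ _ _ _ _ _ Mk x t A) mt).
Qed.

Hypotheses (phi2 : phi \in Lfun mu 2%:E) (hd : partial_int_defined Mk phi).

Let mphi : measurable_fun setT phi.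
Proof. by have [] := (Lfun2P mu phi).1 phi2. Qed.

Let mfst2 A : measurable_fun setT
  (fun p : Theta * subprod S A * subprod S (~: A) => p.1.1).
Proof. exact: (measurableT_comp measurable_fst measurable_fst). Qed.

Let mpc A : measurable_fun setT (phi \o @complete _ _ _ _ S A).
Proof. exact: (measurableT_comp mphi (@measurable_complete _ _ _ _ S A)). Qed.

Let Lfun2_complete A : phi \o @complete _ _ _ _ S A \in Lfun (completed mu0 Mk A) 2%:E.
Proof.
exact: (Lfun2_image (@measurable_complete _ _ _ _ S A)
  (@completed_law _ _ _ _ _ _ mu0 Mk A) phi2).
Qed.

Lemma Lfun2_partial_int A :
  @partial_int _ _ _ _ _ S Mk A phi \in Lfun (marginal mu0 Mk A) 2%:E.
Proof. exact: (Lfun2_kernel_Rintegral (@Lfun2_complete A)). Qed.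

Lemma Lfun2_full_int : full_int Mk phi \in Lfun mu0 2%:E.
Proof. exact: (Lfun2_kernel_Rintegral phi2). Qed.

Definition partial_moment A := \int[marginal mu0 Mk A]_p (partial_int Mk phi p ^+ 2).

Let Lfun2_completed_fst A (f : Theta * subprod S A -> R) :
  f \in Lfun (marginal mu0 Mk A) 2%:E ->
  (fun q : Theta * subprod S A * subprod S (~: A) => f q.1) \in
    Lfun (completed mu0 Mk A) 2%:E.
Proof.
move=> f2; exact: (Lfun2_image measurable_fst
  (kjoint_fst (marginal mu0 Mk A) (redraw Mk A measurable_fst)) f2).
Qed.

(** [partial_int] is the conditional expectation of [phi] given [(theta, x_A)].
    The assumption [partial_int_defined] makes this hold pointwise. *)
Lemma integral_completed A (f : Theta * subprod S A -> R) :
  f \in Lfun (marginal mu0 Mk A) 2%:E ->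
  \int[completed mu0 Mk A]_q (f q.1 * phi (complete q)) =
  \int[marginal mu0 Mk A]_p (f p * partial_int Mk phi p).
Proof.
move=> f2.
have i1 := Lfun2_mul (Lfun2_completed_fst f2) (Lfun2_complete A).
rewrite [LHS](Rintegral_kjoint i1); apply: eq_Rintegral => -[t x] _ /=.
by rewrite RintegralZl//; exact: hd.
Qed.

Lemma Lfun2_select N (n : 'I_K -> 'I_N) :
  phi \o @select _ _ _ _ S N n \in Lfun (sample_law mu0 Mk N) 2%:E.
Proof.
exact: (Lfun2_image (measurable_select n)
  (select_law mu0 Mk n) phi2).
Qed.

(** In the coupling both factors have the conditional expectation [partial_int]
    given [(theta, x_A)] and are conditionally independent. *)
Lemma Rintegral_select_mul N (n n' : 'I_K -> 'I_N) :
  \int[sample_law mu0 Mk N]_z (phi (select n z) * phi (select n' z)) =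
  partial_moment [set k | n k == n' k]%SET.
Proof.
set A := [set k | _]%SET.
pose h (p : Theta * (iprod S * iprod S)) := phi (p.1, p.2.1) * phi (p.1, p.2.2).
have m1 : measurable_fun setT (fun p : Theta * (iprod S * iprod S) => (p.1, p.2.1)).
  apply/measurable_fun_pairP; split; first exact: measurable_fst.
  exact: (measurableT_comp measurable_fst measurable_snd).
have m2 : measurable_fun setT (fun p : Theta * (iprod S * iprod S) => (p.1, p.2.2)).
  apply/measurable_fun_pairP; split; first exact: measurable_fst.
  exact: (measurableT_comp measurable_snd measurable_snd).
have mh : measurable_fun setT h.
  by apply: measurable_funM; [exact: (measurableT_comp mphi m1)|exact: (measurableT_comp mphi m2)].
have mG := @measurable_coupled_pair _ Theta _ _ S A.
have mF := @measurable_select_pair _ Theta _ _ S _ n n'.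
have e1 := Rintegral_image (m2 := image_measure (coupled mu0 Mk A) mG) mF
  (fun C mC => agreement_coupling mu0 Mk n n' mC) mh.
have e2 := Rintegral_image (m1 := coupled mu0 Mk A)
  (m2 := image_measure (coupled mu0 Mk A) mG) mG (fun C mC => erefl) mh.
rewrite [LHS]e1 -[LHS]e2.
have law1 C : measurable C -> coupled mu0 Mk A ((@complete _ _ _ _ S A \o fst) @^-1` C) = mu C.
  move=> mC; apply: etrans (completed_law mu0 Mk A mC).
  apply: (kjoint_fst (completed mu0 Mk A) (redraw Mk A (@mfst2 A))).
  by rewrite -[X in measurable X]setTI; exact: measurable_complete.
have law2 C : measurable C -> coupled mu0 Mk A
    ((fun p => ((coupled_pair p).1, (coupled_pair p).2.2)) @^-1` C) = mu C.
  move=> mC; apply: etrans (select_law mu0 Mk n' mC).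
  have mC' : measurable [set p : Theta * (iprod S * iprod S) | C (p.1, p.2.2)].
    by rewrite -[X in measurable X]setTI; exact: m2.
  exact/esym/(agreement_coupling mu0 Mk n n' mC').
have i1 := Lfun2_mul
  (Lfun2_image (measurableT_comp (@measurable_complete _ _ _ _ S A) measurable_fst) law1 phi2)
  (Lfun2_image (measurableT_comp m2 mG) law2 phi2).
rewrite [LHS](Rintegral_kjoint i1).
transitivity (\int[completed mu0 Mk A]_q (partial_int Mk phi q.1 * phi (complete q))).
  apply: eq_Rintegral => -[[t x] y] _ /=; rewrite mulrC.
  by rewrite RintegralZl//; exact: hd.
by rewrite (integral_completed (@Lfun2_partial_int A)).
Qed.

Let full_fst A := fun p : Theta * subprod S A => full_int Mk phi p.1.

Let Lfun2_full_fst A : @full_fst A \in Lfun (marginal mu0 Mk A) 2%:E.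
Proof.
exact: (Lfun2_image measurable_fst (kjoint_fst mu0 (subkernel Mk A)) Lfun2_full_int).
Qed.

Let full_moment := \int[mu0]_t (full_int Mk phi t ^+ 2).

Let mfull : measurable_fun setT (full_int Mk phi).
Proof. by have [] := (Lfun2P _ _).1 Lfun2_full_int. Qed.

Let Rintegral_full_fst A :
  \int[marginal mu0 Mk A]_p (@full_fst A p ^+ 2) = full_moment.
Proof.
exact: (Rintegral_image measurable_fst (kjoint_fst mu0 (subkernel Mk A))
  (measurable_funX 2 mfull)).
Qed.

(** The scalar product of [full_int] with any conditional expectation of [phi] is
    its scalar product with [phi] itself, which no longer depends on [A]; for the
    empty set it is the squared norm of [full_int]. *)
Let partial_full_moment A :
  \int[marginal mu0 Mk A]_p (@full_fst A p * partial_int Mk phi p) = full_moment.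
Proof.
have muE B : \int[marginal mu0 Mk B]_p (@full_fst B p * partial_int Mk phi p) =
    \int[mu]_p (full_int Mk phi p.1 * phi p).
  rewrite -(integral_completed (@Lfun2_full_fst B)).
  have mg : measurable_fun setT (fun p : Theta * iprod S => full_int Mk phi p.1 * phi p).
    by apply: measurable_funM => //; exact: (measurableT_comp mfull measurable_fst).
  exact: (Rintegral_image (@measurable_complete _ _ _ _ S B)
    (@completed_law _ _ _ _ _ _ mu0 Mk B) mg).
rewrite muE -(muE finset.set0) -(Rintegral_full_fst finset.set0).
by apply: eq_Rintegral => -[t x] _; rewrite partial_int_set0// expr2.
Qed.

Lemma partial_moment_set0 : partial_moment finset.set0 = full_moment.
Proof.
rewrite -(Rintegral_full_fst finset.set0).
by apply: eq_Rintegral => -[t x] _; rewrite partial_int_set0.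
Qed.

(** Pythagoras: [full_int] is the orthogonal projection of [partial_int] on the
    functions of [theta]. *)
Lemma partial_full_variance A :
  \int[mu0]_t \int[subkernel Mk A t]_x
    (partial_int Mk phi (t, x) - full_int Mk phi t) ^+ 2 =
  partial_moment A - partial_moment finset.set0.
Proof.
have p2 := Lfun2_partial_int A; have f2 := Lfun2_full_fst A.
have [md id] := (Lfun2P _ _).1 (Lfun2B p2 f2).
have [_ ip2] := (Lfun2P _ _).1 p2; have [_ if2] := (Lfun2P _ _).1 f2.
have ipf := Lfun2_mul f2 p2.
rewrite -[LHS](Rintegral_kjoint id).
transitivity (\int[marginal mu0 Mk A]_p (partial_int Mk phi p ^+ 2 -
    (2 * (@full_fst A p * partial_int Mk phi p) - @full_fst A p ^+ 2))).
  by apply: eq_Rintegral => p _; ring.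
have i3 := integrable_realZ 2 ipf.
rewrite [LHS](RintegralB measurableT ip2 (integrable_realB i3 if2)).
rewrite (RintegralB measurableT i3 if2) (RintegralZl 2 measurableT ipf).
rewrite partial_moment_set0; transitivity (partial_moment A - (2 * full_moment - full_moment)).
  congr (_ - (2 * _ - _)); first exact: partial_full_moment.
  exact: Rintegral_full_fst.
by ring.
Qed.

Lemma full_int_variance : \int[mu0]_t (full_int Mk phi t - \int[mu]_p phi p) ^+ 2 =
  partial_moment finset.set0 - (\int[mu]_p phi p) ^+ 2.
Proof.
rewrite (Rintegral_kjoint (Lfun2_integrable phi2)).
by rewrite [LHS](Rintegral_sqrB Lfun2_full_int) partial_moment_set0.
Qed.

End second_moments.

(** * Agreement sets of two selections *)

Section agreement_weights.
Variables (R : realType) (K N : nat).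
Hypothesis N0 : (0 < N)%N.
Variable V : {set 'I_K} -> R.
Local Notation c := (N%:R^-1 : R).

(** The probability that two independent uniform selections agree exactly
    on [B]. *)
Definition agreement_weight (B : {set 'I_K}) : R :=
  \prod_k (if k \in B then c else 1 - c).

Let NR0 : N%:R != 0 :> R. Proof. by rewrite pnatr_eq0 -lt0n. Qed.

(** The coefficient of [V B] is a sum over the sets [A] that contain [B]; it is
    the expansion of the product [agreement_weight B], where [A] collects the
    factors in which [- c] is chosen in [1 - c], or the only term [c]. *)
Lemma alternating_sum_weight :
  \sum_(A : {set 'I_K}) (N%:R ^+ #|A|)^-1 *
    \sum_(B : {set 'I_K} | B \subset A) (-1) ^+ (#|A| - #|B|) * V B =
  \sum_B V B * agreement_weight B.
Proof.
under eq_bigr do rewrite mulr_sumr.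
rewrite (exchange_big_dep xpredT)//=; apply: eq_bigr => B _.
rewrite /agreement_weight.
pose F k := if k \in B then c else - c; pose G k : R := if k \in B then 0 else 1.
under [X in _ = _ * X]eq_bigr => k _.
  rewrite (_ : (if _ then _ else _) = F k + G k); last first.
    by rewrite /F /G; case: ifP => _; rewrite ?addr0// addrC.
  over.
rewrite bigA_distr mulr_sumr [RHS](bigID (fun A : {set 'I_K} => B \subset A))/=.
rewrite [X in _ = _ + X]big1 ?addr0; last first.
  move=> A /subsetPn[k kB kA]; rewrite (bigD1 k)//= (negbTE kA) /G kB.
  by rewrite mul0r mulr0.
apply: eq_bigr => A BA.
have -> : \prod_i (if i \in A then F i else G i) =
    \prod_i ((if i \in A then c else 1) * (if i \in A :\: B then -1 else 1)).
  apply: eq_bigr => i _; rewrite /F /G finset.in_setD.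
  have := fintype.subsetP BA i.
  by case: (i \in A); case: (i \in B) => //= h; rewrite ?mulrN1 ?mulr1//; have := h isT.
rewrite big_split/= -!big_mkcond/= !prodr_const cardsDS// exprVn; ring.
Qed.

(** Exact agreement on [B] is a condition on each coordinate separately, so that
    the sum over pairs of selections is a product over the coordinates. *)
Lemma agreement_count (B : {set 'I_K}) :
  (N%:R ^+ K)^-1 ^+ 2 * \sum_(n : {ffun 'I_K -> 'I_N}) \sum_(n' : {ffun 'I_K -> 'I_N})
    ([set k | n k == n' k]%SET == B)%:R = agreement_weight B.
Proof.
pose a k (i j : 'I_N) : R := ((i == j) == (k \in B))%:R.
transitivity ((N%:R ^+ K)^-1 ^+ 2 *
    \sum_(n : {ffun 'I_K -> 'I_N}) \sum_(n' : {ffun 'I_K -> 'I_N})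
      \prod_k a k (n k) (n' k)).
  congr (_ * _); apply: eq_bigr => n _; apply: eq_bigr => n' _.
  have [E|nB] := eqVneq [set k | n k == n' k]%SET B.
    by rewrite big1// => k _; rewrite /a -E finset.inE eqxx.
  have [k kB] : exists k, (n k == n' k) != (k \in B).
    apply/existsP; rewrite -negb_forall; apply: contra nB => /forallP h.
    by apply/eqP/setP => k; rewrite finset.inE; exact: (eqP (h k)).
  by rewrite (bigD1 k)//= /a (negbTE kB) mul0r.
under eq_bigr => n _ do rewrite -(bigA_distr_bigA (fun k j => a k (n k) j)).
rewrite -(bigA_distr_bigA (fun k i => \sum_j a k i j)).
have -> : (N%:R ^+ K)^-1 ^+ 2 = \prod_(k < K) c ^+ 2.
  by rewrite prodr_const card_ord -exprVn exprAC.
rewrite -big_split/=; apply: eq_bigr => k _.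
transitivity (c ^+ 2 * \sum_(i < N) (if k \in B then 1 else N%:R - 1)).
  congr (_ * _); apply: eq_bigr => i _; rewrite /a.
  have e : \sum_(j < N) (i == j)%:R = 1 :> R.
    rewrite (bigD1 i)//= eqxx big1 ?addr0// => j ji.
    by rewrite eq_sym (negbTE ji).
  case: (k \in B); first by rewrite -[RHS]e; apply: eq_bigr => j _; rewrite eqb_id.
  transitivity (\sum_(j < N) (1 - (i == j)%:R : R)).
    by apply: eq_bigr => j _; case: (i == j); rewrite ?subrr ?subr0.
  by rewrite sumrB e sumr_const card_ord.
rewrite sumr_const card_ord -mulr_natr.
by case: ifP => _; field.
Qed.

Lemma agreement_sum :
  (N%:R ^+ K)^-1 ^+ 2 * \sum_(n : {ffun 'I_K -> 'I_N}) \sum_(n' : {ffun 'I_K -> 'I_N})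
    V [set k | n k == n' k]%SET = \sum_B V B * agreement_weight B.
Proof.
under [RHS]eq_bigr => B _ do rewrite -agreement_count mulrCA mulr_sumr.
rewrite -mulr_sumr; congr (_ * _).
under [RHS]eq_bigr => B _ do under eq_bigr do rewrite mulr_sumr.
rewrite [RHS]exchange_big/=; apply: eq_bigr => n _.
rewrite [RHS]exchange_big/=; apply: eq_bigr => n' _.
rewrite (bigD1 [set k | n k == n' k]%SET)//= eqxx mulr1 big1 ?addr0// => B nB.
by rewrite eq_sym (negbTE nB) mulr0.
Qed.

End agreement_weights.

(** * The cross-product estimator *)

Section iid_average.
Context d (T : measurableType d) d1 (Omega : measurableType d1) (R : realType).
Context (P : probability Omega R) (law : probability T R).
Variable Z : nat -> {RV P >-> T}.
Hypothesis iidZ : iid law Z.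
Variables (g : T -> R) (M : nat).
Hypothesis M0 : (0 < M)%N.

Let average w := (\sum_(i < M) g (Z i w)) / M%:R.

Let MR0 : M%:R != 0 :> R. Proof. by rewrite pnatr_eq0 -lt0n. Qed.

Lemma expectation_iid_average : law.-integrable setT (EFin \o g) ->
  'E_P[average]%E = (\int[law]_t g t)%:E.
Proof.
move=> ig; have mg := integrable_measurable ig.
have [iS eS] := Rintegral_sum (index_enum 'I_M)
  (fun i : 'I_M => integrable_iid iidZ i ig).
have ia : P.-integrable setT (EFin \o average).
  rewrite (_ : EFin \o average = EFin \o (fun w => M%:R^-1 * \sum_(i < M) g (Z i w))).
    exact: integrable_realZ.
  by apply/funext => w /=; rewrite /average mulrC.
rewrite expectation.unlock -[LHS]fineK; last exact: integrable_fin_num.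
congr EFin; rewrite -[LHS]/(\int[P]_w average w).
rewrite /average; under eq_Rintegral do rewrite mulrC.
rewrite (RintegralZl _ measurableT iS) eS.
under eq_bigr => i _ do rewrite /= (Rintegral_iid iidZ i mg).
by rewrite sumr_const card_ord -[X in _ * X]mulr_natl mulKf.
Qed.

Lemma variance_iid_average : g \in Lfun law 2%:E ->
  'V_P[average]%E =
  (\int[law]_t (g t - \int[law]_s g s) ^+ 2 / M%:R)%:E.
Proof.
move=> g2; set m := \int[law]_s g s.
have EX : 'E_P[average]%E = m%:E := expectation_iid_average (Lfun2_integrable g2).
pose u t := g t - m.
have u2 : u \in Lfun law 2%:E by exact: (Lfun2B g2 (Lfun2_cst law m)).
have u0 : \int[law]_t u t = 0.
  rewrite (RintegralB measurableT (Lfun2_integrable g2) (integrable_cst law m)).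
  by rewrite [X in _ - X](Rintegral_cst1 law) subrr.
have S2 := Lfun2_iid_sum iidZ M u2; have [mS iS] := (Lfun2P _ _).1 S2.
rewrite /variance covariance.unlock EX /= expectation.unlock.
transitivity (\int[P]_w (M%:R ^- 2 * (\sum_(i < M) u (Z i w)) ^+ 2)%:E)%E.
  apply: eq_integral => w _; congr EFin.
  rewrite /u sumrB sumr_const card_ord -[m *+ M]mulr_natr /= /average.
  set s := \sum_(i < M) _.
  rewrite -[LHS]/((s / M%:R - m) * (s / M%:R - m)); by field.
have iS' := integrable_realZ (M%:R ^- 2) iS.
rewrite -[LHS]fineK; last exact: (integrable_fin_num measurableT iS').
congr EFin; rewrite -[LHS]/(\int[P]_w (M%:R ^- 2 * (\sum_(i < M) u (Z i w)) ^+ 2)).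
rewrite (RintegralZl _ measurableT iS) (Rintegral_iid_sum_sqr iidZ M u2 u0).
by rewrite /u; field.
Qed.

End iid_average.

Section single_sample.
Context d0 (Theta : measurableType d0) (R : realType) (K : nat).
Context (d : 'I_K -> measure_display) (S : forall k, measurableType (d k)).
Variables (mu0 : probability Theta R) (Mk : forall k, R.-pker Theta ~> S k).
Variable phi : Theta * iprod S -> R.
Variable N : nat.
Hypothesis N0 : (0 < N)%N.
Local Notation mu := (kjoint mu0 (kprod Mk) : probability (Theta * iprod S)%type R).
Local Notation law := (sample_law mu0 Mk N).

(** The contribution of one sample: the estimator is the mean of these
    independent copies. *)
Definition cross_average (z : sample Theta S N) : R :=
  (N%:R ^+ K)^-1 * \sum_(n : {ffun 'I_K -> 'I_N}) phi (select n z).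

Lemma cross_estimatorE Omega (Z : nat -> Omega -> sample Theta S N) M w :
  cross_estimator phi Z M w = (\sum_(m < M) cross_average (Z m w)) / M%:R.
Proof. by rewrite -mulr_sumr mulrC mulrA -invfM. Qed.

Let card_selections : \sum_(n : {ffun 'I_K -> 'I_N}) (1 : R) = N%:R ^+ K.
Proof. by rewrite sumr_const card_ffun !card_ord natrX. Qed.

Let NK0 : N%:R ^+ K != 0 :> R.
Proof. by rewrite expf_neq0// pnatr_eq0 -lt0n. Qed.

Section integrable.
Hypothesis iphi : mu.-integrable setT (EFin \o phi).

Let sums := Rintegral_sum (index_enum {ffun 'I_K -> 'I_N})
  (fun n => integrable_image (measurable_select n) (select_law mu0 Mk n) iphi).

Lemma integrable_cross_average : law.-integrable setT (EFin \o cross_average).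
Proof. exact: (integrable_realZ _ sums.1). Qed.

Lemma Rintegral_cross_average : \int[law]_z cross_average z = \int[mu]_p phi p.
Proof.
have mphi := integrable_measurable iphi.
rewrite [LHS](RintegralZl _ measurableT sums.1) sums.2.
transitivity ((N%:R ^+ K)^-1 *
    \sum_(n : {ffun 'I_K -> 'I_N}) (\int[mu]_p phi p * 1)).
  congr (_ * _); apply: eq_bigr => n _; rewrite mulr1.
  exact: (Rintegral_image (measurable_select n) (select_law mu0 Mk n) mphi).
by rewrite -mulr_sumr card_selections mulrCA mulVf// mulr1.
Qed.

End integrable.

Hypotheses (phi2 : phi \in Lfun mu 2%:E) (hd : partial_int_defined Mk phi).

Lemma Lfun2_cross_average : cross_average \in Lfun law 2%:E.
Proof.
exact: (Lfun2Z _ (Lfun2_sum _ (fun n : {ffun 'I_K -> 'I_N} => Lfun2_select phi2 n))).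
Qed.

Lemma cross_average_sqr :
  \int[law]_z (cross_average z ^+ 2) =
  (N%:R ^+ K)^-1 ^+ 2 * \sum_(n : {ffun 'I_K -> 'I_N}) \sum_(n' : {ffun 'I_K -> 'I_N})
    partial_moment mu0 Mk phi [set k | n k == n' k]%SET.
Proof.
have inn (n n' : {ffun 'I_K -> 'I_N}) :=
  Lfun2_mul (Lfun2_select phi2 n) (Lfun2_select phi2 n').
have sn n := Rintegral_sum (index_enum {ffun 'I_K -> 'I_N}) (inn n).
have s := Rintegral_sum (index_enum {ffun 'I_K -> 'I_N}) (fun n => (sn n).1).
transitivity (\int[law]_z ((N%:R ^+ K)^-1 ^+ 2 * \sum_(n : {ffun 'I_K -> 'I_N})
   \sum_(n' : {ffun 'I_K -> 'I_N}) (phi (select n z) * phi (select n' z)))).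
  apply: eq_Rintegral => z _; rewrite exprMn; congr (_ * _).
  by rewrite expr2 mulr_suml; apply: eq_bigr => n _; rewrite mulr_sumr.
rewrite (RintegralZl _ measurableT s.1) s.2; congr (_ * _).
apply: eq_bigr => n _; rewrite (sn n).2; apply: eq_bigr => n' _.
exact: Rintegral_select_mul.
Qed.

(** Both sides are combinations of the moments [partial_moment B]. The variances
    in [asymptotic_variance] are the differences [V B] with [partial_moment set0],
    hence [V set0 = 0] and the sum over nonempty [A] extends to all [A]; the
    weights are then those of [alternating_sum_weight] and [agreement_sum]. *)
Lemma variance_cross_average :
  \int[law]_z (cross_average z - \int[law]_y cross_average y) ^+ 2 =
  asymptotic_variance Mk mu0 N phi.
Proof.
rewrite [LHS](Rintegral_sqrB Lfun2_cross_average) cross_average_sqr.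
rewrite (Rintegral_cross_average (Lfun2_integrable phi2)).
rewrite /asymptotic_variance (full_int_variance phi2).
pose V (B : {set 'I_K}) : R := partial_moment mu0 Mk phi B - partial_moment mu0 Mk phi finset.set0.
have V0 : V finset.set0 = 0 by rewrite /V subrr.

pose U (A : {set 'I_K}) : R := (N%:R ^+ #|A|)^-1 * \sum_(B : {set 'I_K} | B \subset A)
  (-1) ^+ (#|A| - #|B|) * V B.
transitivity (partial_moment mu0 Mk phi finset.set0 - (\int[mu]_p phi p) ^+ 2 +
  \sum_(A : {set 'I_K}) U A); last first.
  congr (_ + _); rewrite (bigD1 finset.set0)//= [U finset.set0]/U.
  rewrite (big_pred1 finset.set0); last by move=> B; rewrite finset.subset0.
  rewrite V0 !mulr0 add0r; apply: eq_bigr => A _; congr (_ * _).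
  apply: eq_bigr => B _; congr (_ * _).
  exact/esym/partial_full_variance.
rewrite /U alternating_sum_weight -(agreement_sum N0).
rewrite /V; under [X in _ = _ + _ * X]eq_bigr do rewrite sumrB.
rewrite sumrB mulrBr.
rewrite [X in _ = _ + (_ - X)](_ : _ = partial_moment mu0 Mk phi finset.set0).
  by ring.
rewrite -[partial_moment _ _ _ _]mulr1 -!mulr_sumr mulrCA.
under eq_bigr do rewrite card_selections -[N%:R ^+ K]mulr1.
by rewrite -mulr_sumr card_selections -expr2 -exprMn mulVf// expr1n mulr1.
Qed.

End single_sample.

Theorem theorem3 (R : realType) (K : nat) (K_gt1 : (1 < K)%N)
    (d0 : measure_display) (Theta : measurableType d0)
    (d : 'I_K -> measure_display) (S : forall k, measurableType (d k))
    (mu0 : probability Theta R) (Mk : forall k, R.-pker Theta ~> S k)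
    (phi : Theta * iprod S -> R) :
  let mu : probability (Theta * iprod S)%type R := kjoint mu0 (kprod Mk) in
  let mu_phi := \int[mu]_p phi p in
  mu.-integrable setT (EFin \o phi) ->
  (forall (N : nat), (0 < N)%N ->
   forall (d1 : measure_display) (Omega : measurableType d1)
     (P : probability Omega R)
     (Z : nat -> {RV P >-> sample Theta S N}),
   iid (sample_law mu0 Mk N) Z ->
   (forall M, (0 < M)%N -> 'E_P[cross_estimator phi Z M]%E = mu_phi%:E) /\
   {ae P, forall w, cross_estimator phi Z M w @[M --> \oo] --> mu_phi}) /\
  (phi \in Lfun mu 2%:E -> partial_int_defined Mk phi ->
   (forall A : {set 'I_K},
     partial_int Mk phi \in Lfun (kjoint mu0 (subkernel Mk A)) 2%:E) /\
   (forall (N : nat), (0 < N)%N ->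
    forall (d1 : measure_display) (Omega : measurableType d1)
      (P : probability Omega R)
      (Z : nat -> {RV P >-> sample Theta S N}),
    iid (sample_law mu0 Mk N) Z ->
    cvg_in_distribution P
      (fun M w => Num.sqrt M%:R * (cross_estimator phi Z M w - mu_phi))
      (normal_law 0 (asymptotic_variance Mk mu0 N phi)) /\
    (forall M, (0 < M)%N ->
      'V_P[cross_estimator phi Z M]%E =
      (asymptotic_variance Mk mu0 N phi / M%:R)%:E))).
Proof.
move=> mu mu_phi iphi; split.
  move=> N N0 d1 Omega P Z iidZ; split.
    move=> M M0; rewrite (_ : cross_estimator _ _ _ = fun w =>
      (\sum_(m < M) cross_average phi (Z m w)) / M%:R); last first.
      by apply/funext => w; exact: cross_estimatorE.
    rewrite (expectation_iid_average iidZ M0 (integrable_cross_average N iphi)).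
    by rewrite (Rintegral_cross_average N0 iphi).
  have := strong_law iidZ (integrable_cross_average N iphi).
  rewrite (Rintegral_cross_average N0 iphi); apply: filterS => w.
  rewrite (_ : (fun M => cross_estimator phi Z M w) =
      fun M => (\sum_(m < M) cross_average phi (Z m w)) / M%:R)//.
  by apply/funext => M; exact: cross_estimatorE.
move=> phi2 hd; split; first by move=> A; exact: (Lfun2_partial_int phi2).
move=> N N0 d1 Omega P Z iidZ.
have g2 := Lfun2_cross_average N phi2; split.
  have := central_limit iidZ g2.
  rewrite (variance_cross_average N0 phi2 hd) (Rintegral_cross_average N0 iphi).
  congr (cvg_in_distribution P _ _); apply/funext => M.
  by apply/funext => w; rewrite cross_estimatorE.
move=> M M0; rewrite (_ : cross_estimator _ _ _ = fun w =>
  (\sum_(m < M) cross_average phi (Z m w)) / M%:R); last first.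
  by apply/funext => w; exact: cross_estimatorE.
rewrite (variance_iid_average iidZ M0 g2) (variance_cross_average N0 phi2 hd).
by [].
Qed.
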